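(* Let $\mathbf X$ be a rough path cocycle and $\mathbf Z$ an $\mathbf X$-controlled rough path cocycle over an invertible measure-preserving dynamical system $(\Omega,\mathcal F,\mathbb P,\{\theta_t\}_{t\in\mathbb R})$. For $k\in\mathbb N$, $k\ge1$, assume $F\in C_b^{k+3}(W,\mathcal L(U,W))$ and $F_0\in C_b^{k+1}(W,W)$. Then, for every fixed $(t,\omega)$, the map $\phi_t^\omega$ belongs to $C^k\bigl(W\times\mathcal L(V,W),W\times\mathcal L(V,W)\bigr)$. Moreover, for $y,\xi\in W\times\mathcal L(V,W)$, the Fréchet derivative $\xi_t:=D_y\phi_t^\omega[\xi]$ is the solution of the variational equation $$d\xi_t=DF(\phi_t^\omega(y))\xi_t\,d\mathbf Z_t(\omega)+DF_0(\phi_t^\omega(y))\xi_t\,dt,\qquad\xi_0=\xi .$$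
   Context: $U,V,W$ are finite-dimensional Banach spaces, $\alpha\in(1/3,1/2]$, $X_{s,t}:=X_t-X_s$. $C_b^k$ denotes $k$-times continuously differentiable maps with bounded derivatives up to order $k$. An invertible measure-preserving dynamical system is a probability space with measurable, $\mathbb P$-preserving maps $\theta_t$, $t\in\mathbb R$, with $\theta_0=\mathrm{id}$, $\theta_{t+s}=\theta_t\circ\theta_s$ and $(t,\omega)\mapsto\theta_t\omega$ jointly measurable. An $\alpha$-Hölder rough path $\mathbf X=(X,\mathbb X)$ on an interval: $X$ is $V$-valued and $\alpha$-Hölder, $\mathbb X$ is $V\otimes V$-valued with $\sup\|\mathbb X_{s,t}\|/|t-s|^{2\alpha}<\infty$, and $\mathbb X_{s,t}=\mathbb X_{s,u}+\mathbb X_{u,t}+X_{s,u}\otimes X_{u,t}$. An $\mathbf X$-controlled path is $(Z,Z')$ with $Z'$ $\alpha$-Hölder and $R^Z_{s,t}=Z_{s,t}-Z'_sX_{s,t}$ satisfying $\sup\|R^Z_{s,t}\|/|t-s|^{2\alpha}<\infty$. On $\mathbb R$ these conditions are required on every compact interval. A rough path cocycle is a random process $\mathbf X=(X,\mathbb X)$ with each $\mathbf X(\omega)$ an $\alpha$-Hölder rough path on $\mathbb R$ over $V$ and $X_{s,s+t}(\omega)=X_{0,t}(\theta_s\omega)$, $\mathbb X_{s,s+t}(\omega)=\mathbb X_{0,t}(\theta_s\omega)$ for $s\in\mathbb R,t\ge0$. An $\mathbf X$-controlled rough path cocycle is a random process $\mathbf Z=(Z,Z')$, with values in $U\times\mathcal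 L(V,U)$, each $\mathbf Z(\omega)$ being $\mathbf X(\omega)$-controlled on $\mathbb R$, and $Z_{s,s+t}(\omega)=Z_{0,t}(\theta_s\omega)$, $Z'_{s+t}(\omega)=Z'_t(\theta_s\omega)$ for $s\in\mathbb R,t\ge0$. Controlled integral of an $\mathcal L(U,W)$-valued controlled path $(G,G')$: $\int_s^tG_r\,d\mathbf Z_r:=\lim_{|\mathcal P|\to0}\sum_{[u,v]}\bigl(G_uZ_{u,v}+G'_uZ'_u\mathbb X_{u,v}\bigr)$. $F(Y)$ has Gubinelli derivative $DF(Y)Y'$. Solution map: for $\omega\in\Omega$, $w\in W$, let $(Y,Y')$ be the unique $\mathbf X(\omega)$-controlled path with $Y_t=w+\int_0^tF(Y_r)\,d\mathbf Z_r(\omega)+\int_0^tF_0(Y_r)\,dr$, $Y'_t=F(Y_t)Z'_t(\omega)$, and put $\phi_t^\omega(w):=(Y_t,Y'_t)$. The value $w$ is associated with the initial state $(w,F(w)Z'_0(\omega))$, and for $(w,w')\in W\times\mathcal L(V,W)$, $\phi_t^\omega(w,w'):=\phi_t^\omega(w)$. Convention: the coefficients $F,F_0$ act on pairs through the first component. Thus the variational equation means that the first component $\eta_t$ of $\xi_t$ satisfies $\eta_t=\eta_0+\int_0^tDF(Y_r)\eta_r\,d\mathbf Z_r(\omega)+\int_0^tDF_0(Y_r)\eta_r\,dr$, where $Y$ is the first component of $\phi_\cdot^\omega(y)$ and $\eta_0$ is the first component of $\xi$, the second component of $\xi_t$ being the Gubinelli derivative $DF(Y_t)\eta_tZ'_t(\omega)$.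 *)

(* Defs.v *)
From HB Require Import structures.
From mathcomp Require Import all_boot all_order all_algebra.
From mathcomp Require Import all_classical all_reals all_analysis.
Set Implicit Arguments.
Unset Strict Implicit.
Unset Printing Implicit Defensive.
Import Order.TTheory GRing.Theory Num.Theory.
Import passmx.
Import numFieldNormedType.Exports.
Local Open Scope classical_set_scope.
Local Open Scope ring_scope.

(* Finite-dimensional normed spaces with an arbitrary norm. Over a realType
   they are complete, so these are the finite-dimensional Banach spaces. *)
#[short(type="normedVectType")]
HB.structure Definition NormedVector (R : numFieldType) :=
  {V of Vector R V & NormedModule R V}.

HB.instance Definition _ (R : numFieldType) (E F : normedVectType R) :=
  Vector.on (E * F)%type.
HB.instance Definition _ (R : numFieldType) := Vector.on R^o.

Section OperatorNorm.
Variables (R : realType) (E F : normedVectType R).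

Local Notation n := (\dim {:E}).
Local Notation vec := (vecof (vbasis {:E})).
Local Notation crd := (rVof (vbasis {:E})).

Let vecK : cancel vec crd.
Proof. exact/vecofK/vbasisP. Qed.

Let crdK : cancel crd vec.
Proof. exact/rVofK/vbasisP. Qed.

Let rV_coord_le (x : 'rV[R]_n) i : `|x ord0 i| <= `|x|.
Proof.
rewrite [leRHS]/Num.norm /= mx_normrE.
by apply/bigmax_geP; right => /=; exists (ord0, i).
Qed.

Let rV_bounded (G : normedVectType R) (h : {linear 'rV[R]_n -> G}) :
  exists2 C, 0 <= C & forall x, `|h x| <= C * `|x|.
Proof.
exists (\sum_i `|h (delta_mx 0 i)|); first exact: sumr_ge0.
move=> x; rewrite {1}(row_sum_delta x) linear_sum.
rewrite (le_trans (ler_norm_sum _ _ _))// mulr_suml.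
by apply: ler_sum => i _; rewrite linearZ normrZ mulrC ler_wpM2l.
Qed.

Let crd_bounded : exists2 C : R, 0 <= C & forall x : E, `|crd x| <= C * `|x|.
Proof.
pose S := [set x : 'rV[R]_n | `|x| = 1].
have SV (x : 'rV[R]_n) : x != 0 -> S (`|x|^-1 *: x).
  move=> x0; rewrite /S/= normrZ ger0_norm ?invr_ge0// mulVf//.
  by rewrite normr_eq0.
have [S0|S0] := pselect (S !=set0); last first.
  exists 0 => // x; rewrite mul0r; have [->|v0] := eqVneq (crd x) 0.
    by rewrite normr0.
  by exfalso; apply: S0; exists (`|crd x|^-1 *: crd x); exact: SV.
have [C C0 hC] := @rV_bounded E vec.
pose g (x : 'rV[R]_n) : R := `|vec x|.
have cg : continuous g.
  have cvec : continuous vec.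
    apply: bounded_linear_continuous; apply/linear_boundedP.
    exists C; split; first exact: ger0_real.
    by move=> M CM y; rewrite (le_trans (hC y))// ler_wpM2r// ltW.
  by move=> x; exact: (cvg_norm (cvec x)).
have cS : compact S.
  apply: bounded_closed_compact.
    exists 1; split; first exact: real1.
    by move=> M M1 x /= ->; exact: ltW.
  rewrite (_ : S = (@Num.norm R 'rV[R]_n) @^-1` [set 1])//.
  apply: closed_comp; last exact: closed_eq.
  by move=> x _; exact: norm_continuous.
have [c cin gc] := compact_EVT_min S0 cS (continuous_subspaceT cg).
have gc0 : 0 < g c.
  rewrite /g normr_gt0; apply/eqP => rc0.
  have c0 : c = 0 by rewrite -(vecK c) rc0 linear0.
  move: cin; rewrite inE /S/= c0 normr0 => /esym/eqP.
  by rewrite oner_eq0.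
exists (g c)^-1; first by rewrite invr_ge0 ltW.
move=> x; have [->|v0] := eqVneq (crd x) 0.
  by rewrite normr0 mulr_ge0// invr_ge0 ltW.
have /gc : `|crd x|^-1 *: crd x \in S by rewrite inE; exact: SV.
rewrite {2}/g linearZ normrZ/= crdK ger0_norm ?invr_ge0// => h.
by rewrite ler_pdivlMl// mulrC -ler_pdivlMl ?normr_gt0.
Qed.

Lemma lfun_bounded (f : 'Hom(E, F)) :
  exists2 C, 0 <= C & forall x, `|f x| <= C * `|x|.
Proof.
have [A A0 hA] := crd_bounded.
have [B B0 hB] := @rV_bounded F (f \o vec).
exists (B * A); first exact: mulr_ge0.
move=> x; rewrite -{1}(crdK x) (le_trans (hB (crd x)))//.
by rewrite -mulrA ler_wpM2l.
Qed.

Definition opnorm (f : 'Hom(E, F)) : R :=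
  sup [set `|f x| | x in [set x : E | `|x| <= 1]].

Let opnorm_has_sup (f : 'Hom(E, F)) :
  has_sup [set `|f x| | x in [set x : E | `|x| <= 1]].
Proof.
split; first by exists `|f 0|; exists 0 => //=; rewrite normr0.
have [C C0 hC] := lfun_bounded f; exists C => _ [x /= x1 <-].
by rewrite (le_trans (hC x))// ler_piMr.
Qed.

Lemma le_opnorm (f : 'Hom(E, F)) x : `|x| <= 1 -> `|f x| <= opnorm f.
Proof.
by move=> x1; apply: ub_le_sup; [exact: (opnorm_has_sup f).2 | exists x].
Qed.

Let opnorm_le (f : 'Hom(E, F)) M :
  (forall x, `|x| <= 1 -> `|f x| <= M) -> opnorm f <= M.
Proof.
move=> fM; apply: ge_sup; first exact: (opnorm_has_sup f).1.
by move=> _ [x /= x1 <-]; exact: fM.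
Qed.

Let opnorm_ge0 f : 0 <= opnorm f.
Proof. by apply: le_trans (@le_opnorm f 0 _); rewrite ?normr0. Qed.

Let opnormD f g : opnorm (f + g) <= opnorm f + opnorm g.
Proof.
apply: opnorm_le => x x1; rewrite add_lfunE (le_trans (ler_normD _ _))//.
by rewrite lerD// le_opnorm.
Qed.

Let opnormZ (l : R) f : opnorm (l *: f) = `|l| * opnorm f.
Proof.
have le (k : R) g : opnorm (k *: g) <= `|k| * opnorm g.
  by apply: opnorm_le => x x1; rewrite scale_lfunE normrZ ler_wpM2l// le_opnorm.
apply/eqP; rewrite eq_le le/=; have [->|l0] := eqVneq l 0.
  by rewrite normr0 mul0r.
rewrite -ler_pdivlMl ?normr_gt0// -normfV.
by rewrite {1}(_ : f = l^-1 *: (l *: f)) ?le// scalerA mulVf// scale1r.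
Qed.

Let opnorm_eq0 f : opnorm f = 0 -> f = 0.
Proof.
move=> f0; apply/lfunP => x; rewrite lfunE/=; have [->|x0] := eqVneq x 0.
  by rewrite linear0.
have : `|f (`|x|^-1 *: x)| <= 0.
  rewrite -f0 le_opnorm// normrZ ger0_norm ?invr_ge0// mulVf//.
  by rewrite normr_eq0.
rewrite normr_le0 linearZ/= scaler_eq0 invr_eq0 normr_eq0 (negbTE x0)/=.
by move/eqP.
Qed.

HB.instance Definition _ :=
  @Lmodule_isNormed.Build R 'Hom(E, F) opnorm opnormD opnormZ opnorm_eq0.

End OperatorNorm.

Section Smoothness.
Variable R : realType.

Definition frechet (E F : normedVectType R) (f : E -> F) (x : E) : 'Hom(E, F) :=
  linfun ('d f x).

Fixpoint Ck (k : nat) (E F : normedVectType R) (f : E -> F) {struct k} : Prop :=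
  match k with
  | 0 => continuous f
  | k'.+1 => (forall x, differentiable f x) /\ Ck k' (frechet f)
  end.

(* The derivative of order zero, i.e. the map itself, is bounded as well. *)
Fixpoint Cbk (k : nat) (E F : normedVectType R) (f : E -> F) {struct k} : Prop :=
  (exists M : R, forall x, `|f x| <= M) /\
  match k with
  | 0 => continuous f
  | k'.+1 => (forall x, differentiable f x) /\ Cbk k' (frechet f)
  end.

End Smoothness.

Section Tensor.
Variables (R : realType) (V : normedVectType R).

(* V (x) V, identified with L(V^*, V): the pure tensor x (x) y is the map
   l |-> l(x) y. Its norm is the injective cross norm; the choice of the norm
   is immaterial in finite dimension. *)
Definition tensor := 'Hom('Hom(V, R^o), V).
HB.instance Definition _ := NormedVector.on tensor.

Definition tens (x y : V) : tensor :=
  linfun (fun l : 'Hom(V, R^o) => (l x : R) *: y).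

(* The linear extension to V (x) V of a bilinear map B on V x V. *)
Definition tens_ext (E : normedVectType R) (B : V -> V -> E) (T : tensor) : E :=
  \sum_(i < \dim {:V}) B (vbasis {:V})`_i (T (linfun (coord (vbasis {:V}) i : V -> R^o))).

Lemma tens_ext_tens (E : normedVectType R) (B : 'Hom(V, 'Hom(V, E))) x y :
  tens_ext (fun u v => B u v) (tens x y) = B x y.
Proof.
have tl : linear (fun l : 'Hom(V, R^o) => (l x : R) *: y).
  move=> a l m; rewrite add_lfunE scale_lfunE.
  by rewrite [X in X *: _ = _](_ : _ = a * l x + m x)// scalerDl scalerA.
pose tL := GRing.isLinear.Build R _ _ _ _ tl.
pose t : {linear _ -> _} := HB.pack (fun l : 'Hom(V, R^o) => (l x : R) *: y) tL.
rewrite [in RHS](coord_vbasis (memvf x)) linear_sum sum_lfunE /tens_ext.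
apply: eq_bigr => i _; rewrite /tens -[X in linfun X]/(t : _ -> _) lfunE/=.
by rewrite !linearZ/= scale_lfunE lfunE.
Qed.

End Tensor.

Section RoughPath.
Variables (R : realType) (alpha : R).

Definition incr (E : normedVectType R) (X : R -> E) (s t : R) : E := X t - X s.

(* Finiteness of sup |A_{s,t}| / |t - s|^p over each compact interval. *)
Definition holder2 (E : normedVectType R) (p : R) (A : R -> R -> E) : Prop :=
  forall a b : R, exists C : R, forall s t : R,
    a <= s -> s < t -> t <= b -> `|A s t| / (t - s) `^ p <= C.

Definition is_rough_path (V : normedVectType R)
    (X : R -> V) (XX : R -> R -> tensor V) : Prop :=
  [/\ holder2 alpha (incr X), holder2 (2 * alpha) XX &
      forall s u t, s <= u -> u <= t ->
        XX s t = XX s u + XX u t + tens (incr X s u) (incr X u t)].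

Definition is_controlled (V E : normedVectType R) (X : R -> V)
    (Z : R -> E) (Z' : R -> 'Hom(V, E)) : Prop :=
  holder2 alpha (incr Z') /\
  holder2 (2 * alpha) (fun s t => incr Z s t - Z' s (incr X s t)).

(* A partition a = x_0 < x_1 < ... < x_n = b is encoded, as in itv_partition,
   by the sequence x_1, ..., x_n; it is empty when a = b. *)
Definition fine_partitions (a b : R) : set_system (seq R) :=
  filter_from [set e : R | 0 < e] (fun e => [set p | itv_partition a b p /\
    forall i, (i < size p)%N ->
      nth b (a :: p) i.+1 - nth b (a :: p) i < e]).

Definition partition_lim (E : normedVectType R) (Xi : R -> R -> E) (a b : R) : E :=
  lim ((fun p => \sum_(0 <= i < size p)
          Xi (nth b (a :: p) i) (nth b (a :: p) i.+1)) @ fine_partitions a b).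

Definition oriented (E : normedVectType R) (I : R -> R -> E) (s t : R) : E :=
  if s <= t then I s t else - I t s.

Definition controlled_int (U V W : normedVectType R) (XX : R -> R -> tensor V)
    (Z : R -> U) (Z' : R -> 'Hom(V, U))
    (G : R -> 'Hom(U, W)) (G' : R -> 'Hom(V, 'Hom(U, W))) : R -> R -> W :=
  oriented (partition_lim (fun u v =>
    G u (incr Z u v) + tens_ext (fun x y => G' u x (Z' u y)) (XX u v))).

(* Lebesgue integral of a vector-valued function, taken coordinatewise. *)
Definition time_int (W : normedVectType R) (g : R -> W) : R -> R -> W :=
  oriented (fun a b => \sum_(i < \dim {:W})
    Rintegral lebesgue_measure `[a, b] (fun r => coord (vbasis {:W}) i (g r))
      *: (vbasis {:W})`_i).

End RoughPath.

Section Equations.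
Variables (R : realType) (alpha : R) (U V W : normedVectType R).
Variables (X : R -> V) (XX : R -> R -> tensor V).
Variables (Z : R -> U) (Z' : R -> 'Hom(V, U)).
Variables (F : W -> 'Hom(U, W)) (F0 : W -> W).

Definition solves_rde (w : W) (Y : R -> W * 'Hom(V, W)) : Prop :=
  let y t := (Y t).1 in let y' t := (Y t).2 in
  [/\ is_controlled alpha X y y',
      forall t, y t = w
        + controlled_int XX Z Z' (fun r => F (y r))
            (fun r => (frechet F (y r) \o y' r)%VF) 0 t
        + time_int (fun r => F0 (y r)) 0 t
    & forall t, y' t = (F (y t) \o Z' t)%VF].

Definition rde_solution (w : W) : R -> W * 'Hom(V, W) :=
  get (unique (solves_rde w)).

(* The integrand DF(y) eta has Gubinelli derivative
   v |-> D^2F(y)[y' v] eta + DF(y)[eta' v]. *)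
Definition solves_variational (y : R -> W) (y' : R -> 'Hom(V, W)) (eta0 : W)
    (xi : R -> W * 'Hom(V, W)) : Prop :=
  let eta t := (xi t).1 in let eta' t := (xi t).2 in
  [/\ is_controlled alpha X eta eta',
      forall t, eta t = eta0
        + controlled_int XX Z Z' (fun r => frechet F (y r) (eta r))
            (fun r => linfun (fun v : V =>
               frechet (frechet F) (y r) (y' r v) (eta r)
               + frechet F (y r) (eta' r v))) 0 t
        + time_int (fun r => frechet F0 (y r) (eta r)) 0 t
    & forall t, eta' t = (frechet F (y t) (eta t) \o Z' t)%VF].

End Equations.

Section Cocycles.
Variables (R : realType) (d : measure_display) (Omega : measurableType d).
Variables (P : probability Omega R) (theta : R -> Omega -> Omega).

Record invertible_mpds : Prop := InvertibleMPDS {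
  mpds_measurable : forall t, measurable_fun setT (theta t);
  mpds_preserving : forall t A, measurable A -> P (theta t @^-1` A) = P A;
  mpds_id : theta 0 = idfun;
  mpds_flow : forall t s, theta (t + s) = theta t \o theta s;
  mpds_joint : measurable_fun setT
    (fun p : measurableTypeR R * Omega => theta p.1 p.2)
}.

Definition borel_measurable (E : normedVectType R) (f : Omega -> E) : Prop :=
  measurable_fun setT (f : Omega -> g_sigma_algebraType (@open E)).

Record rough_path_cocycle (alpha : R) (V : normedVectType R)
    (X : Omega -> R -> V) (XX : Omega -> R -> R -> tensor V) : Prop :=
  RoughPathCocycle {
  rpc_measurable1 : forall t, borel_measurable (fun w => X w t);
  rpc_measurable2 : forall s t, s <= t -> borel_measurable (fun w => XX w s t);
  rpc_rough_path : forall w, is_rough_path alpha (X w) (XX w);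
  rpc_shift1 : forall w s t, 0 <= t ->
    incr (X w) s (s + t) = incr (X (theta s w)) 0 t;
  rpc_shift2 : forall w s t, 0 <= t -> XX w s (s + t) = XX (theta s w) 0 t
}.

Record controlled_cocycle (alpha : R) (U V : normedVectType R)
    (X : Omega -> R -> V) (Z : Omega -> R -> U)
    (Z' : Omega -> R -> 'Hom(V, U)) : Prop := ControlledCocycle {
  cc_measurable1 : forall t, borel_measurable (fun w => Z w t);
  cc_measurable2 : forall t, borel_measurable (fun w => Z' w t);
  cc_controlled : forall w, is_controlled alpha (X w) (Z w) (Z' w);
  cc_shift1 : forall w s t, 0 <= t ->
    incr (Z w) s (s + t) = incr (Z (theta s w)) 0 t;
  cc_shift2 : forall w s t, 0 <= t -> Z' w (s + t) = Z' (theta s w) t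
}.

(* The second component of the state does not enter. *)
Definition solution_map (alpha : R) (U V W : normedVectType R)
    (X : Omega -> R -> V) (XX : Omega -> R -> R -> tensor V)
    (Z : Omega -> R -> U) (Z' : Omega -> R -> 'Hom(V, U))
    (F : W -> 'Hom(U, W)) (F0 : W -> W) (t : R) (w : Omega)
    (y : W * 'Hom(V, W)) : W * 'Hom(V, W) :=
  rde_solution alpha (X w) (XX w) (Z w) (Z' w) F F0 y.1 t.

End Cocycles.

(* Main.v *)
Require Import Defs.
From HB Require Import structures.
From mathcomp Require Import all_boot all_order all_algebra.
From mathcomp Require Import all_classical all_reals all_analysis.
From mathcomp Require Import ring lra zify.
Set Implicit Arguments.
Unset Strict Implicit.
Unset Printing Implicit Defensive.
Import Order.TTheory GRing.Theory Num.Theory.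
Import numFieldNormedType.Exports.
Local Open Scope classical_set_scope.
Local Open Scope ring_scope.

(** Everything is pathwise: for a fixed outcome, the statement is about one rough equation on the
whole line, driven by a path Z controlled by a rough path X.

The rough equation is rewritten in Davie's form. With Q(y) = DF(y) o F(y), the germ
  A_{s,t}(y) = F(y) Z_{s,t} + area_{s,t}(Q(y)) + (t - s) F_0(y)
predicts the increment over [s, t] of a solution that is at y at time s; here area_{s,t} is
the second level of Z, contracted with the coefficient Q(y). Writing
lw s t = (t - s)^alpha, a path Y solves the equation if and only if
Y_t - Y_s - A_{s,t}(Y_s) = O(lw s t ^ 3) for s <= t, uniformly on compact intervals
(solves_rdeP). In this form no integral is left, initial times and negative times need no
special treatment, and the same sentence describes the variational equation, with the
derivative of A in place of A (solves_variationalP). The passage between the two forms is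
the sewing lemma: a path whose increments are Xi_{s,t} + O(lw s t ^ 3) is the limit of the
Riemann sums of Xi, because 3 alpha > 1 (partition_lim_sewn); and the expansion of F(Y)
along Z identifies Xi with the germ (equation_davie, davie_equation).

The rest concerns an abstract germ A. What it has to satisfy is a bound on A by lw s t and on
its coboundary A_{s,t}(y) - A_{s,u}(y) - A_{u,t}(y + A_{s,u}(y)) by lw s u * lw u t * lw s t,
together with the same bounds for their derivatives. Davie paths exist, as limits of Euler
schemes (davie_exists); the Gronwall inequality for remainders (gronwall_sewing) makes two
Davie paths, as well as their remainders, stay close in proportion to their initial distance
(davie_stable). Hence there is a unique flow phi (flow_exists). Difference quotients of phi
are bounded, and each of their limit points is a path with linearised remainder of third
order; such paths are unique, so that phi is differentiable and its derivative is the
linearised flow (flow_isd).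

Higher derivatives come by induction. The pair (phi, D phi) is itself the flow of a germ, the
tangent germ (y, h) |-> (A_{s,t}(y), D A_{s,t}(y) h), which satisfies the same bounds with one
derivative less (regular_tangent, tangent_flow); so phi is as smooth as the coboundary of A
(flow_smooth). For the germ of the rough equation the coboundary contains a second-order
Taylor remainder of F, first differences of Q and first differences of F_0
(germ_coboundaryE). Its k-th derivatives are therefore bounded through the derivatives of F up to
order k + 2 and those of Q and F_0 up to order k + 1. *)

(** * Powers of the time step and a Gronwall inequality for remainders *)

(** The affine map M |-> th M + c contracts to its fixed point c / (1 - th); an a priori bound,
    however bad, only serves to start the iteration. *)
Lemma self_improve (R : realType) (T : Type) (P : T -> Prop) (f g : T -> R)
    (th c : R) :
  0 <= th < 1 -> 0 <= c -> (forall x, P x -> 0 <= g x) ->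
  (exists2 M, 0 <= M & forall x, P x -> f x <= M * g x) ->
  (forall M, 0 <= M -> (forall x, P x -> f x <= M * g x) ->
    forall x, P x -> f x <= (th * M + c) * g x) ->
  forall x, P x -> f x <= c / (1 - th) * g x.
Proof.
move=> /andP[th0 th1] c0 g0 [M0 M00 HM0] H x Px.
have th1' : 0 < 1 - th by rewrite subr_gt0.
have q0 : 0 <= c / (1 - th) by rewrite divr_ge0// ltW.
have iter n : forall x, P x -> f x <= (th ^+ n * M0 + c / (1 - th)) * g x.
  elim: n => [|n IH] y Py.
    rewrite expr0 mul1r (le_trans (HM0 _ Py))// ler_wpM2r ?g0// lerDl//.
  have /(_ _ y Py) := H _ _ IH.
  have -> : th * (th ^+ n * M0 + c / (1 - th)) + c =
            th ^+ n.+1 * M0 + c / (1 - th).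
    by rewrite exprS; field; rewrite gt_eqF.
  by apply; rewrite addr_ge0// mulr_ge0// exprn_ge0.
have thn : th ^+ n * M0 * g x + c / (1 - th) * g x @[n --> \oo]
    --> 0 * M0 * g x + c / (1 - th) * g x.
  apply: cvgD; last exact: cvg_cst.
  apply: cvgM; last exact: cvg_cst.
  apply: cvgM; last exact: cvg_cst.
  by apply: cvg_expr; rewrite ger0_norm.
rewrite !mul0r add0r in thn.
rewrite -(cvg_lim _ thn)//; apply: limr_ge; first by apply/cvg_ex; eexists; exact: thn.
by near=> n; rewrite -mulrDl; exact: iter.
Unshelve. all: by end_near. Qed.

Lemma le_of_eq (R : realType) (x y : R) : x = y -> x <= y.
Proof. by move=> ->. Qed.

Section Weight.
Variables (R : realType) (al : R).
Hypotheses (al3 : 3^-1 < al) (al2 : al <= 2^-1).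

(** The unit in which all orders are measured: cubes of it are summable along partitions since
    3 alpha > 1, and time is of the order of its square since 2 alpha <= 1. *)
Definition lw (s t : R) : R := (t - s) `^ al.
(** The factor by which the sum of lw ^ 3 over the pieces drops when an interval is cut in two
    pieces of at most 2/3 of its length. The ratio 2/3, instead of 1/2, makes room for the
    midpoints of a grid. *)
Definition theta : R := (2 / 3) `^ (3 * al - 1).

Lemma al0 : 0 < al. Proof. by apply: lt_trans al3; rewrite invr_gt0. Qed.
Hint Resolve al0 : core.
Lemma al31 : 0 < 3 * al - 1.
Proof. by rewrite subr_gt0 -ltr_pdivrMl// mulr1. Qed.

Lemma al21 : 2 * al <= 1.
Proof. by rewrite -ler_pdivlMl// mulr1. Qed.

Lemma lw_ge0 s t : 0 <= lw s t. Proof. exact: powR_ge0. Qed.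

Lemma lw_refl s : lw s s = 0.
Proof. by rewrite /lw subrr powR0// gt_eqF. Qed.

Lemma lw_le s s' t t' : s' <= s -> s <= t -> t <= t' -> lw s t <= lw s' t'.
Proof.
move=> ss st tt; rewrite /lw ge0_ler_powR ?nnegrE//; [have := al0; lra..].
Qed.

Lemma theta_gt0 : 0 < theta. Proof. by apply: powR_gt0; lra. Qed.

Lemma theta_lt1 : theta < 1.
Proof.
have := @gt0_ltr_powR R _ al31 (2 / 3) 1; rewrite /= powR1.
by apply; rewrite ?nnegrE//; lra.
Qed.

Lemma powR_al3 x : 0 <= x -> (x `^ al) ^+ 3 = x * x `^ (3 * al - 1).
Proof.
have a0 := al0; move=> x0; rewrite mulr_powRB1//; last lra.
by rewrite -powR_mulrn ?powR_ge0// -powRrM mulrC.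
Qed.

(** With x ^ (3 alpha) = x * x ^ (3 alpha - 1), the second factor of each piece gains theta
    because 3 alpha > 1. *)
Lemma cube_split x y : 0 <= x -> 0 <= y -> x <= 2 / 3 * (x + y) ->
  y <= 2 / 3 * (x + y) ->
  (x `^ al) ^+ 3 + (y `^ al) ^+ 3 <= theta * ((x + y) `^ al) ^+ 3.
Proof.
move=> x0 y0 hx hy; rewrite !powR_al3//; last exact: addr_ge0.
have h z : 0 <= z -> z <= 2 / 3 * (x + y) ->
    z `^ (3 * al - 1) <= theta * (x + y) `^ (3 * al - 1).
  move=> z0 hz; have a1 := al31; rewrite /theta -powRM//; [|lra..].
  by rewrite ge0_ler_powR ?nnegrE//; lra.
have -> : theta * ((x + y) * (x + y) `^ (3 * al - 1)) =
  x * (theta * (x + y) `^ (3 * al - 1)) + y * (theta * (x + y) `^ (3 * al - 1)).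
  by ring.
by rewrite lerD// ler_wpM2l// h.
Qed.

Lemma lw_cube_split s u t : s <= u -> u <= t -> u - s <= 2 / 3 * (t - s) ->
  t - u <= 2 / 3 * (t - s) ->
  lw s u ^+ 3 + lw u t ^+ 3 <= theta * lw s t ^+ 3.
Proof.
move=> su ut h1 h2; rewrite /lw.
have -> : t - s = (u - s) + (t - u) by ring.
by apply: cube_split; rewrite ?subr_ge0//; lra.
Qed.

Lemma lw_small e : 0 < e ->
  exists2 tau, 0 < tau & forall s t, s <= t -> t - s <= tau -> lw s t <= e.
Proof.
move=> e0; exists (e `^ al^-1); first exact: powR_gt0.
move=> s t st h; rewrite /lw.
have -> : e = (e `^ al^-1) `^ al by rewrite -powRrM mulVf ?gt_eqF// powRr1// ltW.
by rewrite ge0_ler_powR ?nnegrE ?powR_ge0//; [have := al0; lra..].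
Qed.

(** Hence first differences of the drift, multiplied by the time step, are of third order. *)
Lemma time_le_lw T : 0 <= T ->
  exists2 C, 0 <= C & forall s t, s <= t -> t - s <= T -> t - s <= C * lw s t ^+ 2.
Proof.
move=> T0; exists (T `^ (1 - 2 * al)); first exact: powR_ge0.
move=> s t st h; have [->|st0] := eqVneq (t - s) 0.
  by rewrite mulr_ge0 ?powR_ge0// sqr_ge0.
have h0 : 0 <= t - s by rewrite subr_ge0.
rewrite /lw -powR_mulrn ?powR_ge0// -powRrM [in X in _ <= X * _]mulrC.
rewrite -{1}(powRr1 h0) [X in (t - s) `^ X](_ : 1 = (1 - al * 2) + al * 2); last by ring.
rewrite powRD; last by apply/implyP.
have a21 := al21; rewrite ler_wpM2r ?powR_ge0// ge0_ler_powR ?nnegrE//; lra.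
Qed.

Lemma lw_bound T s t : s <= t -> t - s <= T -> lw s t <= T `^ al.
Proof.
by move=> st h; rewrite /lw ge0_ler_powR ?nnegrE//; [have := al0; lra..].
Qed.

(** Bisection: if r <= K lw ^ 3 then the two halves give r <= (th K + c) lw ^ 3, so that
    self_improve removes K from the conclusion. *)
Lemma sewing_bound (r : R -> R -> R) (a b th e C c K : R) :
  0 <= C -> 0 <= c -> 0 <= K -> 0 <= th < 1 -> (1 + C * e) * theta <= th ->
  (forall s t, a <= s -> s <= t -> t <= b -> lw s t <= e) ->
  (forall s t, a <= s -> s <= t -> t <= b -> 0 <= r s t <= K * lw s t ^+ 3) ->
  (forall s u t, a <= s -> s <= u -> u <= t -> t <= b ->
    r s t <= r s u + r u t + c * lw s t ^+ 3 + C * lw s t * r s u) ->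
  forall s t, a <= s -> s <= t -> t <= b -> r s t <= c / (1 - th) * lw s t ^+ 3.
Proof.
move=> C0 c0 K0 th01 eth le_e rK rS s t as_ st tb.
apply: (@self_improve R (R * R) (fun x => [/\ a <= x.1, x.1 <= x.2 & x.2 <= b])
  (fun x => r x.1 x.2) (fun x => lw x.1 x.2 ^+ 3) th c th01 c0 _ _ _ (s, t)) => //=.
- by move=> x _; rewrite exprn_ge0 ?lw_ge0.
- by exists K => // x [h1 h2 h3]; case/andP: (rK _ _ h1 h2 h3).
move=> {s t as_ st tb} M M0 HM [x y] /= [h1 h2 h3]; pose u := (x + y) / 2.
have [xu uy] : x <= u /\ u <= y by rewrite /u; split; clear -h2; lra.
have [ub au] := (le_trans uy h3, le_trans h1 xu).
have ru1 : r x u <= M * lw x u ^+ 3 by exact: (HM (x, u)).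
have ru2 : r u y <= M * lw u y ^+ 3 by exact: (HM (u, y)).
have l3 : lw x u ^+ 3 + lw u y ^+ 3 <= theta * lw x y ^+ 3.
  by apply: lw_cube_split => //; clear -h2; rewrite /u; lra.
have le := le_e _ _ h1 h2 h3.
have l30 : 0 <= lw x y ^+ 3 by rewrite exprn_ge0 ?lw_ge0.
have /andP[rxu0 _] := rK _ _ h1 xu ub.
have /andP[ruy0 _] := rK _ _ au uy h3.
apply: le_trans (rS x u y h1 xu uy h3) _.
have hC : C * lw x y * r x u <= C * e * r x u by rewrite ler_wpM2r// ler_wpM2l.
have hs : r x u + r u y <= M * (theta * lw x y ^+ 3).
  by apply: le_trans (lerD ru1 ru2) _; rewrite -mulrDr ler_wpM2l.
have Ce0 : 0 <= C * e by rewrite mulr_ge0// (le_trans _ le)// lw_ge0.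
have hs2 : (1 + C * e) * (r x u + r u y) <= (1 + C * e) * (M * (theta * lw x y ^+ 3)).
  by rewrite ler_wpM2l// addr_ge0.
have hs3 : (1 + C * e) * theta * (M * lw x y ^+ 3) <= th * (M * lw x y ^+ 3).
  by rewrite ler_wpM2r// mulr_ge0.
have hs4 : 0 <= C * e * r u y by rewrite mulr_ge0.
clear -hC hs2 hs3 hs4; lra.
Qed.

(** Two nested self-improvements: for a given bound M of d, sewing_bound controls r by M, and
    then d is at most d s + M / 2. Both directions of time are covered, since a flow started at
    time 0 has to be followed to negative times as well. *)
Lemma gronwall_short (d : R -> R) (r : R -> R -> R) (a b th e C K : R) :
  0 <= C -> 0 <= K -> 0 <= e -> e <= 1 -> 0 <= th < 1 ->
  (1 + C * e) * theta <= th -> (C + C / (1 - th)) * e <= 2^-1 ->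
  (forall s t, a <= s -> s <= t -> t <= b -> lw s t <= e) ->
  (forall t, 0 <= d t) ->
  (forall s t, a <= s -> s <= t -> t <= b -> [/\ d t <= d s + C * lw s t * d s + r s t,
      d s <= d t + C * lw s t * d s + r s t & 0 <= r s t <= K * lw s t ^+ 3]) ->
  (forall s u t, a <= s -> s <= u -> u <= t -> t <= b ->
    r s t <= r s u + r u t + C * (d s * lw s t ^+ 3 + lw s t * r s u)) ->
  forall s t, a <= s -> s <= b -> a <= t -> t <= b -> d t <= 2 * d s.
Proof.
move=> C0 K0 e0 e1 th01 eth eC le_e d0 H1 H2 s t as_ sb at_ tb.
have rK x y : a <= x -> x <= y -> y <= b -> 0 <= r x y <= K * lw x y ^+ 3.
  by move=> h1 h2 h3; have [] := H1 _ _ h1 h2 h3.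
have th1' : 0 <= 1 - th by case/andP: th01 => _ /ltW; rewrite subr_ge0.
have le_e3 x y : a <= x -> x <= y -> y <= b -> lw x y ^+ 3 <= e.
  move=> h1 h2 h3; apply: (@le_trans _ _ (e ^+ 3)).
    by rewrite lerXn2r ?nnegrE ?lw_ge0// le_e.
  by rewrite -[leRHS]expr1 ler_wiXn2l.
have -> : 2 * d s = d s / (1 - 2^-1) * 1 by field.
have h2 : 0 <= 2^-1 :> R by rewrite invr_ge0.
apply: (@self_improve R R (fun x => a <= x <= b) d (fun=> 1) 2^-1 (d s));
  rewrite ?d0 ?at_ ?tb ?h2//; first by rewrite invf_lt1// ltr1n.
- exists (d a + C * e * d a + K * e).
    by rewrite addr_ge0 ?mulr_ge0// addr_ge0 ?mulr_ge0.
  move=> x /andP[ax xb]; rewrite mulr1.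
  have [h _ /andP[_ rk]] := H1 a x (lexx a) ax xb.
  apply: (le_trans h); apply: lerD.
    by rewrite lerD2l ler_wpM2r// ler_wpM2l// le_e.
  by apply: (le_trans rk); rewrite ler_wpM2l// le_e3.
move=> M M0 HM x /andP[ax xb]; rewrite mulr1.
have dM y : a <= y -> y <= b -> d y <= M.
  by move=> ay yb; rewrite -[M]mulr1; apply: HM; rewrite ay.
have A y z : a <= y -> y <= z -> z <= b -> r y z <= C * M / (1 - th) * lw y z ^+ 3.
  apply: (sewing_bound C0 _ K0 th01 eth le_e rK); first exact: mulr_ge0.
  move=> p q v ap pq qv vb; apply: (le_trans (H2 p q v ap pq qv vb)).
  rewrite -[leRHS]addrA lerD2l mulrDr -!mulrA lerD2r ler_wpM2l//.
  by rewrite ler_wpM2r ?exprn_ge0 ?lw_ge0// dM// (le_trans pq)// (le_trans qv).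
have key y z : a <= y -> y <= z -> z <= b -> C * lw y z * d y + r y z <= 2^-1 * M.
  move=> ay yz zb; apply: (@le_trans _ _ (C * e * M + C / (1 - th) * e * M)).
    apply: lerD; last first.
      rewrite -mulrA [e * M]mulrC mulrA; apply: le_trans (A _ _ ay yz zb) _.
      rewrite -[C * M / _]mulrAC ler_wpM2l// ?le_e3//.
      by rewrite !mulr_ge0// invr_ge0.
    rewrite ler_pM// ?mulr_ge0 ?lw_ge0//; last by rewrite dM// (le_trans yz).
    by rewrite ler_wpM2l// le_e.
  by rewrite -mulrDl ler_wpM2r// -mulrDl.
have [xs|/ltW sx] := lerP x s.
  have [_ h _] := H1 x s ax xs sb; have k := key x s ax xs sb.
  clear -h k; lra.
have [h _ _] := H1 s x as_ sx xb; have k := key s x as_ sx xb.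
clear -h k; lra.
Qed.

(** The segment from 0 to t is cut into n + 1 steps of length at most tau; each costs a factor 2. *)
Lemma gronwall_chain (d : R -> R) (T tau : R) : 0 <= tau ->
  (forall a b, - T <= a -> b <= T -> b - a <= tau -> forall s t,
     a <= s -> s <= b -> a <= t -> t <= b -> d t <= 2 * d s) ->
  forall n t, - T <= t <= T -> `|t| <= n%:R * tau -> d t <= 2 ^+ n * d 0.
Proof.
move=> tau0 step; elim=> [|n IH] t /andP[Tt tT].
  by rewrite mul0r normr_le0 => /eqP->; rewrite mul1r.
move=> tn; pose c := n%:R / n.+1%:R : R.
have n1 : 0 < n.+1%:R :> R by rewrite ltr0n.
have cE : c * n.+1%:R = n%:R by rewrite /c divfK// gt_eqF.
have c01 : 0 <= c <= 1 by rewrite /c divr_ge0//= ler_pdivrMr// mul1r ler_nat.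
clearbody c; have [c0 c1] := andP c01.
have ctn : `|c * t| <= n%:R * tau.
  by rewrite normrM ger0_norm// -cE -mulrA ler_wpM2l.
have tct : `|t - c * t| <= tau.
  have -> : t - c * t = (1 - c) * t by ring.
  rewrite normrM ger0_norm ?subr_ge0//.
  have -> : tau = (1 - c) * (n.+1%:R * tau).
    by rewrite mulrA mulrBl cE mul1r -[n.+1%:R]natr1; ring.
  by rewrite ler_wpM2l// subr_ge0.
have /andP[Tct ctT] : - T <= c * t <= T.
  rewrite -ler_norml normrM ger0_norm// (@le_trans _ _ `|t|)// ?ler_norml ?Tt//.
  by rewrite ler_piMl.
apply: (@le_trans _ _ (2 * d (c * t))); last first.
  by rewrite exprS -mulrA ler_wpM2l// IH// Tct.
move: tct; rewrite ler_norml => /andP[h1 h2].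
have [h|/ltW h] := lerP t (c * t).
  by apply: (step t (c * t)) => //; clear -h1; lra.
exact: (step (c * t) t).
Qed.

(** The source of all stability: d is the distance of two paths and r the size of the
    difference of their third-order remainders. The point is that the bound K on r is not
    quantitative, while L depends on T and C only and both conclusions are proportional to d 0. *)
Lemma gronwall_sewing T C : 0 <= T -> 0 <= C -> exists2 L, 0 <= L &
  forall (d : R -> R) (r : R -> R -> R),
  (forall t, 0 <= d t) ->
  (forall s t, - T <= s -> s <= t -> t <= T ->
     [/\ d t <= d s + C * lw s t * d s + r s t,
      d s <= d t + C * lw s t * d s + r s t &
      0 <= r s t <= C * (d s + d t)]) ->
  (forall s u t, - T <= s -> s <= u -> u <= t -> t <= T ->
     r s t <= r s u + r u t + C * (d s * lw s t ^+ 3 + lw s t * r s u)) ->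
  (exists2 K, 0 <= K & forall s t, - T <= s -> s <= t -> t <= T ->
     r s t <= K * lw s t ^+ 3) ->
  (forall t, - T <= t -> t <= T -> d t <= L * d 0) /\
  (forall s t, - T <= s -> s <= t -> t <= T -> r s t <= L * lw s t ^+ 3 * d 0).
Proof.
move=> T0 C0; have th0 := theta_gt0; have th1 := theta_lt1.
have [th [C1 [e [th01 C1E C10 [e0 e1 eC eth]]]]] : exists th C1 e,
    [/\ 0 <= th < 1, C1 = C / (1 - th), 0 <= C1 & [/\ 0 < e, e <= 1,
    (C + C1) * e <= 2^-1 & (1 + C * e) * theta <= th]].
  (* Any th strictly between theta and 1 will do; e is then small enough for the hypotheses of
     both sewing_bound and gronwall_short on intervals of weight at most e. *)
  exists ((1 + theta) / 2), (C / (1 - (1 + theta) / 2)).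
  have th1' : 0 < 1 - (1 + theta) / 2 by clear -th1; lra.
  have C10 : 0 <= C / (1 - (1 + theta) / 2) by rewrite divr_ge0// ltW.
  set C1 := C / _ in C10 *; clearbody C1.
  exists (Num.min 1 (Num.min (2 * (C + C1 + 1))^-1 ((1 - theta) / (2 * (C + 1))))).
  set e := Num.min _ _.
  have C11 : 0 < 2 * (C + C1 + 1) by clear -C0 C10; lra.
  have C2 : 0 < 2 * (C + 1) by clear -C0; lra.
  have e0 : 0 < e.
    by rewrite /e !lt_min ltr01 invr_gt0 divr_gt0 ?subr_gt0 ?andbT.
  have e1 : e <= 1 by rewrite /e ge_min lexx.
  split=> //; first by clear -th0 th1; lra.
  split=> //.
    have : e <= (2 * (C + C1 + 1))^-1 by rewrite /e !ge_min lexx !orbT.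
    rewrite -[_^-1]mul1r ler_pdivlMr// -[2^-1]mul1r ler_pdivlMr//.
    by clear -e0; lra.
  have : e <= (1 - theta) / (2 * (C + 1)) by rewrite /e !ge_min lexx !orbT.
  rewrite ler_pdivlMr// => h.
  have : C * e * theta <= C * e by rewrite ler_piMr// ?mulr_ge0// ltW.
  by clear -h e0; lra.
have [tau tau0 htau] := lw_small e0.
have [N hN] : exists N : nat, T <= N%:R * tau.
  exists (Num.trunc (T / tau)).+1.
  by rewrite -ler_pdivrMr//; apply/ltW/truncnS_gt.
have [q q0 hq] : exists2 q : R, 0 <= q & forall s t, tau <= t - s -> 1 <= lw s t ^+ 3 * q.
  exists ((tau `^ al) ^- 3); first by rewrite invr_ge0 exprn_ge0// powR_ge0.
  move=> s t h; rewrite ler_pdivlMr ?mul1r ?exprn_gt0 ?powR_gt0//.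
  rewrite lerXn2r ?nnegrE ?lw_ge0 ?powR_ge0//.
  have h0 := le_trans (ltW tau0) h.
  by rewrite /lw ge0_ler_powR ?nnegrE ?(ltW tau0) ?(ltW al0).
have [p p0 pE] : exists2 p : R, 0 <= p & p = 2 ^+ N by exists (2 ^+ N).
exists (p + C1 * p + 2 * C * p * q); first by rewrite !addr_ge0// !mulr_ge0.
move=> d r d0 H1 H2 [K K0 H3].
have dL t : - T <= t -> t <= T -> d t <= p * d 0.
  move=> Tt tT; rewrite pE; apply: (@gronwall_chain d T tau); rewrite ?(ltW tau0) ?Tt//.
    move=> a b Ta bT ba; rewrite C1E in eC.
    apply: (@gronwall_short d r a b _ _ _ _ C0 K0 (ltW e0) e1 th01 eth eC) => //.
    - move=> x y ax xy yb; apply: htau => //; apply: le_trans ba.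
      by rewrite lerB.
    - move=> x y ax xy yb; have Tx := le_trans Ta ax; have yT := le_trans yb bT.
      by have [h1 h2 /andP[-> _]] := H1 x y Tx xy yT; split=> //; exact: H3.
    - move=> x u y ax xu uy yb; have Tx := le_trans Ta ax.
      by have yT := le_trans yb bT; exact: H2.
  by apply: le_trans hN; rewrite ler_norml Tt.
split=> [t Tt tT|s t Ts st tT].
  apply: le_trans (dL t Tt tT) _; rewrite ler_wpM2r// -addrA lerDl.
  by rewrite addr_ge0// !mulr_ge0.
have ds := dL s Ts (le_trans st tT); have dt := dL t (le_trans Ts st) tT.
have l30 : 0 <= lw s t ^+ 3 by rewrite exprn_ge0 ?lw_ge0.
have [|/ltW] := lerP (t - s) tau => h.
  have hh : r s t <= C * (p * d 0) / (1 - th) * lw s t ^+ 3.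
    apply: (@sewing_bound _ s t _ e C _ K) => //; first by rewrite !mulr_ge0.
    - move=> x y sx xy yt; apply: htau => //; apply: le_trans h.
      by rewrite lerB.
    - move=> x y sx xy yt; have Tx := le_trans Ts sx; have yT := le_trans yt tT.
      by have [_ _ /andP[-> _]] := H1 x y Tx xy yT; exact: H3.
    - move=> x u y sx xu uy yt; have Tx := le_trans Ts sx; have yT := le_trans yt tT.
      apply: (le_trans (H2 x u y Tx xu uy yT)).
      rewrite -[leRHS]addrA lerD2l mulrDr -![C * _ * _]mulrA lerD2r ler_wpM2l//.
      by rewrite ler_wpM2r ?exprn_ge0 ?lw_ge0// dL// (le_trans xu)// (le_trans uy).
  apply: (le_trans hh).
  have -> : C * (p * d 0) / (1 - th) * lw s t ^+ 3 = C1 * p * lw s t ^+ 3 * d 0.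
    by rewrite C1E; ring.
  rewrite ler_wpM2r// ler_wpM2r// -addrA addrCA lerDl.
  by rewrite addr_ge0// !mulr_ge0.
have [_ _ /andP[_ hr]] := H1 s t Ts st tT.
apply: (le_trans hr); apply: (@le_trans _ _ (2 * C * p * d 0 * (lw s t ^+ 3 * q))).
  apply: (@le_trans _ _ (2 * C * p * d 0)).
    have : C * (d s + d t) <= C * (p * d 0 + p * d 0) by rewrite ler_wpM2l// lerD.
    by clear; lra.
  by rewrite ler_peMr ?hq// !mulr_ge0.
have -> : 2 * C * p * d 0 * (lw s t ^+ 3 * q) = 2 * C * p * q * lw s t ^+ 3 * d 0.
  by ring.
rewrite ler_wpM2r// ler_wpM2r// lerDr.
by rewrite addr_ge0// !mulr_ge0.
Qed.

End Weight.

(** * Finite-dimensional analysis: ultrafilter limits and mean values *)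

Section UltraLimits.

Lemma ultra_fmap (I J : Type) (f : I -> J) (F : set_system I) :
  UltraFilter F -> UltraFilter (f @ F).
Proof.
move=> FU; split=> [|G GF sFG]; first exact: fmap_proper_filter.
rewrite predeqE => A; split; last exact: sFG.
move=> GA; have [//|FnA] := in_ultra_setVsetC (f @^-1` A) FU.
have /(filterI GA) : G (~` A) by apply: sFG.
by rewrite setICr => /filter_not_empty.
Qed.

(** Compactness is used through finer ultrafilters instead of subsequences: a limit that does
    not depend on the ultrafilter is a limit along the filter itself. *)
Lemma cvg_of_ultra (I : Type) (T : topologicalType) (F : set_system I)
    (f : I -> T) (l : T) : Filter F ->
  (forall G, UltraFilter G -> F `<=` G -> f @ G --> l) -> f @ F --> l.
Proof.
move=> FF H A nA; apply: contrapT => nF.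
have WP : ProperFilter (within (~` (f @^-1` A)) F).
  apply: Build_ProperFilter_ex.
  move=> B FB; apply: contrapT => nB; apply: nF.
  change (F (f @^-1` A)).
  apply: (@filterS _ F _ [set x | (~` (f @^-1` A)) x -> B x]) FB => x Bx.
  by apply: contrapT => nAx; apply: nB; exists x; exact: Bx.
have [G [GU sWG]] := ultraFilterLemma WP.
have sFG : F `<=` G by move=> B FB; apply: sWG; apply: filterS FB => x.
have GA : G (f @^-1` A) by exact: (H G GU sFG A nA).
have GnA : G (~` (f @^-1` A)) by apply: sWG; apply: nearW.
have GF : Filter G by exact: filter_filter.
by have := @filterI _ _ GF _ _ GA GnA; rewrite setICr; exact: filter_not_empty.
Qed.

End UltraLimits.

Section FiniteDim.
Variable R : realType.
Implicit Types E G H : normedVectType R.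

Lemma lfun_norm_le E G (f : 'Hom(E, G)) x : `|f x| <= `|f| * `|x|.
Proof.
have [->|x0] := eqVneq x 0; first by rewrite linear0 !normr0 mulr0.
have nx : 0 < `|x| by rewrite normr_gt0.
have := @le_opnorm _ _ _ f (`|x|^-1 *: x).
rewrite normrZ ger0_norm ?invr_ge0// mulVf ?gt_eqF// => /(_ (lexx _)).
by rewrite linearZ/= normrZ ger0_norm ?invr_ge0// mulrC ler_pdivrMr.
Qed.

Lemma norm_lfun_le E G (f : 'Hom(E, G)) M : 0 <= M ->
  (forall x, `|f x| <= M * `|x|) -> `|f| <= M.
Proof.
move=> M0 fM; apply: ge_sup; first by exists `|f 0|; exists 0 => //=; rewrite normr0.
by move=> _ [x /= x1 <-]; apply: le_trans (fM x) _; rewrite ler_piMr.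
Qed.

Lemma linear_bounded E G (f : {linear E -> G}) :
  exists2 C, 0 <= C & forall x, `|f x| <= C * `|x|.
Proof.
have [C C0 hC] := lfun_bounded (linfun f).
by exists C => // x; have := hC x; rewrite lfunE.
Qed.

Lemma linear_cont E (G : normedModType R) (f : {linear E -> G}) :
  (exists2 C, 0 <= C & forall x, `|f x| <= C * `|x|) -> continuous f.
Proof.
move=> [C C0 hC]; apply: bounded_linear_continuous; apply/linear_boundedP.
exists C; split; first exact: ger0_real.
by move=> M CM y; rewrite (le_trans (hC y))// ler_wpM2r// ltW.
Qed.

Lemma fdlin_continuous E G (f : {linear E -> G}) : continuous f.
Proof. exact: linear_cont (linear_bounded f). Qed.

(** Coordinates with values in R, rather than in R^o, so that ring sees their codomain. *)
Definition crd E (i : 'I_(\dim {:E})) : E -> R := coord (vbasis {:E}) i.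

HB.instance Definition _ E i := GRing.Linear.copy (@crd E i) (coord (vbasis {:E}) i : E -> R^o).

Lemma crdZ E i k (x : E) : crd i (k *: x) = k * crd i x.
Proof. exact: linearZ. Qed.

Lemma crdD E i (x y : E) : crd i (x + y) = crd i x + crd i y.
Proof. exact: linearD. Qed.

Lemma crdN E i (x : E) : crd i (- x) = - crd i x.
Proof. exact: linearN. Qed.

Lemma crdE E (x : E) : x = \sum_i crd i x *: (vbasis {:E})`_i.
Proof. exact: (coord_vbasis (memvf x)). Qed.

Lemma crd_inj E (x y : E) : (forall i, crd i x = crd i y) -> x = y.
Proof. by move=> h; rewrite (crdE x) (crdE y); apply: eq_bigr => i _; rewrite h. Qed.

Lemma crd_bounded E : exists2 C, 0 <= C & forall i (x : E), `|crd i x| <= C * `|x|.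
Proof.
have /choice[c hc] : forall i, exists C, 0 <= C /\ forall x : E, `|crd i x| <= C * `|x|.
  move=> i; have [C C0 hC] := @linear_bounded E R^o (coord (vbasis {:E}) i : E -> R^o).
  by exists C; split.
exists (\sum_i c i); first by apply: sumr_ge0 => i _; case: (hc i).
move=> i x; apply: le_trans ((hc i).2 x) _; rewrite ler_wpM2r//.
by rewrite (bigD1 i)//= lerDl sumr_ge0// => j _; case: (hc j).
Qed.

Lemma norm_le_crd E : exists2 C, 0 <= C &
  forall (x : E) M, 0 <= M -> (forall i, `|crd i x| <= M) -> `|x| <= C * M.
Proof.
exists (\sum_(i < \dim {:E}) `|(vbasis {:E})`_i|); first exact: sumr_ge0.
move=> x M M0 hM; rewrite {1}(crdE x) (le_trans (ler_norm_sum _ _ _))// mulr_suml.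
by apply: ler_sum => i _; rewrite normrZ mulrC ler_wpM2l.
Qed.

Lemma crd_continuous E i : continuous (@crd E i).
Proof.
apply: (@linear_cont E R (@crd E i)).
by have [C C0 hC] := crd_bounded E; exists C => // x; exact: hC.
Qed.

(** The finite-dimensional form of the theorem of Bolzano and Weierstrass. *)
Lemma ultra_cvg E (I : Type) (F : set_system I) (f : I -> E) K :
  UltraFilter F -> (\forall i \near F, `|f i| <= K) -> exists l : E, f @ F --> l.
Proof.
move=> FU fK; have [C C0 hC] := crd_bounded E.
have /choice[l hl] : forall j, exists l : R, (crd j \o f) @ F --> l.
  move=> j; pose A : set R := `[- (C * K), C * K]%classic.
  have germ_continuous : compact A by exact: segment_compact.
  rewrite compact_ultra in germ_continuous.
  have [|l [_ hl]] := germ_continuous ((crd j \o f) @ F) (ultra_fmap _ FU); last by exists l.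
  apply: filterS fK => i fi; rewrite /A /= in_itv/= -ler_norml.
  by apply: le_trans (hC j (f i)) _; rewrite ler_wpM2l.
exists (\sum_j l j *: (vbasis {:E})`_j).
rewrite (_ : f = (fun i => \sum_j (crd j \o f) i *: (vbasis {:E})`_j)); last first.
  by apply/funext => i /=; rewrite -crdE.
apply: cvg_big => //=; first exact: add_continuous.
by move=> j _; apply: cvgZ; [exact: hl | exact: cvg_cst].
Qed.

Lemma lim_le (I : Type) (F : set_system I) (f g : I -> R) (l c : R) :
  ProperFilter F -> f @ F --> l -> g @ F --> c ->
  (\forall i \near F, f i <= g i) -> l <= c.
Proof.
move=> FF fl gc fg; apply/ler_addgt0Pr => e e0.
have e2 : 0 < e / 2 by rewrite divr_gt0.
move/cvgrPdist_lt : fl => /(_ _ e2) fl; move/cvgrPdist_lt : gc => /(_ _ e2) gc.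
have [i [[/= + +] h]] := filter_ex (filterI (filterI fl gc) fg).
rewrite !ltr_norml => /andP[h1 h2] /andP[h3 h4].
by clear -h h1 h2 h3 h4; lra.
Qed.

Lemma lim_norm_le (G : normedModType R) (I : Type) (F : set_system I)
  (f : I -> G) (g : I -> R) (l : G) (c : R) :
  ProperFilter F -> f @ F --> l -> g @ F --> c ->
  (\forall i \near F, `|f i| <= g i) -> `|l| <= c.
Proof.
move=> FF fl gc fg; have nl : (fun i => `|f i|) @ F --> `|l| by exact: cvg_norm.
exact: (lim_le FF nl gc fg).
Qed.

Lemma cvg_dist0 (G : normedModType R) (I : Type) (F : set_system I)
  (f : I -> G) (l : G) : Filter F ->
  f @ F --> l -> (fun i => `|f i - l|) @ F --> (0 : R).
Proof.
move=> FF /cvgrPdist_lt fl; apply/cvgrPdist_lt => e e0; move: (fl e e0).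
by apply: filterS => i; rewrite sub0r normrN normr_id distrC.
Qed.

Lemma cvg_squeeze (G : normedModType R) (I : Type) (F : set_system I)
  (f : I -> G) (g : I -> R) (l : G) :
  Filter F -> g @ F --> (0 : R) ->
  (\forall i \near F, `|f i - l| <= g i) -> f @ F --> l.
Proof.
move=> FF g0 fg; apply/cvgrPdist_lt => e e0.
move/cvgrPdist_lt : g0 => /(_ e e0) g0.
near=> i; rewrite distrC (@le_lt_trans _ _ (g i))//; first by near: i.
apply: le_lt_trans (ler_norm _) _; rewrite -normrN -[- g i]add0r.
by near: i.
Unshelve. all: by end_near. Qed.

(** The fixed point of the contraction y |-> w - A y. It inverts one Euler step, which is what
    continues solutions to negative times. *)
Lemma lipschitz_surj E (A : E -> E) : (forall x y, `|A x - A y| <= 2^-1 * `|x - y|) ->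
  forall w, exists y, y + A y = w.
Proof.
move=> lipA w; pose y n := iter n (fun z => w - A z) w.
have yS n : y n.+1 = w - A (y n) by [].
have yb n : `|y n - w| <= 2 * `|A w|.
  elim: n => [|n IH]; first by rewrite subrr normr0 mulr_ge0.
  rewrite yS addrAC subrr add0r normrN -[A _](subrK (A w)).
  apply: le_trans (ler_normD _ _) _; have := lipA (y n) w.
  by clear -IH; lra.
have yd n : `|y n.+1 - y n| <= `|A w| * (2^-1) ^+ n.
  elim: n => [|n IH]; first by rewrite yS /= addrAC subrr add0r normrN mulr1.
  rewrite yS {2}yS opprB [w - _]addrC addrACA subrr addr0 addrC distrC.
  by apply: le_trans (lipA _ _) _; rewrite exprS mulrCA ler_wpM2l.
have [G [GU sG]] := ultraFilterLemma (@eventually_filter).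
have [|l hl] := @ultra_cvg E nat G y (2 * `|A w| + `|w|) GU.
  by apply: nearW => n; rewrite -[y n](subrK w) (le_trans (ler_normD _ _))// lerD2r.
have hg : (fun n => `|A w| * (2^-1) ^+ n : R) @ G --> (0 : R).
  suff : `|A w| * 2^-1 ^+ n @[n --> \oo] --> (0 : R) by move=> h A' /h /sG.
  rewrite -[X in _ --> X](mulr0 `|A w|); apply: cvgM; first exact: cvg_cst.
  by apply: cvg_expr; rewrite ger0_norm ?invr_ge0// invf_lt1 ?ltr1n.
have hyS : (fun n => y n.+1) @ G --> l.
  rewrite (_ : (fun n => y n.+1) = (fun n => (y n.+1 - y n) + y n)); last first.
    by apply/funext => n; rewrite subrK.
  rewrite -[X in _ --> X]add0r; apply: cvgD => //.
  apply: (@cvg_squeeze E nat G _ (fun n => `|A w| * (2^-1) ^+ n)) => //.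
  by apply: nearW => n; rewrite subr0.
have hyS' : (fun n => y n.+1) @ G --> w - A l.
  apply: cvgB; first exact: cvg_cst.
  apply: (@cvg_squeeze E nat G _ (fun n => 2^-1 * `|y n - l|)).
    rewrite -[X in _ --> X](mulr0 2^-1); apply: cvgM; first exact: cvg_cst.
    exact: cvg_dist0.
  by apply: nearW => n; exact: lipA.
exists l; rewrite [X in X + _](_ : l = w - A l) ?subrK//.
exact: (cvg_unique _ hyS hyS').
Qed.

Lemma is_diff_continuous E G (f : E -> G) df x : is_diff x f df -> {for x, continuous f}.
Proof. by move=> h; apply: differentiable_continuous; exact: ex_diff. Qed.

Lemma is_diff_linear E G (f : {linear E -> G}) x : is_diff x f f.
Proof.
have cf : continuous f by exact: fdlin_continuous.
by apply: DiffDef; [exact: linear_differentiable | rewrite diff_lin].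
Qed.

(** The intermediate point depends on the coordinate; the vector-valued forms below pay for
    this with a constant depending on the space only. *)
Lemma seg_mvt E G (f : E -> G) (df : E -> E -> G) y a i :
  (forall x, is_diff x f (df x)) ->
  exists2 th, 0 <= th <= 1 &
    crd i (f (y + a)) - crd i (f y) = crd i (df (y + th *: a) a).
Proof.
move=> hf; pose g (th : R) := crd i (f (y + th *: a)).
have dg (th : R) : is_derive th 1 g (crd i (df (y + th *: a) a)).
  have h1 : is_diff th (fun th : R => y + th *: a) (fun h => h *: a).
    have := @is_diffD R R E (cst y) ( *:%R ^~ a) 0 ( *:%R ^~ a) th _ _.
    by move=> /(_ _ _) h; apply: is_diff_eq; rewrite funeqE => z; rewrite /= fctE add0r.
  have h2 : is_diff th (fun th : R => f (y + th *: a)) (fun h => df (y + th *: a) (h *: a)).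
    exact: (@is_diff_comp _ _ _ _ (fun th : R => y + th *: a) _ f).
  have dcr x : is_diff x (@crd G i) (@crd G i).
    apply: DiffDef; first exact/linear_differentiable/crd_continuous.
    by rewrite diff_lin//; exact: crd_continuous.
  have h3 : is_diff th g (fun h => crd i (df (y + th *: a) (h *: a))).
    exact: (@is_diff_comp _ _ _ _ (fun th : R => f (y + th *: a)) _ (@crd G i)).
  apply: DeriveDef; first by apply: diff_derivable; exact: ex_diff.
  by rewrite deriveE ?diff_val ?scale1r//; exact: ex_diff.
have [|th th01] := @MVT_segment R g (fun th => crd i (df (y + th *: a) a)) 0 1 ler01 (fun x _ => dg x).
  apply: continuous_subspaceT => x; apply: differentiable_continuous.
  by apply/derivable1_diffP; have [] := dg x.
rewrite subr0 mulr1 /g scale1r scale0r addr0 => e; exists th => //.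
Qed.

Lemma vec_mvt G : exists2 c, 0 <= c &
  forall E (f : E -> G) (df : E -> E -> G) y a M, 0 <= M ->
  (forall x, is_diff x f (df x)) ->
  (forall th, 0 <= th <= 1 -> `|df (y + th *: a) a| <= M) ->
  `|f (y + a) - f y| <= c * M.
Proof.
have [C C0 hC] := norm_le_crd G; have [C' C'0 hC'] := crd_bounded G.
exists (C * C'); first exact: mulr_ge0.
move=> E f df y a M M0 hf hM; rewrite -mulrA; apply: hC; first exact: mulr_ge0.
move=> i; have [th th01 e] := seg_mvt y a i hf.
by rewrite linearB/= e (le_trans (hC' _ _))// ler_wpM2l// hM.
Qed.

(** Two applications of the mean value theorem; of the first intermediate point th only th <= 1 is
    known. *)
Lemma vec_mvt2 G : exists2 c, 0 <= c &
  forall E (f : E -> G) (df : E -> E -> G) (d2f : E -> E -> E -> G) y a M, 0 <= M ->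
  (forall x, is_diff x f (df x)) ->
  (forall x, is_diff x (df ^~ a) (d2f x a)) ->
  (forall x k h, d2f x a (k *: h) = k *: d2f x a h) ->
  (forall th, 0 <= th <= 1 -> `|d2f (y + th *: a) a a| <= M) ->
  `|f (y + a) - f y - df y a| <= c * M.
Proof.
have [C C0 hC] := norm_le_crd G; have [C' C'0 hC'] := crd_bounded G.
exists (C * C'); first exact: mulr_ge0.
move=> E f df d2f y a M M0 hf hdf lin hM; rewrite -mulrA; apply: hC.
  exact: mulr_ge0.
move=> i; have [th /andP[th0 th1] e] := seg_mvt y a i hf.
have [th' /andP[th'0 th'1] e'] := seg_mvt y (th *: a) i hdf.
rewrite !linearB/= e e' lin scalerA linearZ/= normrM ger0_norm//.
rewrite (@le_trans _ _ `|crd i (d2f (y + (th' * th) *: a) a a)|)//.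
  by rewrite ler_piMl.
rewrite (le_trans (hC' _ _))// ler_wpM2l// hM// mulr_ge0//=.
by rewrite mulr_ile1.
Qed.

(** The second difference of f along s a and s b is symmetric in a and b, and by two mean value
    arguments it equals s ^ 2 times a value of d2f near x at (a, b). *)
Lemma schwarz_symmetry E G (f : E -> G) (df : E -> E -> G) (d2f : E -> E -> E -> G) :
  (forall x, is_diff x f (df x)) ->
  (forall x h, is_diff x (df ^~ h) (d2f x h)) ->
  (forall x k h, df x (k *: h) = k *: df x h) ->
  (forall x a k h, d2f x a (k *: h) = k *: d2f x a h) ->
  (forall h k, continuous (fun x => d2f x h k)) ->
  forall x h k, d2f x h k = d2f x k h.
Proof.
move=> hf hdf linf lind cd2 x h k.
rewrite [LHS]crdE [RHS]crdE; apply: eq_bigr => i _; congr (_ *: _).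
(* The intermediate points z depend on a, b and s, but lie in the unit square. *)
have key (a b : E) (s : R) : s != 0 -> exists2 z : R * R,
    (0 <= z.1 <= 1) && (0 <= z.2 <= 1) &
    crd i (f (x + s *: a + s *: b)) - crd i (f (x + s *: a)) -
      crd i (f (x + s *: b)) + crd i (f x) =
    s ^+ 2 * crd i (d2f (x + z.1 *: (s *: a) + z.2 *: (s *: b)) a b).
  move=> s0.
  have hg y : is_diff y (fun y => f (y + s *: b) - f y) (fun v => df (y + s *: b) v - df y v).
    have h1 : is_diff y (fun y => y + s *: b) id.
      have := @is_diffD R E E id (cst (s *: b)) id 0 y _ _.
      by move=> /(_ _ _) h1; apply: is_diff_eq; rewrite funeqE => z; rewrite /= fctE addr0.
    have h2 : is_diff y (fun y => f (y + s *: b)) (df (y + s *: b)).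
      exact: (@is_diff_comp _ _ _ _ (fun y => y + s *: b) id f).
    exact: (@is_diffB _ _ _ (fun y => f (y + s *: b)) f).
  have [t t01 et] := seg_mvt x (s *: a) i hg.
  have [u u01 eu] := seg_mvt (x + t *: (s *: a)) (s *: b) i (fun y => hdf y a).
  exists (t, u) => /=; first by rewrite t01.
  rewrite !linearB/= in et.
  rewrite (_ : _ + _ = s * (crd i (df (x + t *: (s *: a) + s *: b) a) - crd i (df (x + t *: (s *: a)) a))).
    by rewrite eu lind crdZ mulrA -expr2.
  move: et; rewrite !linf !crdZ -mulrBr => <-.
  by rewrite opprK addrA.
have lim (a b : E) : forall e : R, 0 < e -> exists2 del : R, 0 < del & forall (s : R) (z : R * R), 0 < s < del ->
    (0 <= z.1 <= 1) && (0 <= z.2 <= 1) ->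
    `|crd i (d2f (x + z.1 *: (s *: a) + z.2 *: (s *: b)) a b) - crd i (d2f x a b)| <= e.
  move=> e e0.
  have : {for x, continuous (fun y => crd i (d2f y a b))}.
    by apply: continuous_comp; [exact: cd2 | exact: crd_continuous].
  move/cvgrPdist_le => /(_ e e0) /nbhs_ballP[r /= r0 hr].
  have ab0 : 0 < `|a| + `|b| + 1 by rewrite ltr_wpDl ?addr_ge0.
  exists (r / (`|a| + `|b| + 1)); first by rewrite divr_gt0.
  move=> s [t u] /= /andP[s0 sd] /andP[/andP[t0 t1] /andP[u0 u1]].
  rewrite distrC; apply: hr; rewrite -ball_normE/= -addrA opprD addrA subrr sub0r normrN.
  apply: le_lt_trans (ler_normD _ _) _; rewrite !normrZ !(ger0_norm t0, ger0_norm u0) (gtr0_norm s0).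
  have h1 : t * (s * `|a|) <= s * `|a| by rewrite ler_piMl// mulr_ge0// ltW.
  have h2 : u * (s * `|b|) <= s * `|b| by rewrite ler_piMl// mulr_ge0// ltW.
  rewrite ltr_pdivlMr// in sd.
  by clear -h1 h2 sd s0; lra.
have main (e : R) : 0 < e -> `|crd i (d2f x h k) - crd i (d2f x k h)| <= e + e.
  move=> e0; have [d1 d10 h1] := lim h k e e0; have [d2 d20 h2] := lim k h e e0.
  pose s := Num.min d1 d2 / 2.
  have m0 : 0 < Num.min d1 d2 by rewrite lt_min d10.
  have s0 : 0 < s by rewrite divr_gt0.
  have sm : s < Num.min d1 d2 by rewrite /s; clear -m0; lra.
  have := sm; rewrite lt_min => /andP[sd1 sd2].
  have [z z01 ez] := key h k s (lt0r_neq0 s0).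
  have [z' z'01 ez'] := key k h s (lt0r_neq0 s0).
  have es : crd i (d2f (x + z.1 *: (s *: h) + z.2 *: (s *: k)) h k) =
            crd i (d2f (x + z'.1 *: (s *: k) + z'.2 *: (s *: h)) k h).
    apply: (@mulfI _ (s ^+ 2)); first by rewrite expf_neq0// lt0r_neq0.
    by rewrite -ez -ez' [x + s *: k + s *: h]addrAC; congr (_ + _); exact: addrAC.
  have := h1 s z; rewrite s0 sd1 => /(_ isT z01) k1.
  have := h2 s z'; rewrite s0 sd2 => /(_ isT z'01); rewrite -es => k2.
  rewrite -(subrK (crd i (d2f (x + z.1 *: (s *: h) + z.2 *: (s *: k)) h k)) (crd i (d2f x h k))).
  by rewrite -addrA (le_trans (ler_normD _ _))// lerD// distrC.
apply/eqP; rewrite -subr_eq0 -normr_le0; apply/ler_addgt0Pr => e e0.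
have e2 : 0 < e / 2 by rewrite divr_gt0.
by rewrite add0r; apply: le_trans (main _ e2) _; clear; lra.
Qed.

End FiniteDim.

(** Coordinates turn linear identities between vectors into ring identities. *)
Ltac vring := apply: crd_inj => ?; rewrite ?(crdD, crdN, crdZ); ring.

(** * Families of maps with weighted bounds on all derivatives *)

Section Calculus.
Variable R : realType.
Implicit Types E G H : normedVectType R.

Definition mklin (E G : lmodType R) (f : E -> G) (lf : linear f) : {linear E -> G} :=
  HB.pack f (GRing.isLinear.Build _ _ _ _ _ lf).

Lemma linZ (E G : lmodType R) (f : E -> G) k h : linear f -> f (k *: h) = k *: f h.
Proof. by move=> lf; rewrite -[f]/(mklin lf : E -> G) linearZ. Qed.

Lemma linD (E G : lmodType R) (f : E -> G) h k : linear f -> f (h + k) = f h + f k.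
Proof. by move=> lf; rewrite -[f]/(mklin lf : E -> G) linearD. Qed.

Lemma lin0 (E G : lmodType R) (f : E -> G) : linear f -> f 0 = 0.
Proof. by move=> lf; rewrite -[f]/(mklin lf : E -> G) linear0. Qed.

(** The rules of differential calculus are restated on eta-expanded maps, the form in which
    families of maps and their derivatives are given below. *)
Lemma isd_add E G (f g df dg : E -> G) x : is_diff x f df -> is_diff x g dg ->
  is_diff x (fun y => f y + g y) (fun h => df h + dg h).
Proof. by move=> hf hg; exact: is_diffD. Qed.

Lemma isd_sub E G (f g df dg : E -> G) x : is_diff x f df -> is_diff x g dg ->
  is_diff x (fun y => f y - g y) (fun h => df h - dg h).
Proof. by move=> hf hg; exact: is_diffB. Qed.

Lemma isd_comp E G H (f df : E -> G) (g dg : G -> H) x :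
  is_diff x f df -> is_diff (f x) g dg ->
  is_diff x (fun y => g (f y)) (fun h => dg (df h)).
Proof. by move=> hf hg; exact: (is_diff_comp hf hg). Qed.

Lemma isd_pair E G H (f df : E -> G) (g dg : E -> H) x :
  is_diff x f df -> is_diff x g dg ->
  is_diff x (fun y => (f y, g y)) (fun h => (df h, dg h)).
Proof. by move=> hf hg; exact: is_diff_pair. Qed.

Lemma isd_lin E G (l : E -> G) x : linear l -> is_diff x l l.
Proof. by move=> ll; have := is_diff_linear (mklin ll) x. Qed.

Lemma isd_cst E G (c : G) (x : E) : is_diff x (fun=> c) (fun=> 0).
Proof. exact: is_diff_cst. Qed.

Lemma isd_linear E G (f df : E -> G) x : is_diff x f df -> linear df.
Proof. by move=> h; rewrite -(@diff_val _ _ _ _ _ _ _ h) => a u v; rewrite linearP. Qed.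

Lemma isdZ E G (f df : E -> G) x k h : is_diff x f df -> df (k *: h) = k *: df h.
Proof. by move=> /isd_linear; exact: linZ. Qed.

Lemma isd0 E G (f df : E -> G) x : is_diff x f df -> df 0 = 0.
Proof. by move=> /isd_linear; exact: lin0. Qed.

Lemma isdD E G (f df : E -> G) x h k : is_diff x f df -> df (h + k) = df h + df k.
Proof. by move=> /isd_linear; exact: linD. Qed.

Lemma isd_unique E G (f df dg : E -> G) x : is_diff x f df -> is_diff x f dg -> df = dg.
Proof. by move=> h1 h2; rewrite -(@diff_val _ _ _ _ _ _ _ h1) -(@diff_val _ _ _ _ _ _ _ h2). Qed.

Lemma linear_fst E G : linear (@fst E G). Proof. by []. Qed.
Lemma linear_snd E G : linear (@snd E G). Proof. by []. Qed.

Lemma bilin_continuous E G H (B : E -> G -> H) : (forall y, linear (B ^~ y)) ->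
  (forall x, linear (B x)) -> continuous (fun p : E * G => B p.1 p.2).
Proof.
move=> l1 l2.
rewrite (_ : (fun p : E * G => B p.1 p.2) =
  (fun p : E * G => \sum_i crd i p.1 *: B (vbasis {:E})`_i p.2)); last first.
  apply/funext => p; rewrite {1}(crdE p.1).
  have -> : B (\sum_i crd i p.1 *: (vbasis {:E})`_i) p.2 =
    mklin (l1 p.2) (\sum_i crd i p.1 *: (vbasis {:E})`_i) by [].
  rewrite linear_sum; apply: eq_bigr => i _; exact: (linZ _ _ (l1 p.2)).
move=> p; apply: cvg_big => //=; first exact: add_continuous.
move=> i _; apply: cvgZ.
  apply: (@continuous_comp _ _ _ fst (@crd R E i)); last exact: crd_continuous.
  exact: cvg_fst.
apply: (@continuous_comp _ _ _ snd (B (vbasis {:E})`_i)); first exact: cvg_snd.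
have cl : continuous (mklin (l2 (vbasis {:E})`_i)) by exact: fdlin_continuous.
exact: cl.
Qed.

Definition mkbilin E G H (B : E -> G -> H) (l1 : forall y, linear (B ^~ y))
    (l2 : forall x, linear (B x)) : {bilinear E -> G -> H} :=
  HB.pack B (bilinear_isBilinear.Build R E G H _ _ B
    ((fun y => l1 y), (fun x => l2 x))).

Lemma isd_bilin E G H (B : E -> G -> H) p : (forall y, linear (B ^~ y)) ->
  (forall x, linear (B x)) ->
  is_diff p (fun q : E * G => B q.1 q.2) (fun q => B p.1 q.2 + B q.1 p.2).
Proof.
move=> l1 l2; have cB := bilin_continuous l1 l2.
apply: DiffDef.
  exact: (@differentiable_bilin _ _ _ _ (mkbilin l1 l2)).
exact: (@diff_bilin _ _ _ _ (mkbilin l1 l2)).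
Qed.

Lemma bilin_bounded E G H (B : E -> G -> H) : (forall y, linear (B ^~ y)) ->
  (forall x, linear (B x)) ->
  exists2 k, 0 <= k & forall u v, `|B u v| <= k * `|u| * `|v|.
Proof.
move=> l1 l2; have cB := bilin_continuous l1 l2.
have [k k0 hk] := @bilinear_schwarz _ _ _ _ (mkbilin l1 l2) cB.
by exists k => //; exact: ltW.
Qed.

Definition cball E (M : R) : set E := [set x | `|x| <= M].

(** Uniform C^m bounds, of the order of a weight w i, for a family f i of maps: f i is bounded on
    B, and its derivative g i, as a map of the pair (point, direction), is again such a family as
    long as the direction stays in a ball. Keeping point and direction together, instead of
    iterating operator-valued derivatives, makes the derivative of a flow a flow of the same kind
    and reduces each closure property to one induction. The weight carries the order in the time
    increments. *)
Fixpoint cbd (I : Type) (w : I -> R) (m : nat) E G (B : set E) (f : I -> E -> G)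
    {struct m} : Prop :=
  (exists2 C : R, 0 <= C & forall i x, B x -> `|f i x| <= C * w i) /\
  match m with
  | 0 => forall i, continuous (f i)
  | m'.+1 => exists2 g : I -> E * E -> G,
      (forall i x, is_diff x (f i) (fun h => g i (x, h))) &
      forall M, cbd w m' (B `*` cball M) g
  end.

Section Closure.
Variable I : Type.
Implicit Types w : I -> R.

Lemma cbd_inv w m E G (B : set E) (f : I -> E -> G) : cbd w m.+1 B f ->
  (exists2 C : R, 0 <= C & forall i x, B x -> `|f i x| <= C * w i) /\
  exists2 g : I -> E * E -> G,
      (forall i x, is_diff x (f i) (fun h => g i (x, h))) &
      forall M, cbd w m (B `*` cball M) g.
Proof. by []. Qed.

Lemma cbd_bound w m E G (B : set E) (f : I -> E -> G) : cbd w m B f ->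
  exists2 C, 0 <= C & forall i x, B x -> `|f i x| <= C * w i.
Proof. by case: m => [|m] []. Qed.

Lemma cbd_cont w m E G (B : set E) (f : I -> E -> G) i : cbd w m B f ->
  continuous (f i).
Proof.
case: m => [|m] [_]; first exact.
by move=> [g hg _] x; exact: is_diff_continuous (hg i x).
Qed.

Lemma cbdS w m E G (B : set E) (f : I -> E -> G) : cbd w m.+1 B f -> cbd w m B f.
Proof.
elim: m E G B f => [|m IH] E G B f hf.
  split; [exact: (cbd_bound hf)|by move=> i; exact: cbd_cont hf].
have [bf [g hg cg]] := cbd_inv hf; split=> //; exists g => // M; exact: IH.
Qed.

Lemma cbd_le w m n E G (B : set E) (f : I -> E -> G) : (n <= m)%N ->
  cbd w m B f -> cbd w n B f.
Proof.
by move=> /subnK <-; elim: (m - n)%N => // k IH; rewrite addSn => /cbdS.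
Qed.

Lemma cbd_sub w m E G (B B' : set E) (f : I -> E -> G) : B' `<=` B ->
  cbd w m B f -> cbd w m B' f.
Proof.
elim: m E G B B' f => [|m IH] E G B B' f sB [[C C0 bf] hf].
  by split=> //; exists C => // i x /sB; exact: bf.
split; first by exists C => // i x /sB; exact: bf.
have [g hg cg] := hf; exists g => // M; apply: IH (cg M).
by move=> x [? ?]; split=> //; exact: sB.
Qed.

Lemma cbd_weight w w' m E G (B : set E) (f : I -> E -> G) c : 0 <= c ->
  (forall i, w i <= c * w' i) -> cbd w m B f -> cbd w' m B f.
Proof.
move=> c0 ww; elim: m E G B f => [|m IH] E G B f.
  move=> [[C C0 bf] hf]; split=> //; exists (C * c); first exact: mulr_ge0.
  by move=> i x Bx; apply: le_trans (bf i x Bx) _; rewrite -mulrA ler_wpM2l.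
move=> /cbd_inv[[C C0 bf] hf]; split.
  exists (C * c); first exact: mulr_ge0.
  by move=> i x Bx; apply: le_trans (bf i x Bx) _; rewrite -mulrA ler_wpM2l.
by have [g hg cg] := hf; exists g => // M; exact: IH.
Qed.

Lemma cbd_cst w m E G (B : set E) (z : I -> G) c : 0 <= c ->
  (forall i, `|z i| <= c * w i) -> cbd w m B (fun i (_ : E) => z i).
Proof.
elim: m E B z c => [|m IH] E B z c c0 hz; first by split; [exists c|move=> i x; exact: cvg_cst].
split; first by exists c.
exists (fun=> fun=> 0); first by move=> i x; exact: isd_cst.
by move=> M; apply: (IH _ _ _ 0) => // i; rewrite normr0 mul0r.
Qed.

Lemma cbdD w m E G (B : set E) (f g : I -> E -> G) :
  cbd w m B f -> cbd w m B g -> cbd w m B (fun i x => f i x + g i x).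
Proof.
have bd E' (B' : set E') (f' g' : I -> E' -> G) :
    (exists2 C, 0 <= C & forall i x, B' x -> `|f' i x| <= C * w i) ->
    (exists2 C, 0 <= C & forall i x, B' x -> `|g' i x| <= C * w i) ->
    exists2 C, 0 <= C & forall i x, B' x -> `|f' i x + g' i x| <= C * w i.
  move=> [C C0 hC] [D D0 hD]; exists (C + D); first exact: addr_ge0.
  move=> i x Bx; apply: le_trans (ler_normD _ _) _.
  by rewrite mulrDl lerD// ?hC ?hD.
elim: m E B f g => [|m IH] E B f g.
  move=> [bf hf] [bg hg]; split; first exact: bd.
  by move=> i x; apply: cvgD; [exact: hf|exact: hg].
move=> /cbd_inv[bf hf] /cbd_inv[bg hg]; split; first exact: bd.
have [f' df cf] := hf; have [g' dg cg] := hg.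
exists (fun i p => f' i p + g' i p).
  by move=> i x; exact: (isd_add (df i x) (dg i x)).
by move=> M; exact: IH.
Qed.

Lemma cbd_lin w m E G H (B : set E) (f : I -> E -> G) (l : G -> H) : linear l ->
  cbd w m B f -> cbd w m B (fun i x => l (f i x)).
Proof.
move=> ll; have [c c0 hc] := linear_bounded (mklin ll).
have bd E' (B' : set E') (f' : I -> E' -> G) :
    (exists2 C, 0 <= C & forall i x, B' x -> `|f' i x| <= C * w i) ->
    exists2 C, 0 <= C & forall i x, B' x -> `|l (f' i x)| <= C * w i.
  move=> [C C0 hC]; exists (c * C); first exact: mulr_ge0.
  by move=> i x Bx; apply: le_trans (hc _) _; rewrite -mulrA ler_wpM2l// hC.
elim: m E B f => [|m IH] E B f.
  move=> [bf hf]; split; first exact: bd.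
  move=> i x; apply: (@continuous_comp _ _ _ (f i) l); first exact: hf.
  exact: is_diff_continuous (isd_lin (f i x) ll).
move=> /cbd_inv[bf hf]; split; first exact: bd.
have [f' df cf] := hf; exists (fun i p => l (f' i p)); last by move=> M; exact: IH.
by move=> i x; exact: (isd_comp (df i x) (isd_lin _ ll)).
Qed.

Lemma cbdN w m E G (B : set E) (f : I -> E -> G) :
  cbd w m B f -> cbd w m B (fun i x => - f i x).
Proof. by apply: (@cbd_lin w m E G G B f -%R) => a u v; rewrite opprD scalerN. Qed.

Lemma cbdB w m E G (B : set E) (f g : I -> E -> G) :
  cbd w m B f -> cbd w m B g -> cbd w m B (fun i x => f i x - g i x).
Proof. by move=> hf hg; apply: cbdD => //; exact: cbdN. Qed.

Lemma cbd_sum w m E G (B : set E) (J : finType) (f : J -> I -> E -> G) :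
  (forall j, cbd w m B (f j)) -> cbd w m B (fun i x => \sum_j f j i x).
Proof.
move=> hf; pose P r := cbd w m B (fun i x => \sum_(j <- r) f j i x).
suff : P (index_enum J) by [].
elim: (index_enum J) => [|j r IH]; rewrite /P.
  rewrite (_ : (fun _ => _) = (fun _ _ => 0)).
    by apply: (@cbd_cst _ _ _ _ _ (fun=> 0) 0) => // i; rewrite normr0 mul0r.
  by apply/funext => i; apply/funext => x; rewrite big_nil.
rewrite (_ : (fun _ => _) = (fun i x => f j i x + \sum_(j <- r) f j i x)).
  exact: cbdD.
by apply/funext => i; apply/funext => x; rewrite big_cons.
Qed.

Lemma cbd_precomp w m E E' G (B : set E) (B' : set E') (f : I -> E -> G) (l : E' -> E) :
  linear l -> (forall x, B' x -> B (l x)) ->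
  cbd w m B f -> cbd w m B' (fun i x => f i (l x)).
Proof.
elim: m E E' G B B' f l => [|m IH] E E' G B B' f l ll lB.
  move=> [[C C0 bf] hf]; split; first by exists C => // i x Bx; exact/bf/lB.
  move=> i x; apply: (@continuous_comp _ _ _ l (f i)); last exact: hf.
  exact: is_diff_continuous (isd_lin x ll).
move=> /cbd_inv[[C C0 bf] hf]; split; first by exists C => // i x Bx; exact/bf/lB.
have [g hg cg] := hf; exists (fun i p => g i (l p.1, l p.2)).
  by move=> i x; exact: (isd_comp (isd_lin x ll) (hg i (l x))).
have [c c0 hc] := linear_bounded (mklin ll).
move=> M; apply: (@IH (E * E)%type (E' * E')%type G (B `*` cball (c * M)) _ g
  (fun p => (l p.1, l p.2))) => //.
  by move=> a [u1 u2] [v1 v2] /=; rewrite !ll.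
move=> [x y] [/= Bx yM]; split=> /=; first exact: lB.
by apply: le_trans (hc y) _; rewrite ler_wpM2l.
Qed.

Lemma cbd_fst w m E E' G (B : set E) (B' : set E') (f : I -> E -> G) :
  cbd w m B f -> cbd w m (B `*` B') (fun i (x : E * E') => f i x.1).
Proof. by apply: cbd_precomp => //= x []. Qed.

Lemma cbd_pair w m E G H (B : set E) (f : I -> E -> G) (g : I -> E -> H) :
  cbd w m B f -> cbd w m B g -> cbd w m B (fun i x => (f i x, g i x)).
Proof.
have bd E' (B' : set E') (f' : I -> E' -> G) (g' : I -> E' -> H) :
    (exists2 C, 0 <= C & forall i x, B' x -> `|f' i x| <= C * w i) ->
    (exists2 C, 0 <= C & forall i x, B' x -> `|g' i x| <= C * w i) ->
    exists2 C, 0 <= C & forall i x, B' x -> `|(f' i x, g' i x)| <= C * w i.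
  move=> [C C0 hC] [D D0 hD]; exists (Num.max C D); first by rewrite le_max C0.
  move=> i x Bx; have h1 := hC i x Bx; have h2 := hD i x Bx.
  rewrite prod_normE/= ge_max; apply/andP; split.
    have [h|h] := leP C D; last exact: h1.
    have w0 : 0 <= C * w i by apply: le_trans h1.
    have [C00|C00] := eqVneq C 0.
      by apply: le_trans h1 _; rewrite C00 mul0r; apply: le_trans h2.
    by apply: le_trans h1 _; rewrite ler_wpM2r// -(pmulr_rge0 _ (_ : 0 < C))// lt_def C00.
  have [h|h] := leP C D; first exact: h2.
  have w0 : 0 <= D * w i by apply: le_trans h2.
  have [D00|D00] := eqVneq D 0.
    by apply: le_trans h2 _; rewrite D00 mul0r; apply: le_trans h1.
  apply: le_trans h2 _; rewrite ler_wpM2r//; last exact: ltW.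
  by rewrite -(pmulr_rge0 _ (_ : 0 < D))// lt_def D00.
elim: m E B f g => [|m IH] E B f g.
  move=> [bf hf] [bg hg]; split; first exact: bd.
  by move=> i x; apply: cvg_pair; [exact: hf|exact: hg].
move=> /cbd_inv[bf hf] /cbd_inv[bg hg]; split; first exact: bd.
have [f' df cf] := hf; have [g' dg cg] := hg.
exists (fun i p => (f' i p, g' i p)).
  by move=> i x; exact: (isd_pair (df i x) (dg i x)).
by move=> M; exact: IH.
Qed.

Lemma cbd_linear m E G (B : set E) (l : E -> G) K : linear l -> 0 <= K ->
  (forall x, B x -> `|l x| <= K) -> cbd (fun _ : I => 1) m B (fun _ => l).
Proof.
elim: m E G B l K => [|m IH] E G B l K ll K0 lK.
  split; first by exists K => // i x Bx; rewrite mulr1 lK.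
  by move=> i x; exact: is_diff_continuous (isd_lin x ll).
split; first by exists K => // i x Bx; rewrite mulr1 lK.
exists (fun=> fun p => l p.2); first by move=> i x; exact: isd_lin.
have [c c0 hc] := linear_bounded (mklin ll).
move=> M; have [M0|M0] := leP 0 M.
  apply: (IH _ _ _ _ (c * M)) => //; last first.
  - by move=> [x y] [/= _ yM]; apply: le_trans (hc y) _; rewrite ler_wpM2l.
  - exact: mulr_ge0.
  by move=> a u v /=; rewrite ll.
apply: (IH _ _ _ _ 0) => //; first by move=> a u v /=; rewrite ll.
move=> [x y] [_]; rewrite /cball/= => h.
by have := lt_le_trans (le_lt_trans h M0) (normr_ge0 y); rewrite ltxx.
Qed.

Lemma cbd_bilin w1 w2 m E G1 G2 H (B : set E) (f : I -> E -> G1) (g : I -> E -> G2)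
  (b : G1 -> G2 -> H) :
  (forall y, linear (b ^~ y)) -> (forall x, linear (b x)) ->
  cbd w1 m B f -> cbd w2 m B g ->
  cbd (fun i => w1 i * w2 i) m B (fun i x => b (f i x) (g i x)).
Proof.
move=> l1 l2; have [k k0 hk] := bilin_bounded l1 l2.
have bd E' (B' : set E') (f' : I -> E' -> G1) (g' : I -> E' -> G2) :
    (exists2 C, 0 <= C & forall i x, B' x -> `|f' i x| <= C * w1 i) ->
    (exists2 C, 0 <= C & forall i x, B' x -> `|g' i x| <= C * w2 i) ->
    exists2 C, 0 <= C & forall i x, B' x -> `|b (f' i x) (g' i x)| <= C * (w1 i * w2 i).
  move=> [C C0 hC] [D D0 hD]; exists (k * (C * D)); first by rewrite !mulr_ge0.
  move=> i x Bx; apply: le_trans (hk _ _) _; rewrite -!mulrA ler_wpM2l//.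
  have -> : C * (D * (w1 i * w2 i)) = (C * w1 i) * (D * w2 i) by ring.
  by apply: ler_pM => //; [exact: hC|exact: hD].
elim: m E B f g => [|m IH] E B f g.
  move=> [bf hf] [bg hg]; split; first exact: bd.
  move=> i x; apply: (@continuous_comp _ _ _ (fun x => (f i x, g i x))
    (fun p => b p.1 p.2)).
    by apply: cvg_pair; [exact: hf|exact: hg].
  exact: bilin_continuous.
move=> cf0 cg0; have [bf [f' df cf]] := cbd_inv cf0; have [bg [g' dg cg]] := cbd_inv cg0.
split; first exact: bd.
exists (fun i p => b (f i p.1) (g' i p) + b (f' i p) (g i p.1)).
  move=> i x; have := isd_comp (isd_pair (df i x) (dg i x)) (isd_bilin (f i x, g i x) l1 l2).
  exact.
move=> M; apply: cbdD; apply: IH => //; exact/cbd_fst/cbdS.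
Qed.

Lemma cbd_comp w m E G H (B : set E) (B' : set G) (f : I -> G -> H) (g : I -> E -> G) :
  (forall i x, B x -> B' (g i x)) -> cbd w m B' f -> cbd (fun=> 1) m B g ->
  cbd w m B (fun i x => f i (g i x)).
Proof.
elim: m E G H B B' f g => [|m IH] E G H B B' f g gB.
  move=> [[C C0 bf] hf] [_ hg].
  split; first by exists C => // i x Bx; exact/bf/gB.
  by move=> i x; apply: (@continuous_comp _ _ _ (g i) (f i)); [exact: hg|exact: hf].
move=> /cbd_inv[[C C0 bf] [f' df cf]] cg0; have [bg [g' dg cg]] := cbd_inv cg0.
split; first by exists C => // i x Bx; exact/bf/gB.
exists (fun i p => f' i (g i p.1, g' i p)).
  by move=> i x; exact: (isd_comp (dg i x) (df i (g i x))).
move=> M; have [K K0 hK] := cbd_bound (cg M).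
apply: (IH _ _ _ _ (B' `*` cball K) f' (fun i p => (g i p.1, g' i p))) => //.
  move=> i p Bp; split; first by apply: gB; case: Bp.
  by rewrite /cball/= -[K]mulr1 hK.
by apply: cbd_pair => //; exact/cbd_fst/cbdS.
Qed.

Lemma is_diff_bound1 E G (f df : E -> G) x K h : is_diff x f df ->
  (forall v, `|v| <= 1 -> `|df v| <= K) -> `|df h| <= K * `|h|.
Proof.
move=> hf hK; have [->|h0] := eqVneq h 0.
  by rewrite (isd0 hf) !normr0 mulr0.
have nh : 0 < `|h| by rewrite normr_gt0.
rewrite -[in X in X <= _](scalerKV (lt0r_neq0 nh) h) (isdZ _ _ hf) normrZ.
rewrite normr_id mulrC ler_wpM2r// hK//.
by rewrite normrZ normfV normr_id mulVf// lt0r_neq0.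
Qed.

(** The derivative of y |-> h(y + a(y)) - h(y) is again a difference of this form, for h' and the
    increment (a, a') of the pair (point, direction); only the bound itself, a mean value
    inequality, has to be proved. The enlarged set B' contains the segments along a. *)
Lemma cbd_shift v w m E G (B B' : set E) (h : I -> E -> G) (a : I -> E -> E) Wm :
  (forall i, 0 <= w i <= Wm) ->
  (forall i y th, 0 <= th <= 1 -> B y -> B' (y + th *: a i y)) ->
  cbd v m.+1 B' h -> cbd w m B a ->
  cbd (fun i => v i * w i) m B (fun i y => h i (y + a i y) - h i y).
Proof.
move=> hw; move: E G B B' h a.
have bd E' G' (B B' : set E') (h : I -> E' -> G') (a : I -> E' -> E') :
    (forall i y th, 0 <= th <= 1 -> B y -> B' (y + th *: a i y)) ->
    cbd v 1 B' h -> cbd w 0 B a ->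
    exists2 C, 0 <= C & forall i x, B x -> `|h i (x + a i x) - h i x| <= C * (v i * w i).
  move=> hB /cbd_inv[_ [h' dh ch]] [[D D0 hD] _]; have [K K0 hK] := cbd_bound (ch 1).
  have [c c0 hc] := vec_mvt G'.
  exists (c * (K * D)); first by rewrite !mulr_ge0.
  move=> i x Bx; rewrite -!mulrA [D * _]mulrCA [K * _]mulrA.
  have /andP[w0 _] := hw i.
  have Kv : 0 <= K * v i.
    apply: (le_trans (normr_ge0 (h' i (x, 0)))); apply: hK.
    split; rewrite /cball/=; last by rewrite normr0.
    by have := hB i x 0; rewrite scale0r addr0 lexx ler01; exact.
  apply: (hc _ (h i) (fun x h => h' i (x, h))) => //.
    by rewrite mulr_ge0// mulr_ge0.
  move=> th th01; apply: (@le_trans _ _ (K * v i * `|a i x|)).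
    apply: (is_diff_bound1 (f := h i) (x := x + th *: a i x) (df := fun u => h' i (x + th *: a i x, u))) => // u u1.
    by apply: hK; split=> //=; exact: hB.
  by rewrite ler_wpM2l// hD.
elim: m => [|m IH] E G B B' h a hB ch0 ca0.
  split; first exact: (bd _ _ B B').
  move=> i x; apply: cvgB; last exact: (cbd_cont ch0).
  apply: (@continuous_comp _ _ _ (fun y => y + a i y) (h i)); last exact: (cbd_cont ch0).
  by apply: cvgD; [exact: cvg_id|exact: (cbd_cont ca0)].
split; first exact: (bd _ _ B B' _ _ hB (cbd_le _ ch0) (cbd_le _ ca0)).
have [_ [h' dh ch]] := cbd_inv ch0; have [_ [a' da ca]] := cbd_inv ca0.
exists (fun i p => h' i (p + (a i p.1, a' i p)) - h' i p).
  move=> i x; apply: (isd_sub _ (dh i x)).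
  exact: (isd_comp (isd_add (is_diff_id x) (da i x)) (dh i (x + a i x))).
move=> M; have [K K0 hK] := cbd_bound (ca M).
apply: (IH _ _ _ (B' `*` cball (M + K * Wm)) h' (fun i p => (a i p.1, a' i p))) => //.
  move=> i [y e] th th01 [/= By eM]; split; first exact: hB.
  rewrite /cball/=; apply: le_trans (ler_normD _ _) _; apply: lerD => //.
  rewrite normrZ ger0_norm; last by case/andP: th01.
  have h1 := hK i (y, e) (conj By eM); have /andP[w0 wW] := hw i.
  apply: (@le_trans _ _ `|a' i (y, e)|); first by rewrite ler_piMl//; case/andP: th01.
  by apply: le_trans h1 _; rewrite ler_wpM2l.
by apply: cbd_pair => //; exact/cbd_fst/cbdS.
Qed.

End Closure.
End Calculus.

(** * Symmetry of second derivatives and Taylor remainders *)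

Section Taylor.
Variables (R : realType) (I : Type).
Implicit Types E G H : normedVectType R.
Implicit Types v w : I -> R.

Lemma isd_dir E G (h' : E * E -> G) (h'' : (E * E) * (E * E) -> G) x a :
  (forall p, is_diff p h' (fun q => h'' (p, q))) ->
  is_diff x (fun x => h' (x, a)) (fun b => h'' ((x, a), (b, 0))).
Proof.
move=> dh; have h1 : is_diff x (fun x : E => (x, a)) (fun b => (b, 0)).
  exact: (isd_pair (is_diff_id x) (isd_cst a x)).
exact: (isd_comp h1 (dh (x, a))).
Qed.

Lemma isd_dir2 E G (h : E -> G) (h' : E * E -> G) (h'' : (E * E) * (E * E) -> G) x a b :
  (forall x, is_diff x h (fun b => h' (x, b))) ->
  (forall p, is_diff p h' (fun q => h'' (p, q))) ->
  h'' ((x, a), (0, b)) = h' (x, b).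
Proof.
move=> dh dh'; have h1 : is_diff a (fun a : E => (x, a)) (fun b => (0, b)).
  exact: (isd_pair (isd_cst x a) (is_diff_id a)).
have h2 := isd_comp h1 (dh' (x, a)).
have h3 : is_diff a (fun a => h' (x, a)) (fun a => h' (x, a)).
  exact: (isd_lin a (isd_linear (dh x))).
by have := isd_unique h2 h3 => /(congr1 (fun f => f b)).
Qed.

(** Schwarz's theorem for derivatives encoded as maps of the pair (point, direction). *)
Lemma isd_sym E G (h : E -> G) (h' : E * E -> G) (h'' : (E * E) * (E * E) -> G) x a b :
  (forall x, is_diff x h (fun b => h' (x, b))) ->
  (forall p, is_diff p h' (fun q => h'' (p, q))) -> continuous h'' ->
  h'' ((x, a), (b, 0)) = h'' ((x, b), (a, 0)).
Proof.
move=> dh dh' ch.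
apply: (@schwarz_symmetry R E G h (fun x b => h' (x, b))
  (fun x a b => h'' ((x, a), (b, 0)))) => //.
- by move=> y c; exact: isd_dir.
- by move=> y k c; exact: (isdZ _ _ (dh y)).
- move=> y c k e; have := isdZ k e (isd_dir y c dh'); exact.
- move=> c k y.
  apply: (@continuous_comp _ _ _ (fun x => ((x, c), (k, 0))) h''); last exact: ch.
  exact: is_diff_continuous (isd_pair (isd_pair (is_diff_id y) (isd_cst c y)) (isd_cst (k, 0) y)).
Qed.

(** As for cbd_shift, the statement reproduces itself: by the symmetry of h'', the derivative of the
    Taylor remainder of h along a is the Taylor remainder of h' along (a, a'). *)
Lemma cbd_taylor v w m E G (B B' : set E) (h : I -> E -> G) (h' : I -> E * E -> G)
    (a : I -> E -> E) Wm :
  (forall i, 0 <= w i <= Wm) ->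
  (forall i y th, 0 <= th <= 1 -> B y -> B' (y + th *: a i y)) ->
  (forall i x, is_diff x (h i) (fun b => h' i (x, b))) ->
  (exists2 C : R, 0 <= C & forall i x, B' x -> `|h i x| <= C * v i) ->
  (forall M, cbd v m.+1 (B' `*` cball M) h') -> cbd w m B a ->
  cbd (fun i => v i * w i ^+ 2) m B
    (fun i y => h i (y + a i y) - h i y - h' i (y, a i y)).
Proof.
move=> hw; move: E G B B' h h' a.
have bd E' G' (B B' : set E') (h : I -> E' -> G') (h' : I -> E' * E' -> G')
     (a : I -> E' -> E') :
    (forall i y th, 0 <= th <= 1 -> B y -> B' (y + th *: a i y)) ->
    (forall i x, is_diff x (h i) (fun b => h' i (x, b))) ->
    (forall M, cbd v 1 (B' `*` cball M) h') -> cbd w 0 B a ->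
    exists2 C, 0 <= C & forall i x, B x ->
      `|h i (x + a i x) - h i x - h' i (x, a i x)| <= C * (v i * w i ^+ 2).
  move=> hB dh ch [[D D0 hD] _]; have [_ [h'' dh' ch']] := cbd_inv (ch 1).
  have [K K0 hK] := cbd_bound (ch' 1).
  have [c c0 hc] := vec_mvt2 G'.
  exists (c * (K * D ^+ 2)); first by rewrite !mulr_ge0// exprn_ge0.
  move=> i x Bx; have /andP[w0 _] := hw i.
  have -> : c * (K * D ^+ 2) * (v i * w i ^+ 2) = c * (K * v i * (D * w i) ^+ 2) by ring.
  have [a0|a0] := eqVneq (a i x) 0.
    rewrite a0 addr0 subrr sub0r normrN (isd0 (dh i x)) normr0.
    apply: mulr_ge0 => //; apply: mulr_ge0; last exact: exprn_ge0 (mulr_ge0 _ _).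
    apply: (le_trans (normr_ge0 (h'' i ((x, 0), (0, 0))))); apply: hK.
    split; rewrite /cball/= ?normr0//; split; rewrite /cball/= ?normr0//.
    by have := hB i x 0; rewrite scale0r addr0 lexx ler01; exact.
  have na : 0 < `|a i x| by rewrite normr_gt0.
  pose e := `|a i x|^-1 *: a i x.
  have ne : `|e| = 1 by rewrite normrZ normfV normr_id mulVf// lt0r_neq0.
  have ae : a i x = `|a i x| *: e by rewrite /e scalerA mulfV ?lt0r_neq0// scale1r.
  have dd y b : is_diff y (fun y => h' i (y, b)) (fun k => h'' i ((y, b), (k, 0))).
    exact: isd_dir.
  have d2Z y b r k : h'' i ((y, b), (r *: k, 0)) = r *: h'' i ((y, b), (k, 0)).
    by have := isdZ r k (dd y b); exact.
  have d2Zl y b r k : h'' i ((y, r *: b), (k, 0)) = r *: h'' i ((y, b), (k, 0)).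
    have h1 := dd y (r *: b).
    have h2 := isd_comp (dd y b) (is_diff_scaler r (h' i (y, b))).
    have e1 : (fun y => h' i (y, r *: b)) = (fun y => r *: h' i (y, b)).
      by apply/funext => z; exact: (isdZ r b (dh i z)).
    rewrite e1 in h1.
    by have := isd_unique h1 h2 => /(congr1 (fun f => f k)).
  have hbd th : 0 <= th <= 1 ->
      `|h'' i ((x + th *: a i x, a i x), (a i x, 0))| <= K * v i * `|a i x| ^+ 2.
    move=> th01; rewrite [X in h'' i (_, (X, _))]ae [X in h'' i ((_, X), _)]ae.
    rewrite d2Z d2Zl !normrZ !normr_id mulrA -expr2 mulrC ler_wpM2r ?exprn_ge0//.
    apply: hK; split; first split; rewrite /cball/= ?ne//; first exact: hB.
    by rewrite prod_normE/= ne normr0 ge_max lexx ler01.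
  have M0 : 0 <= K * v i * `|a i x| ^+ 2.
    by apply: le_trans (hbd 0 _); rewrite ?lexx ?ler01.
  apply: le_trans (hc _ (h i) (fun x b => h' i (x, b))
    (fun x b k => h'' i ((x, b), (k, 0))) x (a i x) _ M0 _ _ _ _) _ => //.
  have Kv : 0 <= K * v i by rewrite -(pmulr_lge0 _ (exprn_gt0 2 na)).
  by rewrite ler_wpM2l// ler_wpM2l// lerXn2r ?nnegrE ?mulr_ge0// hD.
elim: m => [|m IH] E G B B' h h' a hB dh bh ch ca0.
  split; first exact: (bd _ _ B B').
  move=> i x; have ca : continuous (a i) by exact: (cbd_cont ca0).
  have cs : {for x, continuous (fun y => y + a i y)}.
    by apply: cvgD; [exact: cvg_id|exact: ca].
  apply: cvgB; first apply: cvgB.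
  - apply: (@continuous_comp _ _ _ (fun y => y + a i y) (h i)) => //.
    exact: is_diff_continuous (dh i _).
  - exact: is_diff_continuous (dh i _).
  - apply: (@continuous_comp _ _ _ (fun y => (y, a i y)) (h' i)).
      by apply: cvg_pair; [exact: cvg_id|exact: ca].
    exact: (cbd_cont (ch 0)).
split.
  apply: (bd _ _ B B') => //; last exact: (cbd_le _ ca0).
  by move=> M; exact: (cbd_le _ (ch M)).
have [_ [a' da ca]] := cbd_inv ca0.
have [_ [h'' dh' ch']] := cbd_inv (ch 0).
have sym i x y z : h'' i ((x, y), (z, 0)) = h'' i ((x, z), (y, 0)).
  by apply: (isd_sym _ _ _ (dh i) (dh' i)); exact: (cbd_cont (ch' 0)).
exists (fun i p => h' i (p + (a i p.1, a' i p)) - h' i p -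
    h'' i (p, (a i p.1, a' i p))).
  move=> i x.
  have h1 := isd_comp (isd_add (is_diff_id x) (da i x)) (dh i (x + a i x)).
  have h2 := isd_comp (isd_pair (is_diff_id x) (da i x)) (dh' i (x, a i x)).
  have h3 := isd_sub (isd_sub h1 (dh i x)) h2.
  apply: is_diff_eq h3 _; apply/funext => k /=; congr (_ - _).
  have split1 p q r : h'' i (p, (q, r)) = h'' i (p, (q, 0)) + h'' i (p, (0, r)).
    by rewrite -(isdD _ _ (dh' i p)); congr (h'' i (_, _)); congr pair; rewrite ?addr0 ?add0r.
  rewrite split1 [RHS]split1 sym; congr (_ + _).
  by rewrite (isd_dir2 x (a i x) _ (dh i) (dh' i)) (isd_dir2 x k _ (dh i) (dh' i)).
move=> M; have [K K0 hK] := cbd_bound (ca M).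
apply: (IH _ _ _ (B' `*` cball (M + K * Wm)) h' h'' (fun i p => (a i p.1, a' i p))) => //.
- move=> i [y e] th th01 [/= By eM]; split; first exact: hB.
  rewrite /cball/=; apply: le_trans (ler_normD _ _) _; apply: lerD => //.
  rewrite normrZ ger0_norm; last by case/andP: th01.
  have h1 := hK i (y, e) (conj By eM); have /andP[w0 wW] := hw i.
  apply: (@le_trans _ _ `|a' i (y, e)|); first by rewrite ler_piMl//; case/andP: th01.
  by apply: le_trans h1 _; rewrite ler_wpM2l.
- exact: (cbd_bound (ch _)).
- move=> N; have [_ [g dg cg]] := cbd_inv (ch (M + K * Wm)).
  rewrite (_ : h'' = g); first exact: cg.
  apply/funext => i; apply/funext => -[p q].
  by have := isd_unique (dh' i p) (dg i p) => /(congr1 (fun f => f q)).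
- by apply: cbd_pair => //; exact/cbd_fst/cbdS.
Qed.

Lemma cbd_taylor' v w m E G (B B' : set E) (h : I -> E -> G) (h' : I -> E * E -> G)
    (a : I -> E -> E) Wm :
  (forall i, 0 <= w i <= Wm) ->
  (forall i y th, 0 <= th <= 1 -> B y -> B' (y + th *: a i y)) ->
  (forall i x, is_diff x (h i) (fun b => h' i (x, b))) ->
  cbd v m.+2 B' h -> cbd w m B a ->
  cbd (fun i => v i * w i ^+ 2) m B
    (fun i y => h i (y + a i y) - h i y - h' i (y, a i y)).
Proof.
move=> hw hB dh /cbd_inv[bh [g dg cg]] ca; apply: (cbd_taylor hw hB dh bh) => // M.
rewrite (_ : h' = g); first exact: cg.
apply/funext => i; apply/funext => -[p q].
by have := isd_unique (dh i p) (dg i p) => /(congr1 (fun f => f q)).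
Qed.

End Taylor.

(** * Passage to and from maps of class C^k *)

Section Smooth.
Variable R : realType.
Implicit Types E G H : normedVectType R.

Lemma linfun_lin E G (f : E -> G) x : linear f -> linfun f x = f x.
Proof. by move=> lf; rewrite -[X in linfun X]/(mklin lf : E -> G) lfunE. Qed.

Lemma frechetE E G (f : E -> G) x h : frechet f x h = 'd f x h.
Proof. by rewrite /frechet lfunE. Qed.

Lemma isd_frechet E G (f : E -> G) x : differentiable f x ->
  is_diff x f (fun h => frechet f x h).
Proof.
move=> df; apply: (is_diff_eq (differentiableP df)).
by apply/funext => h; rewrite frechetE.
Qed.

Lemma frechet_isd E G (f df : E -> G) x h : is_diff x f df -> frechet f x h = df h.
Proof. by move=> d; rewrite frechetE diff_val. Qed.

Lemma eval_linear1 E G (x : E) : linear (fun f : 'Hom(E, G) => f x).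
Proof. by move=> a f g; rewrite add_lfunE scale_lfunE. Qed.

Lemma eval_linear2 E G (f : 'Hom(E, G)) : linear (fun x => f x).
Proof. by move=> a x y; rewrite linearP. Qed.

Lemma cbd_linear_on (I : Type) m E G (B : set E) (l : E -> G) M : linear l ->
  (forall x, B x -> `|l x| <= M) -> cbd (fun _ : I => 1) m B (fun _ => l).
Proof.
move=> ll lM; apply: (@cbd_linear R I m E G B l (Num.max M 0)) => //.
  by rewrite le_max lexx orbT.
by move=> x /lM xM; rewrite le_max xM.
Qed.

Lemma Cbk_cbd (I : Type) m E G (f : E -> G) : Cbk m f ->
  cbd (fun _ : I => 1) m [set: E] (fun=> f).
Proof.
have bd E' G' (f' : E' -> G') : (exists M : R, forall x, `|f' x| <= M) ->
    exists2 C, 0 <= C & forall (i : I) x, [set: E'] x -> `|f' x| <= C * 1.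
  move=> [M hM]; exists (Num.max M 0); first by rewrite le_max lexx orbT.
  by move=> i x _; rewrite mulr1 le_max hM.
elim: m E G f => [|m IH] E G f; first by move=> [h1 h2]; split=> //; exact: bd.
move=> [h1 [df cf]]; split; first exact: bd.
exists (fun=> fun p => frechet f p.1 p.2); first by move=> i x; exact: isd_frechet.
move=> M.
have := @cbd_bilin R I (fun=> 1) (fun=> 1) m (E * E)%type 'Hom(E, G) E G
  ([set: E] `*` cball M) (fun _ p => frechet f p.1) (fun _ p => p.2)
  (fun f x => f x) (@eval_linear1 E G) (@eval_linear2 E G).
have c1 : cbd (fun _ : I => 1) m ([set: E] `*` (@cball R E M)) (fun _ (p : E * E) => frechet f p.1).
  exact: (@cbd_fst R I (fun=> 1) m E E _ [set: E] (cball M) (fun=> frechet f) (IH _ _ _ cf)).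
have c2 : cbd (fun _ : I => 1) m ([set: E] `*` (@cball R E M)) (fun _ (p : E * E) => p.2).
  by apply: (@cbd_linear_on I m (E * E)%type E _ snd M) => // -[x y] [_ yM].
move=> /(_ c1 c2); apply: (@cbd_weight R I _ _ m _ _ _ _ 1) => // i; rewrite !mulr1.
Qed.

Lemma frechet_crd E G (f : E -> G) x : (forall x, differentiable f x) ->
  frechet f x = \sum_i linfun (fun y => crd i y *: frechet f x (vbasis {:E})`_i).
Proof.
move=> df; apply/lfunP => h; rewrite sum_lfunE {1}(crdE h) linear_sum.
apply: eq_bigr => i _; rewrite linearZ/=.
have ll : linear (fun y : E => crd i y *: frechet f x (vbasis {:E})`_i).
  by move=> a u v; rewrite crdD crdZ scalerDl scalerA.
by rewrite linfun_lin.
Qed.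

(** An operator-valued derivative is a finite combination of its values
    at basis vectors, and these are values of the derivative in the sense of cbd at a frozen
    direction. *)
Lemma cbd_Ck m E G (f : E -> G) :
  (forall M, cbd (fun _ : unit => 1) m (cball M) (fun=> f)) -> Ck m f.
Proof.
elim: m E G f => [|m IH] E G f cf; first by have [_ /(_ tt)] := cf 0.
have df x : differentiable f x.
  by have [_ [g dg _]] := cf 0; exact: (@ex_diff _ _ _ _ _ _ _ (dg tt x)).
split=> //; apply: IH => M.
rewrite (_ : (fun=> frechet f) = (fun=> fun x => \sum_i
  linfun (fun y => crd i y *: frechet f x (vbasis {:E})`_i))); last first.
  by apply/funext => _; apply/funext => x; exact: frechet_crd.
apply: cbd_sum => i; set e := (vbasis {:E})`_i.
have ll (z : G) : linear (fun y : E => crd i y *: z).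
  by move=> a u v; rewrite crdD crdZ scalerDl scalerA.
have lE (z : G) y : linfun (fun y : E => crd i y *: z) y = crd i y *: z.
  by rewrite linfun_lin.
apply: (@cbd_lin R unit _ m E G _ _ (fun=> fun x => frechet f x e)
  (fun z : G => linfun (fun y : E => crd i y *: z))).
  move=> a u v; apply/lfunP => y; rewrite add_lfunE scale_lfunE !lE.
  by rewrite scalerDr !scalerA mulrC.
have [_ [g dg cg]] := cbd_inv (cf M).
rewrite (_ : (fun=> fun x => frechet f x e) = (fun u x => g u (x, e))); last first.
  by apply/funext => u; apply/funext => x; exact: (frechet_isd e (dg u x)).
apply: (@cbd_comp R unit _ m E (E * E)%type G (cball M) (cball M `*` cball `|e|) g
  (fun=> fun x => (x, e))) => //.
  by move=> _ x xM; split=> //=; rewrite /cball/=.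
apply: cbd_pair.
  exact: (@cbd_linear_on unit m E E _ id M).
by apply: (@cbd_cst R unit _ m E E _ (fun=> e) `|e|) => // _; rewrite mulr1.
Qed.

End Smooth.

(** * Germs and the existence of Davie paths *)

(** Both halves obey the ratio 2/3 of theta, even when n is odd. *)
Lemma halving n : (2 <= n)%N -> exists m k, [/\ n = (m + k)%N, (m < n)%N, (k < n)%N,
  (3 * m <= 2 * n)%N & (3 * k <= 2 * n)%N].
Proof. by move=> n2; exists n./2, (n - n./2)%N; split; lia. Qed.

Section Germs.
Variables (R : realType) (al : R).
Hypotheses (al3 : 3^-1 < al) (al2 : al <= 2^-1).
Variable E : normedVectType R.
Local Notation lw := (lw al).

(** The failure of y |-> y + A s t y to compose like a flow. *)
Definition coboundary (A : R -> R -> E -> E) s u t y := A s t y - A s u y - A u t (y + A s u y).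

(** Davie's notion of solution: the germ predicts the increments up to third order. *)
Definition davie (A : R -> R -> E -> E) (T K : R) (Y : R -> E) :=
  forall s t, - T <= s -> s <= t -> t <= T ->
    `|Y t - Y s - A s t (Y s)| <= K * lw s t ^+ 3.

(** The remainder over [s, t] is the sum of the remainders over the two pieces, up to the
    coboundary and to the shift of the base point of A u t. *)
Lemma defect_split (A : R -> R -> E -> E) s u t (a b c : E) :
  c - a - A s t a = (b - a - A s u a) + (c - b - A u t b) - coboundary A s u t a
    + (A u t b - A u t (a + A s u a)).
Proof. rewrite /coboundary; vring. Qed.

(** Bounds that do not depend on the state; they exclude explosion. *)
Definition glob_germ (A : R -> R -> E -> E) (T C : R) :=
  forall s u t, - T <= s -> s <= u -> u <= t -> t <= T ->
  [/\ forall y, `|A s t y| <= C * lw s t,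
      forall y y', `|A s t y - A s t y'| <= C * lw s t * `|y - y'| &
      forall y, `|coboundary A s u t y| <= C * (lw s u * lw u t * lw s t)].

Lemma cube_le s u t : s <= u -> u <= t -> lw s u * lw u t * lw s t <= lw s t ^+ 3.
Proof.
move=> su ut; rewrite [X in _ <= X]exprSr expr2.
have st := le_trans su ut; have l1 := @lw_le R al al3 s s u t (lexx _) su ut.
have l2 := @lw_le R al al3 u s t t su ut (lexx _).
by rewrite ler_pM ?mulr_ge0 ?lw_ge0// ler_pM ?lw_ge0.
Qed.

Section Euler.
Variables (A : R -> R -> E -> E) (T C e th tau h : R) (y : nat -> E) (N : nat).
Hypotheses (gA : glob_germ A T C) (C0 : 0 <= C) (th01 : 0 <= th < 1).
Hypotheses (eth : (1 + C * e) * theta al <= th) (h0 : 0 < h).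
Hypothesis (le_e : forall s t, s <= t -> t - s <= tau -> lw s t <= e).
Let g (i : nat) := - T + i%:R * h.
Hypothesis (NT : N%:R * h <= 2 * T).
Hypothesis (ystep : forall i, (i < N)%N -> y i.+1 = y i + A (g i) (g i.+1) (y i)).

Let gle i j : (i <= j)%N -> g i <= g j.
Proof. by move=> ij; rewrite /g lerD2l ler_wpM2r ?ler_nat// ltW. Qed.

Let gT i : - T <= g i.
Proof. by rewrite /g lerDl mulr_ge0// ltW. Qed.

Let gN i : (i <= N)%N -> g i <= T.
Proof.
move=> /gle /le_trans; apply; rewrite /g; move: NT; lra.
Qed.

(** Induction on the number of steps, cutting the grid interval at its discrete midpoint. One
    step has no defect at all, so that the constant does not depend on the mesh h. *)
Lemma euler_defect n i : (i + n <= N)%N -> n%:R * h <= tau ->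
  `|y (i + n)%N - y i - A (g i) (g (i + n)%N) (y i)| <=
     C / (1 - th) * lw (g i) (g (i + n)%N) ^+ 3.
Proof.
set K := C / (1 - th).
have /andP[th0 th1] := th01.
have th1' : 0 < 1 - th by rewrite subr_gt0.
have K0 : 0 <= K by rewrite /K divr_ge0// ltW.
elim: n {-2}n (leqnn n) i => [|p IH] n np i.
  move: np; rewrite leqn0 => /eqP -> iN _; rewrite addn0 in iN *; rewrite subrr sub0r normrN.
  have [h1 _ _] := gA (gT i) (lexx _) (lexx _) (gN iN).
  by apply: le_trans (h1 _) _; rewrite lw_refl// mulr0 expr0n mulr0.
have [n2|] := leqP 2 n; last first.
  case: n np => [|[|//]] np _ iN nt; first exact: IH.
  rewrite addn1 in iN *; rewrite ystep//.
  by rewrite [y i + _]addrC addrK subrr normr0 mulr_ge0// exprn_ge0// lw_ge0.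
move=> iN nt; have [m [k [nE mn kn m3 k3]]] := halving n2.
have hm : m%:R * h <= tau.
  by apply: le_trans nt; rewrite ler_wpM2r ?(ltW h0)// ler_nat ltnW.
have hk : k%:R * h <= tau.
  by apply: le_trans nt; rewrite ler_wpM2r ?(ltW h0)// ler_nat ltnW.
have r1 := IH m (leq_trans mn np) i _ hm.
have r2 := IH k (leq_trans kn np) (i + m)%N _ hk.
have {}r1 := r1 (leq_trans (leq_add (leqnn i) (ltnW mn)) iN).
have E1 : (i + m + k = i + n)%N by rewrite nE addnA.
rewrite E1 in r2; have {}r2 := r2 iN.
have su : g i <= g (i + m)%N by apply: gle; rewrite leq_addr.
have ut : g (i + m)%N <= g (i + n)%N by apply: gle; rewrite leq_add2l ltnW.
have [_ _ co] := gA (gT i) su ut (gN iN).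
have [_ lip2 _] := gA (gT (i + m)%N) (lexx _) ut (gN iN).
rewrite (defect_split _ _ (g (i + m)%N) _ _ (y (i + m)%N)).
have gd a b : g (a + b)%N - g a = b%:R * h by rewrite /g natrD; ring.
have hl : lw (g (i + m)%N) (g (i + n)%N) <= e.
  by apply: le_e => //; rewrite -E1 gd.
set l1 := lw (g i) (g (i + m)%N) in r1 co *.
set l2 := lw (g (i + m)%N) (g (i + n)%N) in r2 co lip2 hl *.
set l := lw (g i) (g (i + n)%N) in co *.
have l10 : 0 <= l1 by exact: lw_ge0.
have l20 : 0 <= l2 by exact: lw_ge0.
have split3 : l1 ^+ 3 + l2 ^+ 3 <= theta al * l ^+ 3.
  apply: lw_cube_split => //.
    rewrite !gd mulrA ler_wpM2r ?(ltW h0)//.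
    have : (3 * m)%:R <= (2 * n)%:R :> R by rewrite ler_nat.
    by rewrite !natrM; lra.
  rewrite -E1 gd -addnA -nE gd mulrA ler_wpM2r ?(ltW h0)//.
  have : (3 * k)%:R <= (2 * n)%:R :> R by rewrite ler_nat.
  by rewrite !natrM; lra.
have co' : `|coboundary A (g i) (g (i + m)%N) (g (i + n)%N) (y i)| <= C * l ^+ 3.
  by apply: le_trans (co _) _; rewrite ler_wpM2l// cube_le.
have li : `|A (g (i + m)%N) (g (i + n)%N) (y (i + m)%N) -
    A (g (i + m)%N) (g (i + n)%N) (y i + A (g i) (g (i + m)%N) (y i))| <=
    C * e * (K * l1 ^+ 3).
  apply: le_trans (lip2 _ _) _; rewrite opprD addrA.
  by apply: ler_pM => //; rewrite ?mulr_ge0// ler_wpM2l.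
apply: le_trans (ler_normD _ _) _.
apply: le_trans (lerD (ler_normB _ _) li) _.
apply: le_trans (lerD (lerD (le_trans (ler_normD _ _) (lerD r1 r2)) co') (lexx _)) _.
have e0 : 0 <= e by exact: le_trans hl.
have l30 : 0 <= l ^+ 3 by rewrite exprn_ge0// lw_ge0.
apply: (@le_trans _ _ ((1 + C * e) * (K * (l1 ^+ 3 + l2 ^+ 3)) + C * l ^+ 3)).
  have : 0 <= C * e * (K * l2 ^+ 3) by apply: mulr_ge0; [exact: mulr_ge0 | apply: mulr_ge0 => //; exact: exprn_ge0].
  by lra.
apply: (@le_trans _ _ ((1 + C * e) * (K * (theta al * l ^+ 3)) + C * l ^+ 3)).
  rewrite lerD2r ler_wpM2l//; last by rewrite ler_wpM2l.
  by rewrite addr_ge0// mulr_ge0.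
have -> : K * l ^+ 3 = th * (K * l ^+ 3) + C * l ^+ 3.
  by rewrite /K; field; rewrite gt_eqF.
rewrite lerD2r.
have -> : (1 + C * e) * (K * (theta al * l ^+ 3)) =
  (1 + C * e) * theta al * (K * l ^+ 3) by ring.
by rewrite ler_wpM2r// mulr_ge0.
Qed.

Lemma euler_increment n i : (i + n <= N)%N -> n%:R * h <= tau ->
  `|y (i + n)%N - y i| <= C * e + C / (1 - th) * e ^+ 3.
Proof.
move=> iN nt; have d := euler_defect iN nt.
have gd : g (i + n)%N - g i = n%:R * h by rewrite /g natrD; ring.
have st : g i <= g (i + n)%N by apply: gle; rewrite leq_addr.
have le : lw (g i) (g (i + n)%N) <= e by apply: le_e => //; rewrite gd.
have [bA _ _] := gA (gT i) (lexx _) st (gN iN).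
have K0 : 0 <= C / (1 - th).
  by case/andP: th01 => _ ?; rewrite divr_ge0// subr_ge0 ltW.
rewrite -[_ - _](subrK (A (g i) (g (i + n)%N) (y i))) addrC.
apply: le_trans (ler_normD _ _) _; apply: lerD.
  by apply: le_trans (bA _) _; rewrite ler_wpM2l.
apply: (le_trans d); rewrite ler_wpM2l// lerXn2r// nnegrE ?lw_ge0//.
by apply: le_trans le; rewrite lw_ge0.
Qed.

(** Intervals of arbitrary length are covered by pieces of at most tau; as h <= tau / 2, a maximal
    piece is longer than tau / 2. *)
Lemma euler_chain (b : R) : h <= tau / 2 ->
  (forall n i, (i + n <= N)%N -> n%:R * h <= tau -> `|y (i + n)%N - y i| <= b) ->
  forall k n i, (i + n <= N)%N -> n%:R * h <= k%:R * (tau / 2) ->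
  `|y (i + n)%N - y i| <= k.+1%:R * b.
Proof.
move=> ht hb; have b0 : 0 <= b.
  have := hb 0%N 0%N; rewrite addn0 subrr normr0 mul0r; apply => //.
  by have := le_trans (ltW h0) ht; lra.
elim=> [|k IH] n i iN nk.
  rewrite mul1r; apply: hb => //; apply: (le_trans nk); rewrite mul0r.
  by have := le_trans (ltW h0) ht; lra.
pose q := minn n (Num.trunc (tau / h)).
have tau0 : 0 <= tau by have := le_trans (ltW h0) ht; lra.
have qn : (q <= n)%N by rewrite geq_minl.
have qt : q%:R * h <= tau.
  rewrite -ler_pdivlMr//; apply: (@le_trans _ _ (Num.trunc (tau / h))%:R).
    by rewrite ler_nat geq_minr.
  by rewrite truncn_le divr_ge0// ltW.
have e1 : (i + q + (n - q) = i + n)%N by rewrite -addnA subnKC.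
have r : (n - q)%:R * h <= k%:R * (tau / 2).
  have [nq|nq] := leqP n (Num.trunc (tau / h)).
    rewrite /q (minn_idPl nq) subnn mul0r mulr_ge0// divr_ge0//.
  have qE : q = Num.trunc (tau / h) by rewrite /q (minn_idPr (ltnW nq)).
  have hq : tau < q.+1%:R * h.
    by rewrite -ltr_pdivrMr// qE; exact: truncnS_gt.
  rewrite natrB// mulrBl; move: nk hq ht; rewrite -[k.+1%:R]natr1 -[q.+1%:R]natr1.
  by move=> ? ?; lra.
have i1 : (i + q <= N)%N by rewrite (leq_trans _ iN)// leq_add2l.
have i2 : (i + q + (n - q) <= N)%N by rewrite e1.
have := IH (n - q)%N (i + q)%N i2 r; rewrite e1 => r1.
have r2 := hb q i i1 qt.
rewrite -(subrK (y (i + q)%N) (y (i + n)%N)) -addrA.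
apply: le_trans (ler_normD _ _) _; apply: le_trans (lerD r1 r2) _.
by rewrite -[k.+2%:R]natr1 mulrDl mul1r.
Qed.

End Euler.

(** The initial value is prescribed at the middle of the grid: the map from the first state to
    the i-th one is onto, because each step is. *)
Lemma euler_exists A T C e h (N : nat) (w : E) : glob_germ A T C -> 0 <= C -> 0 < h ->
  C * e <= 2^-1 -> (2 * N)%:R * h <= 2 * T ->
  (forall s t, s <= t -> t - s <= h -> lw s t <= e) ->
  exists2 y : nat -> E, y N = w & forall i, (i < 2 * N)%N ->
    y i.+1 = y i + A (- T + i%:R * h) (- T + i.+1%:R * h) (y i).
Proof.
move=> gA C0 h0 Ce NT le_e; pose g (i : nat) := - T + i%:R * h.
pose step i x := x + A (g i) (g i.+1) x.
pose ys x := fix ys (i : nat) : E := if i is i'.+1 then step i' (ys i') else x.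
have gS i : g i.+1 - g i = h by rewrite /g -[i.+1%:R]natr1; ring.
have surj i : (i <= 2 * N)%N -> forall z, exists x, ys x i = z.
  elim: i => [|i IH] iN z; first by exists z.
  have gi : - T <= g i by rewrite /g lerDl mulr_ge0// ltW.
  have gii : g i <= g i.+1 by rewrite -subr_ge0 gS ltW.
  have giT : g i.+1 <= T.
    have : i.+1%:R * h <= (2 * N)%:R * h by rewrite ler_wpM2r ?(ltW h0)// ler_nat.
    by move=> /le_trans/(_ NT); rewrite /g; clear -al3 al2 E; lra.
  have [_ lip _] := gA _ _ _ gi (lexx _) gii giT.
  have [x hx] : exists x, x + A (g i) (g i.+1) x = z.
    apply: lipschitz_surj => p q; apply: le_trans (lip p q) _.
    rewrite ler_wpM2r//; apply: le_trans Ce; rewrite ler_wpM2l// le_e//.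
    by rewrite gS.
  by have [x' hx'] := IH (ltnW iN) x; exists x'; rewrite /= hx'.
have N2 : (N <= 2 * N)%N by rewrite leq_pmull.
by have [x hx] := surj N N2 w; exists (ys x).
Qed.

(** Moving both times to the grid costs two coboundaries and two germs over short intervals. *)
Lemma germ_time_shift A T C s' s t' t z : glob_germ A T C -> 0 <= C -> 
  - T <= s' -> s' <= s -> s <= t' -> t' <= t -> t <= T ->
  forall eta, lw s' s <= eta -> lw t' t <= eta ->
  forall W, lw s' t <= W ->
  `|A s' t' z - A s t z| <= (2 * C + 2 * C * W ^+ 2 + C * W * C) * eta.
Proof.
move=> gA C0 Ts' ss st tt tT eta h1 h2 W hW.
have s't' := le_trans ss st; have st' := le_trans st tt; have s't := le_trans s't' tt.
have t'T := le_trans tt tT; have Ts := le_trans Ts' ss; have Tt' := le_trans Ts st.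
have [_ _ co1] := gA s' t' t Ts' s't' tt tT.
have [_ _ co2] := gA s' s t Ts' ss st' tT.
have [b1 _ _] := gA t' t' t Tt' (lexx _) tt tT.
have [b2 _ _] := gA s' s' s Ts' (lexx _) ss (le_trans st' tT).
have [_ lip _] := gA s s t Ts (lexx _) st' tT.
have l1 : lw s' t' <= W by apply: le_trans hW; exact: lw_le.
have l2 : lw s t <= W by apply: le_trans hW; exact: lw_le.
have lg := @lw_ge0 R al.
have W0 : 0 <= W by apply: le_trans hW.
have eta0 : 0 <= eta by apply: le_trans h1.
rewrite (_ : _ - _ = coboundary A s' s t z + A s' s z + (A s t (z + A s' s z) - A s t z)
   - coboundary A s' t' t z - A t' t (z + A s' t' z)); last first.
  by rewrite /coboundary; vring.
have n1 : `|coboundary A s' s t z| <= C * (eta * W * W).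
  apply: le_trans (co2 z) _; rewrite ler_wpM2l// ler_pM ?mulr_ge0//.
  by rewrite ler_pM.
have n2 : `|coboundary A s' t' t z| <= C * (W * eta * W).
  apply: le_trans (co1 z) _; rewrite ler_wpM2l// ler_pM ?mulr_ge0//.
  by rewrite ler_pM.
have n3 : `|A s' s z| <= C * eta by apply: le_trans (b2 z) _; rewrite ler_wpM2l.
have n4 : `|A t' t (z + A s' t' z)| <= C * eta.
  by apply: le_trans (b1 _) _; rewrite ler_wpM2l.
have n5 : `|A s t (z + A s' s z) - A s t z| <= C * W * (C * eta).
  apply: le_trans (lip _ _) _; rewrite [z + _]addrC addrK.
  by rewrite ler_pM ?mulr_ge0// ler_wpM2l.
apply: le_trans (ler_normB _ _) _.
apply: le_trans (lerD (le_trans (ler_normB _ _) (lerD (le_trans (ler_normD _ _)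
  (lerD (le_trans (ler_normD _ _) (lerD n1 n3)) n5)) n2)) n4) _.
by clear -al3 al2 E; lra.
Qed.

(** The Euler schemes of mesh T / (n + 1) converge along an ultrafilter, and euler_defect passes to
    the limit. On intervals longer than tau / 2 the increments of Y are merely bounded, which
    is enough there since lw is bounded below. *)
Theorem davie_exists T C : 0 < T -> 0 <= C -> exists2 K, 0 <= K &
  forall A, glob_germ A T C -> forall w, exists Y : R -> E,
   [/\ Y 0 = w, davie A T K Y & forall t, - T <= t -> t <= T -> `|Y t - w| <= K].
Proof.
move=> T0 C0; have th0' := @theta_gt0 R al; have th1' := theta_lt1 al3.
set th0 := theta al in th0' th1'.
pose th := (1 + th0) / 2.
have th01 : 0 <= th < 1 by rewrite /th; clear -al3 al2 E th0' th1'; lra.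
have [e [e0 Ce eth]] : exists e, [/\ 0 < e, C * e <= 2^-1 & (1 + C * e) * theta al <= th].
  (* The first bound makes Euler steps invertible, the second one is required by euler_defect. *)
  exists (Num.min (2 * (C + 1))^-1 ((1 - th0) / (2 * (C + 1)))).
  set e := Num.min _ _.
  have C2 : 0 < 2 * (C + 1) by clear -al3 al2 E C0; lra.
  have e0 : 0 < e by rewrite /e lt_min invr_gt0 divr_gt0 ?subr_gt0 ?andbT.
  split=> //.
    have : e <= (2 * (C + 1))^-1 by rewrite /e ge_min lexx.
    rewrite -[_^-1]mul1r ler_pdivlMr// -[2^-1]mul1r ler_pdivlMr//.
    by clear -al3 al2 E e0; lra.
  have : e <= (1 - th0) / (2 * (C + 1)) by rewrite /e ge_min lexx orbT.
  rewrite ler_pdivlMr// -/th0 => h.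
  have : C * e * th0 <= C * e by rewrite ler_piMr ?mulr_ge0// ltW.
  by rewrite /th; clear -al3 al2 E h e0; lra.
have [tau tau0 htau] := lw_small al3 e0.
have t20 : 0 < tau / 2 by rewrite divr_gt0.
pose K1 := C / (1 - th).
have K10 : 0 <= K1 by rewrite /K1 divr_ge0//; case/andP: th01 => _ ?; rewrite subr_ge0 ltW.
pose b := C * e + K1 * e ^+ 3.
have b0 : 0 <= b.
  by rewrite addr_ge0// mulr_ge0// ?exprn_ge0// ltW.
have [k hk] : exists k : nat, 2 * T <= k%:R * (tau / 2).
  exists (Num.trunc (2 * T / (tau / 2))).+1.
  by rewrite -ler_pdivrMr//; apply/ltW/truncnS_gt.
pose K2 := k.+1%:R * b.
have K20 : 0 <= K2 by rewrite mulr_ge0.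
pose W := (2 * T) `^ al.
have W0 : 0 <= W by exact: powR_ge0.
have [q q0 hq] : exists2 q : R, 0 <= q &
    forall s t, tau / 2 <= t - s -> 1 <= lw s t ^+ 3 * q.
  (* The factor that absorbs a mere bound into lw ^ 3 on long intervals. *)
  exists (((tau / 2) `^ al) ^- 3); first by rewrite invr_ge0 exprn_ge0// powR_ge0.
  move=> s t h; rewrite ler_pdivlMr ?mul1r ?exprn_gt0 ?powR_gt0//.
  rewrite lerXn2r ?nnegrE ?lw_ge0 ?powR_ge0//.
  have h0 := le_trans (ltW t20) h.
  by rewrite /lw ge0_ler_powR ?nnegrE ?(ltW t20) ?(ltW (al0 al3)).
have Q1 : 0 <= 8 * K1 by exact: mulr_ge0.
have Q3 : 0 <= 2 * K2 + C * W by apply: addr_ge0; exact: mulr_ge0.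
have Q2 : 0 <= (2 * K2 + C * W) * q by exact: mulr_ge0.
exists (8 * K1 + (2 * K2 + C * W) * q + K2).
  by apply: addr_ge0 => //; exact: addr_ge0.
move=> A gA w; pose h (n : nat) : R := T / n.+1%:R.
have h0 n : 0 < h n by rewrite divr_gt0.
have hN n : n.+1%:R * h n = T by rewrite mulrC divfK.
have cvh : h @ \oo --> (0 : R).
  rewrite (_ : h = fun n => T * n.+1%:R^-1)// -[X in _ --> X](mulr0 T).
  by apply: cvgM; [exact: cvg_cst|exact: cvg_harmonic].
have hsmall (r : R) : 0 < r -> \forall n \near \oo, h n <= r.
  move=> r0; move/cvgrPdist_le : cvh => /(_ r r0); apply: filterS => n.
  by rewrite sub0r normrN ger0_norm// ltW.
pose g n (i : nat) := - T + i%:R * h n.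
have /choice[y hy] : forall n, exists y : nat -> E, h n <= tau / 2 -> y n.+1 = w /\
    forall i, (i < 2 * n.+1)%N -> y i.+1 = y i + A (g n i) (g n i.+1) (y i).
  move=> n; have [hn|hn] := leP (h n) (tau / 2); last by exists (fun=> 0).
  have [|s t st hs|y yN yS] := @euler_exists A T C e (h n) n.+1 w gA C0 (h0 n) Ce.
  - by rewrite natrM -mulrA hN.
  - by apply: htau => //; apply: le_trans hs (le_trans hn _); clear -al3 al2 E tau0; lra.
  - by exists y => _; split.
have NT n : (2 * n.+1)%:R * h n <= 2 * T by rewrite natrM -mulrA hN.
(* The number of the last grid point before t. *)
pose idx n t := Num.trunc ((t + T) / h n).
have idxP n t : - T <= t -> t <= T ->
    [/\ (idx n t <= 2 * n.+1)%N, g n (idx n t) <= t & t <= g n (idx n t) + h n].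
  move=> Tt tT; have p0 : 0 <= (t + T) / h n.
    by rewrite divr_ge0 ?(ltW (h0 n))//; clear -al3 al2 E Tt; lra.
  have h1 : (idx n t)%:R * h n <= t + T by rewrite -ler_pdivlMr// truncn_le.
  have h2 : t + T < (idx n t).+1%:R * h n by rewrite -ltr_pdivrMr//; exact: truncnS_gt.
  split.
  - rewrite -(ler_nat R) -(ler_pM2r (h0 n)); apply: (le_trans h1).
    by rewrite natrM -mulrA hN; clear -al3 al2 E tT; lra.
  - by rewrite /g; clear -al3 al2 E h1; lra.
  - by move: h2; rewrite /g -[_.+1%:R]natr1; clear -al3 al2 E; lra.
pose P n := h n <= tau / 2.
have nearP : \forall n \near \oo, P n by exact: hsmall.
have yincr n i j : P n -> (i <= j)%N -> (j <= 2 * n.+1)%N -> `|y n j - y n i| <= K2.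
  move=> Pn ij jN; have [_ yS] := hy n Pn.
  rewrite -(subnKC ij).
  apply: (@euler_chain tau (h n) (y n) (2 * n.+1) (h0 n) b) => //; last 2 first.
  - by rewrite subnKC.
  - apply: le_trans hk; apply: le_trans (NT n); rewrite ler_wpM2r ?(ltW (h0 n))//.
    by rewrite ler_nat (leq_trans (leq_subr _ _)).
  move=> m p pN mt; exact: (@euler_increment A T C e th tau (h n) (y n) (2 * n.+1)).
have ybd n i : P n -> (i <= 2 * n.+1)%N -> `|y n i - w| <= K2.
  move=> Pn iN; have [<- _] := hy n Pn.
  have [h1|h1] := leqP i n.+1; first by rewrite distrC yincr// leq_pmull.
  by rewrite yincr// ltnW.
have [G [GU sG]] := ultraFilterLemma (@eventually_filter).
have near_oo (Q : nat -> Prop) : (\forall n \near \oo, Q n) -> \forall n \near G, Q n.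
  by move=> hQ; apply: sG.
have /choice[Y hY] : forall t, exists l : E, - T <= t <= T ->
    (fun n => y n (idx n t)) @ G --> l.
  move=> t; have [/andP[Tt tT]|] := boolP (- T <= t <= T); last by exists 0.
  have [|l hl] := @ultra_cvg R E nat G (fun n => y n (idx n t)) (K2 + `|w|) GU.
    apply: near_oo; apply: filterS nearP => n Pn; have [iN _ _] := idxP n t Tt tT.
    rewrite -[y n _](subrK w) (le_trans (ler_normD _ _))// lerD2r; exact: ybd.
  by exists l.
have Yw t : - T <= t -> t <= T -> `|Y t - w| <= K2.
  move=> Tt tT; have hYt := hY t; rewrite Tt tT in hYt.
  apply: (@lim_norm_le R E nat G (fun n => y n (idx n t) - w) (fun=> K2)).
  - by apply: cvgB; [exact: hYt|exact: cvg_cst].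
  - exact: cvg_cst.
  - apply: near_oo; apply: filterS nearP => n Pn; apply: ybd => //.
    by have [] := idxP n t Tt tT.
exists Y; split.
- have T00 : - T <= 0 <= T by clear -al3 al2 E T0; lra.
  have h00 := hY 0 T00.
  have hw : (fun n => y n (idx n 0)) @ G --> w.
    apply: (@cvg_squeeze R E nat G _ (fun=> 0)); first exact: cvg_cst.
    apply: near_oo; apply: filterS nearP => n Pn; have [yN _] := hy n Pn.
    suff -> : idx n 0 = n.+1 by rewrite yN subrr normr0.
    by rewrite /idx add0r -{1}(hN n) mulfK ?gt_eqF// natrK.
  exact: (cvg_unique _ h00 hw).
- move=> s t Ts st tT; have sT := le_trans st tT; have Tt := le_trans Ts st.
  have l30 : 0 <= lw s t ^+ 3 by rewrite exprn_ge0 ?lw_ge0.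
  have [bA lipA _] := gA s s t Ts (lexx _) st tT.
  have lW : lw s t <= W by rewrite lw_bound//; clear -al3 al2 E Ts tT; lra.
  have [hts|/ltW hts] := leP (t - s) (tau / 2); last first.
    apply: (@le_trans _ _ (2 * K2 + C * W)).
      have e1 : Y t - Y s - A s t (Y s) = (Y t - w) - (Y s - w) - A s t (Y s).
        by vring.
      rewrite e1; apply: le_trans (ler_normB _ _) _.
      apply: le_trans (lerD (le_trans (ler_normB _ _) (lerD (Yw t Tt tT) (Yw s Ts sT))) (bA _)) _.
      rewrite mulr2n mulrDl mul1r lerD2l ler_wpM2l//.
    apply: (@le_trans _ _ ((2 * K2 + C * W) * q * lw s t ^+ 3)).
      by rewrite -mulrA [q * _]mulrC ler_peMr// hq.
    by rewrite ler_wpM2r// -addrA addrCA lerDl; exact: addr_ge0.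
  move: st; rewrite le_eqVlt => /predU1P[est|st].
    rewrite -est subrr sub0r normrN; have [b1 _ _] := gA s s s Ts (lexx _) (lexx _) sT.
    by apply: le_trans (b1 _) _; rewrite lw_refl// mulr0 expr0n mulr0.
  have hYs : (fun n => y n (idx n s)) @ G --> Y s by apply: hY; rewrite Ts.
  have hYt : (fun n => y n (idx n t)) @ G --> Y t by apply: hY; rewrite Tt.
  (* Rounding s and t down to a fine grid at most doubles t - s, hence 8 = 2 ^ 3. *)
  apply: (@le_trans _ _ (8 * K1 * lw s t ^+ 3)); last first.
    by rewrite ler_wpM2r// -addrA lerDl; exact: addr_ge0.
  pose B n := A (g n (idx n s)) (g n (idx n t)) (y n (idx n s)).
  have nearst : \forall n \near \oo, P n /\ h n <= t - s.
    by near=> n; split; near: n => //; apply: hsmall; rewrite subr_gt0.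
  have main n : P n /\ h n <= t - s -> [/\ (idx n s <= idx n t)%N,
      - T <= g n (idx n s), g n (idx n s) <= s, s <= g n (idx n t) &
      g n (idx n t) <= t] /\ lw (g n (idx n s)) (g n (idx n t)) <= 2 * lw s t.
    move=> [Pn hn]; have [iN i1 i2] := idxP n s Ts sT; have [jN j1 j2] := idxP n t Tt tT.
    have sj : s <= g n (idx n t) by clear -al3 al2 E j2 hn; lra.
    split.
      split=> //; last by rewrite /g lerDl mulr_ge0// ltW.
      have := le_trans i1 sj; rewrite /g lerD2l (ler_pM2r (h0 n)) ler_nat//.
    have al0' := al0 al3; have al21' := al21 al2.
    apply: (@le_trans _ _ ((2 * (t - s)) `^ al)).
      rewrite /lw ge0_ler_powR ?nnegrE ?(ltW al0')//; first by clear -al3 al2 E i1 sj; lra.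
        by clear -al3 al2 E st; lra.
      by clear -al3 al2 E i1 i2 j1 hn; lra.
    rewrite powRM//; last by rewrite subr_ge0 ltW.
    rewrite ler_wpM2r ?powR_ge0// -[leRHS]powRr1// ler_powR ?ler1n//.
    by clear -al3 al2 E al0' al21'; lra.
  apply: (@lim_norm_le R E nat G (fun n => y n (idx n t) - y n (idx n s) - B n)
    (fun=> 8 * K1 * lw s t ^+ 3)).
  + apply: cvgB; first exact: cvgB.
    (* Two errors: the times of the germ are moved to the grid, and Y s is replaced by the value
       of the scheme. *)
    pose eta n := lw 0 (h n).
    apply: (@cvg_squeeze R E nat G _ (fun n =>
      (2 * C + 2 * C * W ^+ 2 + C * W * C) * eta n + C * W * `|y n (idx n s) - Y s|)).
      rewrite -[X in _ --> X]addr0; apply: cvgD.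
        rewrite -[X in _ --> X](mulr0 (2 * C + 2 * C * W ^+ 2 + C * W * C)).
        apply: cvgM; first exact: cvg_cst.
        have ce : eta @ \oo --> (0 : R).
          apply/cvgrPdist_le => r r0; have [d d0 hd] := lw_small al3 r0.
          apply: filterS (hsmall d d0) => n hn.
          rewrite sub0r normrN ger0_norm ?lw_ge0// /eta.
          by apply: hd; rewrite ?(ltW (h0 n))// subr0.
        by move=> U /ce /sG.
      rewrite -[X in _ --> X](mulr0 (C * W)); apply: cvgM; first exact: cvg_cst.
      exact: cvg_dist0.
    apply: near_oo; apply: filterS nearst => n nst.
    have [[ij gi i1 sj jt] _] := main n nst.
    have [_ _ i2] := idxP n s Ts sT; have [_ _ j2] := idxP n t Tt tT.
    rewrite -(subrKA (A (g n (idx n s)) (g n (idx n t)) (Y s))) addrC.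
    apply: le_trans (ler_normD _ _) _; apply: lerD.
      have lwe p r : r - p <= h n -> p <= r -> lw p r <= eta n.
        move=> pr1 pr2; rewrite /eta /lw subr0 ge0_ler_powR ?nnegrE ?subr_ge0 ?(ltW (h0 n))//.
        exact: ltW (al0 al3).
      apply: (germ_time_shift (Y s) gA C0 gi i1 sj jt tT).
      - by apply: lwe => //; clear -al3 al2 E i2; lra.
      - by apply: lwe => //; clear -al3 al2 E j2; lra.
      - rewrite lw_bound//; first exact: (le_trans i1 (ltW st)).
        by clear -al3 al2 E gi tT; lra.
    have ij' : g n (idx n s) <= g n (idx n t) by exact: le_trans sj.
    have jT := le_trans jt tT.
    have [_ lip _] := gA _ _ _ gi (lexx _) ij' jT.
    apply: le_trans (lip _ _) _; rewrite ler_wpM2r// ler_wpM2l// lw_bound//.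
    by clear -al3 al2 E gi jT; lra.
  + exact: cvg_cst.
  + apply: near_oo; apply: filterS nearst => n nst.
    have [[ij gi i1 sj jt] l2] := main n nst; have [Pn hn] := nst.
    have [iN _ i2] := idxP n s Ts sT; have [jN _ j2] := idxP n t Tt tT.
    have [_ yS] := hy n Pn.
    have := @euler_defect A T C e th tau (h n) (y n) (2 * n.+1) gA C0 th01 eth (h0 n) htau
       (NT n) yS (idx n t - idx n s)%N (idx n s).
    rewrite subnKC// => /(_ jN); rewrite -/(g n _) -/(g n _) => hh.
    have hh0 : (idx n t - idx n s)%:R * h n <= tau.
      rewrite natrB// mulrBl; move: jt i2; rewrite /g => jt i2.
      have Pn' : h n <= tau / 2 by exact: Pn.
      by clear -al3 al2 E jt i2 Pn' hts; lra.
    apply: le_trans (hh hh0) _.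
    have -> : 8 * K1 * lw s t ^+ 3 = K1 * (2 * lw s t) ^+ 3 by ring.
    rewrite ler_wpM2l//.
    by rewrite lerXn2r ?nnegrE ?mulr_ge0 ?lw_ge0.
- move=> t Tt tT; apply: le_trans (Yw t Tt tT) _; rewrite lerDr.
  exact: addr_ge0.
Unshelve. all: by end_near. Qed.

End Germs.

(** * Stability of Davie paths and of their linearisation *)

Section LipschitzBounds.
Variables (R : realType) (I : Type).
Implicit Types (w : I -> R).

Definition convex_set (E : normedVectType R) (B : set E) :=
  forall x y th, 0 <= th <= 1 -> B x -> B y -> B (x + th *: (y - x)).

Lemma cball_convex (E : normedVectType R) M : convex_set (@cball R E M).
Proof.
move=> x y th /andP[th0 th1] xM yM; rewrite /cball/=.
rewrite (_ : x + _ = (1 - th) *: x + th *: y); last by vring.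
apply: le_trans (ler_normD _ _) _; rewrite !normrZ !ger0_norm ?subr_ge0//.
have -> : M = (1 - th) * M + th * M by ring.
by rewrite lerD// ler_wpM2l// subr_ge0.
Qed.

Lemma setX_convex (E G : normedVectType R) (B : set E) (B' : set G) :
  convex_set B -> convex_set B' -> convex_set (B `*` B').
Proof.
by move=> cB cB' [x1 x2] [y1 y2] th th01 [/= h1 h2] [/= h3 h4]; split=> /=;
  [exact: cB|exact: cB'].
Qed.

Lemma cbd_lip w (E G : normedVectType R) (B : set E) (f : I -> E -> G)
    (f' : I -> E -> E -> G) :
  convex_set B -> (forall i, 0 <= w i) -> (forall i x, is_diff x (f i) (f' i x)) ->
  cbd w 1 B f -> exists2 C, 0 <= C & forall i x,  B x ->
    (forall h, `|f' i x h| <= C * w i * `|h|) /\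
    (forall y, B y -> `|f i y - f i x| <= C * w i * `|y - x|).
Proof.
move=> cB w0 df /cbd_inv[_ [g dg cg]]; have [K K0 hK] := cbd_bound (cg 1).
have [c c0 hc] := vec_mvt G.
have e i x h : f' i x h = g i (x, h).
  by have := isd_unique (df i x) (dg i x) => /(congr1 (fun f => f h)).
have key i x h : B x -> `|f' i x h| <= K * w i * `|h|.
  move=> Bx; apply: (is_diff_bound1 _ (df i x)) => v v1; rewrite e.
  by apply: hK; split.
exists (K + c * K); first by rewrite addr_ge0// mulr_ge0.
move=> i x Bx; split=> [h|y By].
  apply: le_trans (key i x h Bx) _; rewrite ler_wpM2r// ler_wpM2r//.
  by rewrite lerDl mulr_ge0.
apply: (@le_trans _ _ (c * (K * w i * `|y - x|))); last first.
  have : 0 <= K * w i * `|y - x| by rewrite !mulr_ge0.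
  by clear; lra.
rewrite -{1}(subrK x y) [y - x + x]addrC.
apply: (hc E (f i) (f' i) x (y - x) _ _ (df i)); first by rewrite !mulr_ge0.
by move=> th th01; apply: key; exact: cB.
Qed.

(** The last bound, on second differences, is the one that compares two Davie paths: it moves the
    base points of an increment r without leaving a term proportional to r alone. *)
Lemma cbd_lip2 w (E G : normedVectType R) (B : set E) (f : I -> E -> G)
    (f' : I -> E -> E -> G) :
  convex_set B -> (forall i, 0 <= w i) -> (forall i x, is_diff x (f i) (f' i x)) ->
  cbd w 2 B f -> exists2 C, 0 <= C & forall i x y, B x -> B y ->
    [/\ forall h, `|f' i y h - f' i x h| <= C * w i * `|y - x| * `|h|,
        `|f i y - f i x - f' i x (y - x)| <= C * w i * `|y - x| ^+ 2 &
        forall r, B (x + r) -> B (y + r) ->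
          `|(f i (y + r) - f i y) - (f i (x + r) - f i x)| <= C * w i * `|r| * `|y - x|].
Proof.
move=> cB w0 df cf; have [_ [g dg cg]] := cbd_inv cf; have [c c0 hc] := vec_mvt G.
have [_ [g' dg' _]] := cbd_inv (cg 1).
have [K K0 hK] := @cbd_lip w (E * E)%type G (B `*` cball 1) g (fun i x h => g' i (x, h))
  (setX_convex cB (cball_convex (M:=1))) w0 dg' (cg 1).
have e i x h : f' i x h = g i (x, h).
  by have := isd_unique (df i x) (dg i x) => /(congr1 (fun f => f h)).
have key i x y h : B x -> B y -> `|f' i y h - f' i x h| <= K * w i * `|y - x| * `|h|.
  move=> Bx By.
  have ld : linear (fun h => f' i y h - f' i x h).
    move=> a u v; rewrite (isd_linear (df i y)) (isd_linear (df i x)).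
    by rewrite scalerBr opprD addrACA.
  apply: (is_diff_bound1 h (isd_lin 0 ld)) => v v1; rewrite !e.
  have [_ h1] := hK i (x, v) (conj Bx v1).
  apply: le_trans (h1 (y, v) (conj By v1)) _; rewrite ler_wpM2l ?mulr_ge0//.
  by rewrite prod_normE/= subrr normr0 ge_max lexx/=.
exists (K + c * K); first by rewrite addr_ge0// mulr_ge0.
have KK : K <= K + c * K by rewrite lerDl mulr_ge0.
have cKK : c * K <= K + c * K by rewrite lerDr.
move=> i x y Bx By; split=> [h||r Bxr Byr].
- apply: le_trans (key i x y h Bx By) _.
  by rewrite ler_wpM2r// ler_wpM2r// ler_wpM2r.
- have dl u : is_diff u (fun z => f i z - f' i x z) (fun h => f' i u h - f' i x h).
    by apply: isd_sub (df i u) _; apply: isd_lin; exact: isd_linear (df i x).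
  have := hc _ _ _ x (y - x) (K * w i * `|y - x| * `|y - x|) _ dl.
  have -> : f i y - f i x - f' i x (y - x) =
      f i (x + (y - x)) - f' i x (x + (y - x)) - (f i x - f' i x x).
    by rewrite (isdD x (y - x) (df i x)) [x + (y - x)]addrC subrK; vring.
  move=> h; apply: le_trans (h _ _) _; first by rewrite !mulr_ge0.
    move=> th /andP[th0 th1]; have Bz : B (x + th *: (y - x)) by apply: cB; rewrite ?th0.
    apply: le_trans (key i _ _ (y - x) Bx Bz) _.
    rewrite ler_wpM2r// ler_wpM2l ?mulr_ge0// addrAC subrr add0r normrZ.
    by rewrite ger0_norm// ler_piMl.
  have -> : c * (K * w i * `|y - x| * `|y - x|) = c * K * w i * `|y - x| ^+ 2 by ring.
  by rewrite ler_wpM2r ?exprn_ge0// ler_wpM2r.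
- have dl u : is_diff u (fun z => f i (z + r) - f i z) (fun h => f' i (u + r) h - f' i u h).
    apply: isd_sub (df i u).
    have := isd_comp (isd_add (is_diff_id u) (isd_cst r u)) (df i (u + r)).
    by move=> h; apply: is_diff_eq h _; apply/funext => k /=; rewrite addr0.
  have := hc _ _ _ x (y - x) (K * w i * `|r| * `|y - x|) _ dl.
  rewrite [x + (y - x)]addrC subrK => h; apply: le_trans (h _ _) _.
  + by rewrite !mulr_ge0.
  + move=> th th01; have Bz : B (x + th *: (y - x)) by apply: cB.
    have Bzr : B (x + th *: (y - x) + r).
      rewrite (_ : _ + r = (x + r) + th *: ((y + r) - (x + r))); last by vring.
      exact: cB.
    apply: le_trans (key i _ _ (y - x) Bz Bzr) _.
    by rewrite [x + _ + r]addrC addrK.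
  have -> : c * (K * w i * `|r| * `|y - x|) = c * K * w i * `|r| * `|y - x| by ring.
  by rewrite ler_wpM2r// ler_wpM2r// ler_wpM2r.
Qed.

End LipschitzBounds.

Section Flow.
Variables (R : realType) (al : R).
Hypotheses (al3 : 3^-1 < al) (al2 : al <= 2^-1).
Local Notation lw := (lw al).
Implicit Types E : normedVectType R.

(** Triples of times serve as indices of families, so that bounds uniform in the times are
    expressed by cbd. *)
Record time_triple (T : R) := TimeTriple { tri_s : R; tri_u : R; tri_t : R;
  tri1 : - T <= tri_s; tri2 : tri_s <= tri_u; tri3 : tri_u <= tri_t; tri4 : tri_t <= T }.

Definition wst T (i : time_triple T) : R := lw (tri_s i) (tri_t i).
Definition wcob T (i : time_triple T) : R := lw (tri_s i) (tri_u i) * lw (tri_u i) (tri_t i) * lw (tri_s i) (tri_t i).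

Lemma wst_ge0 T (i : time_triple T) : 0 <= wst i. Proof. exact: lw_ge0. Qed.
Lemma wcob_ge0 T (i : time_triple T) : 0 <= wcob i.
Proof. by rewrite !mulr_ge0// lw_ge0. Qed.

(** The germ has one derivative more than its coboundary: in the rough equation the coboundary
    involves differences of the vector fields of the germ. *)
Definition regular_germ m E (A : R -> R -> E -> E) := forall T M,
  cbd (@wst T) m.+1 (cball M) (fun i => A (tri_s i) (tri_t i)) /\
  cbd (@wcob T) m (cball M) (fun i => coboundary A (tri_s i) (tri_u i) (tri_t i)).

Lemma regular_germ_le m n E (A : R -> R -> E -> E) : (n <= m)%N -> regular_germ m A -> regular_germ n A.
Proof. by move=> nm rA T M; have [h1 h2] := rA T M; split; exact: cbd_le h1 || exact: cbd_le h2. Qed.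

(** Uniqueness is part of the definition: it identifies the limit points in every compactness
    argument below. *)
Record davie_flow E (A : R -> R -> E -> E) (phi : E -> R -> E) : Prop := DavieFlow {
  flow0 : forall w, phi w 0 = w;
  flow_bound : forall T M, exists2 K, 0 <= K & forall w, `|w| <= M ->
    davie al A T K (phi w) /\ forall t, - T <= t -> t <= T -> `|phi w t| <= K;
  flow_unique : forall Y : R -> E, (forall T, exists K, davie al A T K Y) -> Y = phi (Y 0) }.

(** The germ of the pair formed by a path and its variation. *)
Definition tangent E (A : R -> R -> E -> E) s t (p : E * E) : E * E :=
  (A s t p.1, 'd (A s t) (fst p) (snd p)).

Section Regular1.
Variables (E : normedVectType R) (A : R -> R -> E -> E).
Hypothesis rA : regular_germ 1 A.
Local Notation DA := (fun s t x h => 'd (A s t) x h).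

Lemma time_triple_exists s t : s <= t -> exists T (i : time_triple T), [/\ tri_s i = s, tri_u i = s & tri_t i = t].
Proof.
move=> st; pose T := Num.max (- s) t.
have h1 : - T <= s by rewrite /T lerNl le_max lexx.
have h2 : t <= T by rewrite /T le_max lexx orbT.
by exists T, (TimeTriple h1 (lexx s) st h2).
Qed.

Lemma diff_germ s t x : s <= t -> is_diff x (A s t) ('d (A s t) x).
Proof.
move=> /time_triple_exists[T [i [<- _ <-]]]; have [/cbd_inv[_ [g dg _]] _] := rA T 0.
by apply: differentiableP; exact: (@ex_diff _ _ _ _ _ _ _ (dg i x)).
Qed.

Lemma diff_coboundary s u t x : s <= u -> u <= t ->
  is_diff x (coboundary A s u t) (fun h => DA s t x h - DA s u x h -
    DA u t (x + A s u x) (h + DA s u x h)).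
Proof.
move=> su ut; have st := le_trans su ut; rewrite /coboundary.
apply: isd_sub; first exact: isd_sub (diff_germ x st) (diff_germ x su).
exact: (isd_comp (isd_add (is_diff_id x) (diff_germ x su)) (diff_germ (x + A s u x) ut)).
Qed.

(** What the stability estimates use of the first two derivatives of a germ and of the first
    derivative of its coboundary. *)
Definition germ_estimates (C M s u t : R) (x : E) : Prop :=
  [/\ `|A s t x| <= C * lw s t, forall h, `|DA s t x h| <= C * lw s t * `|h|,
      forall h, `|DA s t x h - DA s u x h - DA u t (x + A s u x) (h + DA s u x h)|
        <= C * lw s t ^+ 3 * `|h| &
      forall y, `|y| <= M -> [/\ `|A s t y - A s t x| <= C * lw s t * `|y - x|,
      `|coboundary A s u t y - coboundary A s u t x| <= C * lw s t ^+ 3 * `|y - x|,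
      forall h, `|DA s t y h - DA s t x h| <= C * lw s t * `|y - x| * `|h|,
      `|A s t y - A s t x - DA s t x (y - x)| <= C * lw s t * `|y - x| ^+ 2 &
      forall r, `|x + r| <= M -> `|y + r| <= M ->
          `|(A s t (y + r) - A s t y) - (A s t (x + r) - A s t x)| <=
             C * lw s t * `|r| * `|y - x| ]].

Lemma germ_bounds T M : exists2 C, 0 <= C & forall s u t, - T <= s -> s <= u -> u <= t -> t <= T ->
  forall x, `|x| <= M ->
  germ_estimates C M s u t x.
Proof.
have [rA1 rA2] := rA T M.
have [C1 C10 h1] := cbd_bound rA1.
have [C2 C20 h2] := cbd_lip (cball_convex (M := M)) (@wst_ge0 T)
  (fun i x => diff_germ x (le_trans (tri2 i) (tri3 i))) (cbdS rA1).
have [C3 C30 h3] := cbd_lip (cball_convex (M := M)) (@wcob_ge0 T)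
  (fun i x => diff_coboundary x (tri2 i) (tri3 i)) rA2.
have [C4 C40 h4] := cbd_lip2 (cball_convex (M := M)) (@wst_ge0 T)
  (fun i x => diff_germ x (le_trans (tri2 i) (tri3 i))) rA1.
pose C := C1 + C2 + C3 + C4.
have [c1 c2 c3 c4] : [/\ C1 <= C, C2 <= C, C3 <= C & C4 <= C].
  by rewrite /C; clear -C10 C20 C30 C40 al3 al2; split; lra.
exists C; first exact: le_trans c1.
move=> s u t Ts su ut tT x xM; have st := le_trans su ut.
pose i := TimeTriple Ts su ut tT.
have w0 := wst_ge0 i; have v0 := wcob_ge0 i.
have wl : wcob i <= lw s t ^+ 3 by exact: cube_le.
have [h21 h22] := h2 i x xM; have [h31 h32] := h3 i x xM.
split.
- by apply: le_trans (h1 i x xM) _; rewrite ler_wpM2r.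
- by move=> h; apply: le_trans (h21 h) _; rewrite ler_wpM2r// ler_wpM2r.
- by move=> h; apply: le_trans (h31 h) _; rewrite ler_wpM2r// ler_pM.
move=> y yM; have [h41 h42 h43] := h4 i x y xM yM; split.
- by apply: le_trans (h22 y yM) _; rewrite ler_wpM2r// ler_wpM2r.
- by apply: le_trans (h32 y yM) _; rewrite ler_wpM2r// ler_pM.
- by move=> h; apply: le_trans (h41 h) _; rewrite ler_wpM2r// ler_wpM2r// ler_wpM2r.
- by apply: le_trans h42 _; rewrite ler_wpM2r ?exprn_ge0// ler_wpM2r.
- move=> r xr yr; apply: le_trans (h43 r xr yr) _.
  by rewrite ler_wpM2r// ler_wpM2r// ler_wpM2r.
Qed.

(** A bounded Davie path and its one-step predictions stay in a common ball, on which the bounds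
    of germ_bounds hold with one constant. *)
Lemma germ_bounds_path T K : 0 <= T -> 0 <= K -> exists M C W, [/\ K <= M, 0 <= C, 0 <= W &
  [/\ forall s t, - T <= s -> s <= t -> t <= T -> lw s t <= W,
   (forall Y, davie al A T K Y -> (forall t, - T <= t -> t <= T -> `|Y t| <= K) ->
     forall s u, - T <= s -> s <= u -> u <= T ->
       [/\ `|Y s| <= M, `|Y s + A s u (Y s)| <= M &
         forall r, `|r| <= K * lw s u ^+ 3 -> `|Y s + A s u (Y s) + r| <= M]) &
   forall s u t, - T <= s -> s <= u -> u <= t -> t <= T ->
  forall x, `|x| <= M ->
  germ_estimates C M s u t x]].
Proof.
move=> T0 K0; have [C0 C00 hC0] := germ_bounds T K.
pose W := (2 * T) `^ al; have W0 : 0 <= W by exact: powR_ge0.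
(* A bound for the path, plus one germ, plus one third-order error. *)
pose M := K + C0 * W + K * W ^+ 3.
have KW0 : 0 <= K * W ^+ 3 by rewrite mulr_ge0// exprn_ge0.
have CW0 : 0 <= C0 * W by rewrite mulr_ge0.
have lW s t : - T <= s -> s <= t -> t <= T -> lw s t <= W.
  by move=> Ts st tT; rewrite lw_bound//; clear -al3 al2 E Ts tT; lra.
have [C C0' hC] := germ_bounds T M.
exists M, C, W; split=> //; first by rewrite /M -addrA lerDl addr_ge0.
split=> // Y dY bY s u Ts su uT.
have Ys : `|Y s| <= K by apply: bY => //; exact: le_trans uT.
have [a1 _ _ _] := hC0 s s u Ts (lexx _) su uT (Y s) Ys.
have a2 : `|A s u (Y s)| <= C0 * W.
  by apply: le_trans a1 _; rewrite ler_wpM2l// lW.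
have a3 : `|Y s + A s u (Y s)| <= K + C0 * W.
  by apply: le_trans (ler_normD _ _) _; exact: lerD.
split.
- by apply: le_trans Ys _; rewrite /M -addrA lerDl addr_ge0.
- by apply: le_trans a3 _; rewrite /M lerDl.
move=> r hr; apply: le_trans (ler_normD _ _) _; rewrite /M lerD//.
apply: le_trans hr _; rewrite ler_wpM2l// lerXn2r ?nnegrE ?lw_ge0//; exact: lW.
Qed.

(** By defect_split, the difference of the remainders over [s, t] is additive up to the difference
    of the coboundaries and to a shift of base points. The latter is a second difference, of order
    |r| |a - a'|, plus a first difference, of order |r - r'|, where a is the prediction of Y u
    and r its error; this is the hypothesis of gronwall_sewing. *)
Lemma davie_stable T K : 0 <= T -> 0 <= K -> exists2 L, 0 <= L & forall Y Y',
  davie al A T K Y -> (forall t, - T <= t -> t <= T -> `|Y t| <= K) ->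
  davie al A T K Y' -> (forall t, - T <= t -> t <= T -> `|Y' t| <= K) ->
  (forall t, - T <= t -> t <= T -> `|Y t - Y' t| <= L * `|Y 0 - Y' 0|) /\
  (forall s t, - T <= s -> s <= t -> t <= T ->
    `|(Y t - Y s - A s t (Y s)) - (Y' t - Y' s - A s t (Y' s))| <=
      L * lw s t ^+ 3 * `|Y 0 - Y' 0|).
Proof.
move=> T0 K0; have [M [C [W [KM C0 W0 [lW inM hC]]]]] := germ_bounds_path T0 K0.
pose C' := (1 + C * W) + C + C * W * K * (1 + C * W).
have CW0 : 0 <= C * W by rewrite mulr_ge0.
have CWK : 0 <= C * W * K * (1 + C * W) by rewrite !mulr_ge0// addr_ge0.
have C'0 : 0 <= C' by rewrite /C' !addr_ge0.
have [L L0 hL] := gronwall_sewing al3 T0 C'0.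
exists L => // Y Y' dY bY dY' bY'.
have CC' : C <= C' by rewrite /C'; clear -al3 al2 E CW0 CWK; lra.
pose Rm Y s t := Y t - Y s - A s t (Y s).
apply: (hL (fun t => `|Y t - Y' t|) (fun s t => `|Rm Y s t - Rm Y' s t|)) => //.
- move=> s t Ts st tT; have lg := @lw_ge0 R al s t; have lWs := lW s t Ts st tT.
  have sT := le_trans st tT.
  have [Ys _ _] := inM Y dY bY s t Ts st tT; have [Y's _ _] := inM Y' dY' bY' s t Ts st tT.
  have [_ _ _ /(_ _ Ys)[lip _ _ _ _]] := hC s s t Ts (lexx _) st tT _ Y's.
  have lip' : `|A s t (Y s) - A s t (Y' s)| <= C' * lw s t * `|Y s - Y' s|.
    by apply: le_trans lip _; rewrite ler_wpM2r// ler_wpM2r.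
  split.
  + have -> : Y t - Y' t = (Y s - Y' s) + (A s t (Y s) - A s t (Y' s)) + (Rm Y s t - Rm Y' s t).
      by rewrite /Rm; vring.
    by apply: le_trans (ler_normD _ _) _; rewrite lerD2r (le_trans (ler_normD _ _))// lerD2l.
  + have -> : Y s - Y' s = (Y t - Y' t) - (A s t (Y s) - A s t (Y' s)) - (Rm Y s t - Rm Y' s t).
      by rewrite /Rm; vring.
    apply: le_trans (ler_normB _ _) _; rewrite lerD2r (le_trans (ler_normB _ _))// lerD2l.
    by rewrite (_ : _ - (_ - _) - (_ - _) = Y s - Y' s)// /Rm; vring.
  rewrite normr_ge0/=.
  rewrite (_ : _ - _ = (Y t - Y' t) - (Y s - Y' s) - (A s t (Y s) - A s t (Y' s))); last first.
    by rewrite /Rm; vring.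
  apply: le_trans (ler_normB _ _) _.
  apply: le_trans (lerD (ler_normB _ _) lip) _.
  have : C * lw s t * `|Y s - Y' s| <= C * W * `|Y s - Y' s|.
    by rewrite ler_wpM2r// ler_wpM2l.
  have : 0 <= C * W * `|Y t - Y' t| by rewrite mulr_ge0.
  have : 0 <= (C + C * W * K * (1 + C * W)) * (`|Y s - Y' s| + `|Y t - Y' t|).
    by rewrite mulr_ge0// addr_ge0.
  by rewrite /C'; clear -al3 al2 E; lra.
- move=> s u t Ts su ut tT; have uT := le_trans ut tT; have Tu := le_trans Ts su.
  have st := le_trans su ut.
  have [Ys yY yrY] := inM Y dY bY s u Ts su uT.
  have [Y's yY' yrY'] := inM Y' dY' bY' s u Ts su uT.
  have [Yu _ _] := inM Y dY bY u t Tu ut tT; have [Y'u _ _] := inM Y' dY' bY' u t Tu ut tT.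
  rewrite /Rm (defect_split A s u t (Y s) (Y u)) (defect_split A s u t (Y' s) (Y' u)).
  rewrite -!/(Rm _ _ _).
  set a := Y s + A s u (Y s) in yY yrY *; set a' := Y' s + A s u (Y' s) in yY' yrY' *.
  set r := Rm Y s u; set r' := Rm Y' s u.
  have Yue : Y u = a + r by rewrite /a /r /Rm; vring.
  have Yue' : Y' u = a' + r' by rewrite /a' /r' /Rm; vring.
  have hr : `|r| <= K * lw s u ^+ 3 by exact: dY.
  have a'r : `|a' + r| <= M by exact: yrY'.
  have lsu := @lw_ge0 R al s u; have lut := @lw_ge0 R al u t; have lst := @lw_ge0 R al s t.
  have [_ _ _ /(_ _ Ys)[_ co _ _ _]] := hC s u t Ts su ut tT _ Y's.
  have [_ _ _ /(_ _ Ys)[lsA _ _ _ _]] := hC s s u Ts (lexx _) su uT _ Y's.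
  have [_ _ _ /(_ _ yY)[_ _ _ _ p4]] := hC u u t Tu (lexx _) ut tT _ yY'.
  have ar : `|a + r| <= M by rewrite -Yue.
  have {}p4 := p4 r a'r ar.
  have a'r' : `|a' + r'| <= M by rewrite -Yue'.
  have [_ _ _ /(_ _ a'r)[lip _ _ _ _]] := hC u u t Tu (lexx _) ut tT _ a'r'.
  have aa' : `|a - a'| <= (1 + C * W) * `|Y s - Y' s|.
    rewrite (_ : a - a' = (Y s - Y' s) + (A s u (Y s) - A s u (Y' s))); last first.
      by rewrite /a /a'; vring.
    apply: le_trans (ler_normD _ _) _; rewrite mulrDl mul1r lerD2l.
    by apply: le_trans lsA _; rewrite ler_wpM2r// ler_wpM2l// lW.
  rewrite (_ : _ - _ = (r - r') + (Rm Y u t - Rm Y' u t)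
     - (coboundary A s u t (Y s) - coboundary A s u t (Y' s))
     + ((A u t (a + r) - A u t a) - (A u t (a' + r) - A u t a'))
     + (A u t (a' + r) - A u t (a' + r'))); last by rewrite Yue Yue'; vring.
  have lut' : lw u t <= lw s t by exact: lw_le.
  have lsu' : lw s u <= lw s t by exact: lw_le.
  have n1 : `|A u t (a + r) - A u t a - (A u t (a' + r) - A u t a')| <=
      C * W * K * (1 + C * W) * (`|Y s - Y' s| * lw s t ^+ 3).
    apply: le_trans p4 _.
    apply: (@le_trans _ _ (C * W * (K * lw s t ^+ 3) * ((1 + C * W) * `|Y s - Y' s|))).
      apply: ler_pM => //; first by rewrite !mulr_ge0.
      apply: ler_pM => //; [by rewrite mulr_ge0|by rewrite ler_wpM2l// lW|].
      apply: le_trans hr _; rewrite ler_wpM2l// lerXn2r// nnegrE.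
    by apply: le_of_eq; ring.
  have n2 : `|A u t (a' + r) - A u t (a' + r')| <= C * lw s t * `|r - r'|.
    apply: le_trans lip _.
    rewrite (_ : a' + r - (a' + r') = r - r'); last by vring.
    by rewrite ler_wpM2r// ler_wpM2l.
  apply: le_trans (ler_normD _ _) _.
  apply: le_trans (lerD (le_trans (ler_normD _ _) (lerD (le_trans (ler_normB _ _)
    (lerD (ler_normD _ _) co)) n1)) n2) _.
  have p1 : 0 <= (1 + C * W) * (`|Y s - Y' s| * lw s t ^+ 3).
    by rewrite !mulr_ge0 ?addr_ge0 ?exprn_ge0.
  have p2 : 0 <= (C' - C) * (lw s t * `|r - r'|).
    by rewrite mulr_ge0 ?subr_ge0// mulr_ge0.
  move: p1 p2; rewrite -/(Rm Y s u) -/(Rm Y' s u) -/r -/r' /C'.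
  by clear -al3 al2 E; lra.
- exists (2 * K); first by rewrite mulr_ge0.
  move=> s t Ts st tT; apply: le_trans (ler_normB _ _) _.
  by rewrite -mulrA mulr2n mulrDl mul1r lerD// ?dY ?dY'.
Qed.

Lemma lin_defect_split (zs zu zt dst dsu duk duk' dur r : E) :
  zu = zs + dsu + r ->
  zt - zs - dst = r + (zt - zu - (duk' + dur)) - (dst - dsu - duk) + (duk' - duk) + dur.
Proof. move=> ->; vring. Qed.

(** The linearisation of davie along Y. *)
Definition davie_lin T K (Y z : R -> E) := forall s t, - T <= s -> s <= t -> t <= T ->
  `|z t - z s - DA s t (Y s) (z s)| <= K * lw s t ^+ 3.

(** The argument of davie_stable, linearised. The constant K' of the hypothesis does not enter L,
    so that the remainder of a variation is controlled by its initial value. *)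
Lemma linear_stable T K : 0 <= T -> 0 <= K -> exists2 L, 0 <= L & forall Y z,
  davie al A T K Y -> (forall t, - T <= t -> t <= T -> `|Y t| <= K) ->
  (exists K', davie_lin T K' Y z) ->
  (forall t, - T <= t -> t <= T -> `|z t| <= L * `|z 0|) /\ davie_lin T (L * `|z 0|) Y z.
Proof.
move=> T0 K0; have [M [C [W [KM C0 W0 [lW inM hC]]]]] := germ_bounds_path T0 K0.
pose C' := (1 + C * W) + C + C * W * K * (1 + C * W).
have CW0 : 0 <= C * W by rewrite mulr_ge0.
have CWK : 0 <= C * W * K * (1 + C * W) by rewrite !mulr_ge0// addr_ge0.
have C'0 : 0 <= C' by rewrite /C' !addr_ge0.
have CC' : C <= C' by rewrite /C'; clear -al3 al2 E CW0 CWK; lra.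
have [L L0 hL] := gronwall_sewing al3 T0 C'0.
exists L => // Y z dY bY [K' hK'].
pose rz s t := z t - z s - DA s t (Y s) (z s).
suff [h1 h2] : (forall t, - T <= t -> t <= T -> `|z t| <= L * `|z 0|) /\
    (forall s t, - T <= s -> s <= t -> t <= T -> `|rz s t| <= L * lw s t ^+ 3 * `|z 0|).
  split=> // s t Ts st tT; apply: le_trans (h2 s t Ts st tT) _.
  by rewrite mulrAC.
apply: (hL (fun t => `|z t|) (fun s t => `|rz s t|)) => //.
- move=> s t Ts st tT; have lg := @lw_ge0 R al s t; have lWs := lW s t Ts st tT.
  have [Ys _ _] := inM Y dY bY s t Ts st tT.
  have [_ dst _ _] := hC s s t Ts (lexx _) st tT _ Ys.
  have dst' : `|DA s t (Y s) (z s)| <= C' * lw s t * `|z s|.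
    by apply: le_trans (dst _) _; rewrite ler_wpM2r// ler_wpM2r.
  split.
  + have -> : z t = z s + DA s t (Y s) (z s) + rz s t by rewrite /rz; vring.
    by apply: le_trans (ler_normD _ _) _; rewrite lerD2r (le_trans (ler_normD _ _))// lerD2l.
  + have {1}-> : z s = z t - DA s t (Y s) (z s) - rz s t by rewrite /rz; vring.
    by apply: le_trans (ler_normB _ _) _; rewrite lerD2r (le_trans (ler_normB _ _))// lerD2l.
  rewrite normr_ge0/=; apply: le_trans (ler_normB _ _) _.
  apply: le_trans (lerD (ler_normB _ _) (dst _)) _.
  have : C * lw s t * `|z s| <= C * W * `|z s| by rewrite ler_wpM2r// ler_wpM2l.
  have : 0 <= C * W * `|z t| by rewrite mulr_ge0.
  have : 0 <= (C + C * W * K * (1 + C * W)) * (`|z s| + `|z t|).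
    by rewrite mulr_ge0// addr_ge0.
  by rewrite /C'; clear -al3 al2 E; lra.
- move=> s u t Ts su ut tT; have uT := le_trans ut tT; have Tu := le_trans Ts su.
  have st := le_trans su ut.
  have [Ys yY yrY] := inM Y dY bY s u Ts su uT.
  have [Yu _ _] := inM Y dY bY u t Tu ut tT.
  set a := Y s + A s u (Y s) in yY yrY *.
  set r := Y u - Y s - A s u (Y s).
  have Yue : Y u = a + r by rewrite /a /r; vring.
  have hr : `|r| <= K * lw s u ^+ 3 by exact: dY.
  have lsu := @lw_ge0 R al s u; have lut := @lw_ge0 R al u t; have lst := @lw_ge0 R al s t.
  have lut' : lw u t <= lw s t by exact: lw_le.
  have lsu' : lw s u <= lw s t by exact: lw_le.
  have [_ _ dco _] := hC s u t Ts su ut tT _ Ys.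
  have [_ dsu _ _] := hC s s u Ts (lexx _) su uT _ Ys.
  have [_ _ _ /(_ _ Yu)[_ _ d2 _ _]] := hC u u t Tu (lexx _) ut tT _ yY.
  have [_ dut _ _] := hC u u t Tu (lexx _) ut tT _ Yu.
  pose k := z s + DA s u (Y s) (z s).
  have hk : `|k| <= (1 + C * W) * `|z s|.
    apply: le_trans (ler_normD _ _) _; rewrite mulrDl mul1r lerD2l.
    by apply: le_trans (dsu _) _; rewrite ler_wpM2r// ler_wpM2l// lW.
  have zu : z u = k + rz s u by rewrite /k /rz; vring.
  have e : rz s t = rz s u + rz u t
      - (DA s t (Y s) (z s) - DA s u (Y s) (z s) - DA u t a k)
      + (DA u t (Y u) k - DA u t a k) + DA u t (Y u) (rz s u).
    have eu : DA u t (Y u) (z u) = DA u t (Y u) k + DA u t (Y u) (rz s u).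
      by rewrite zu linearD.
    by rewrite [rz u t]/rz eu; exact: lin_defect_split zu.
  have n1 : `|DA u t (Y u) k - DA u t a k| <=
      C * W * K * (1 + C * W) * (`|z s| * lw s t ^+ 3).
    apply: le_trans (d2 k) _; rewrite Yue [a + r]addrC addrK.
    apply: (@le_trans _ _ (C * W * (K * lw s t ^+ 3) * ((1 + C * W) * `|z s|))).
      apply: ler_pM => //; first by rewrite !mulr_ge0.
      apply: ler_pM => //; [by rewrite mulr_ge0|by rewrite ler_wpM2l// lW|].
      by apply: le_trans hr _; rewrite ler_wpM2l// lerXn2r.
    by apply: le_of_eq; ring.
  have n2 : `|DA u t (Y u) (rz s u)| <= C * lw s t * `|rz s u|.
    by apply: le_trans (dut _) _; rewrite ler_wpM2r// ler_wpM2l.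
  rewrite e; apply: le_trans (ler_normD _ _) _.
  apply: le_trans (lerD (le_trans (ler_normD _ _) (lerD (le_trans (ler_normB _ _)
    (lerD (ler_normD _ _) (dco (z s)))) n1)) n2) _.
  have p1 : 0 <= (1 + C * W) * (`|z s| * lw s t ^+ 3).
    by rewrite !mulr_ge0 ?addr_ge0 ?exprn_ge0.
  have p2 : 0 <= (C' - C) * (lw s t * `|rz s u|).
    by rewrite mulr_ge0 ?subr_ge0// mulr_ge0.
  by move: p1 p2; rewrite /C'; clear -al3 al2 E; lra.
- exists `|K'| => // s t Ts st tT; apply: le_trans (hK' s t Ts st tT) _.
  by rewrite ler_wpM2r ?exprn_ge0 ?lw_ge0// ler_norm.
Qed.

End Regular1.
End Flow.

(** * Differentiability of the flow of a germ *)

Lemma is_diff_intro (R : realType) (E G : normedVectType R) (f l : E -> G) x : linear l ->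
  (forall e : R, 0 < e -> \forall v \near x, `|f v - f x - l (v - x)| <= e * `|v - x|) ->
  is_diff x f l.
Proof.
move=> ll hf; have cl : continuous (mklin ll) by exact: fdlin_continuous.
have o : f \o shift x = cst (f x) + (mklin ll) +o_ (0 : E) id.
  apply/eqaddoP => e e0; have := hf e e0.
  move=> /nbhs_ballP[r /= r0 hr]; apply/nbhs_ballP; exists r => //= y.
  rewrite -ball_normE/= sub0r normrN => yr.
  have := hr (y + x); rewrite -ball_normE/= opprD addrCA subrr addr0 normrN addrK => /(_ yr).
  by rewrite opprD addrA.
have dE : 'd f x = l :> (E -> G) by exact: (diff_unique cl o).
by apply: DiffDef => //; apply/diff_locallyP; rewrite dE; split.
Qed.

Section Continuity.
Variables (R : realType) (al : R).
Hypotheses (al3 : 3^-1 < al).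
Local Notation lw := (lw al).

Lemma davie_lim (E : normedVectType R) (A : R -> R -> E -> E) (I : Type) (G : set_system I)
   (y : I -> R -> E) Y T K : ProperFilter G ->
  (forall s t, s <= t -> continuous (A s t)) ->
  (forall t, (fun i => y i t) @ G --> Y t) -> (\forall i \near G, davie al A T K (y i)) ->
  davie al A T K Y.
Proof.
move=> PG germ_continuous yY dy s t Ts st tT.
apply: (@lim_norm_le R E I G (fun i => y i t - y i s - A s t (y i s))
  (fun=> K * lw s t ^+ 3)).
- apply: cvgB; first by apply: cvgB; exact: yY.
  exact: (cvg_comp (fun i => y i s) (A s t) (yY s) (germ_continuous s t st (Y s))).
- exact: cvg_cst.
- by apply: filterS dy => i; apply.
Qed.

Lemma near_ball_norm (E : normedVectType R) (w : E) (G : set_system E) : ProperFilter G ->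
  nbhs w `<=` G -> \forall v \near G, `|v| <= `|w| + 1.
Proof.
move=> PG sG; apply: sG; have : nbhs w (ball w 1) by exact: nbhsx_ballx.
apply: filterS => v; rewrite -ball_normE/= => h.
rewrite -(subrK w v) addrC (le_trans (ler_normD _ _))// lerD2l distrC; exact: ltW.
Qed.

(** A limit point of phi v as v tends to w is a Davie path issued from w. *)
Lemma flow_continuous (E : normedVectType R) (A : R -> R -> E -> E) phi t :
  (forall s t, s <= t -> continuous (A s t)) ->
  davie_flow al A phi -> continuous (fun w => phi w t).
Proof.
move=> germ_continuous gphi w; apply: cvg_of_ultra => G GU sG.
have nb : \forall v \near G, `|v| <= `|w| + 1 by exact: near_ball_norm.
have /choice[Y hY] : forall s, exists l : E, (fun v => phi v s) @ G --> l.
  move=> s; have [K K0 hK] := flow_bound gphi `|s| (`|w| + 1).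
  apply: (ultra_cvg (K := K)); apply: filterS nb => v /hK[_]; apply.
    by rewrite lerNl -normrN ler_norm.
  exact: ler_norm.
have dY T : exists K, davie al A T K Y.
  have [K K0 hK] := flow_bound gphi T (`|w| + 1); exists K.
  by apply: (davie_lim _ germ_continuous hY); apply: filterS nb => v /hK[].
have Y0 : Y 0 = w.
  have h0 := hY 0; have h1 : (fun v => phi v 0) @ G --> w.
    rewrite (_ : (fun v => phi v 0) = id); first exact: sG.
    by apply/funext => v; rewrite (flow0 gphi).
  exact: (cvg_unique _ h0 h1).
by have := flow_unique gphi dY; rewrite Y0 => <-; exact: hY.
Qed.

End Continuity.

Section Variation.
Variables (R : realType) (al : R).
Hypotheses (al3 : 3^-1 < al).
Local Notation lw := (lw al).
Variables (E : normedVectType R) (A : R -> R -> E -> E) (phi : E -> R -> E).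
Hypotheses (rA : regular_germ al 1 A) (gphi : davie_flow al A phi).
Local Notation DA := (fun s t x h => 'd (A s t) x h).

Lemma germ_continuous s t : s <= t -> continuous (A s t).
Proof. by move=> st x; exact: is_diff_continuous (diff_germ rA x st). Qed.

(** The stability estimates, with constants common to all paths issued from a ball; along a
    convergent family of initial values they bound the difference quotients. *)
Lemma flow_constants T B : exists K L, [/\ 0 <= K, 0 <= L,
  forall w, `|w| <= B -> davie al A T K (phi w) /\ forall t, - T <= t -> t <= T -> `|phi w t| <= K,
  forall w v, `|w| <= B -> `|v| <= B ->
    (forall t, - T <= t -> t <= T -> `|phi v t - phi w t| <= L * `|v - w|) /\
    (forall s t, - T <= s -> s <= t -> t <= T ->
      `|(phi v t - phi v s - A s t (phi v s)) - (phi w t - phi w s - A s t (phi w s))|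
         <= L * lw s t ^+ 3 * `|v - w|) &
  forall w z, `|w| <= B -> (exists K', davie_lin al A T K' (phi w) z) ->
    (forall t, - T <= t -> t <= T -> `|z t| <= L * `|z 0|) /\
    davie_lin al A T (L * `|z 0|) (phi w) z].
Proof.
have [T0|T0] := leP 0 T; last first.
  have nT t : - T <= t -> t <= T -> False.
    by move=> h1 h2; have := le_trans h1 h2; move: T0; lra.
  exists 0, 0; split=> //.
  - by move=> w _; split=> [s t h1 h2 h3|t h1 h2]; [have := nT s h1 (le_trans h2 h3)|have := nT t h1 h2].
  - by move=> w v _ _; split=> [t h1 h2|s t h1 h2 h3]; [have := nT t h1 h2|have := nT s h1 (le_trans h2 h3)].
  - by move=> w z _ _; split=> [t h1 h2|s t h1 h2 h3]; [have := nT t h1 h2|have := nT s h1 (le_trans h2 h3)].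
have [K K0 hK] := flow_bound gphi T B.
have [L1 L10 h1] := davie_stable al3 rA T0 K0.
have [L2 L20 h2] := linear_stable al3 rA T0 K0.
exists K, (L1 + L2); split=> //; first exact: addr_ge0.
- move=> w v /hK[dw bw] /hK[dv bv]; have [k1 k2] := h1 _ _ dv bv dw bw.
  rewrite !(flow0 gphi) in k1 k2; split.
    move=> t Tt tT; apply: le_trans (k1 t Tt tT) _.
    by rewrite ler_wpM2r// lerDl.
  move=> s t Ts st tT; apply: le_trans (k2 s t Ts st tT) _.
  by rewrite ler_wpM2r// ler_wpM2r ?exprn_ge0 ?lw_ge0// lerDl.
- move=> w z /hK[dw bw] hz; have [k1 k2] := h2 _ _ dw bw hz; split.
    move=> t Tt tT; apply: le_trans (k1 t Tt tT) _.
    by rewrite ler_wpM2r// lerDr.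
  move=> s t Ts st tT; apply: le_trans (k2 s t Ts st tT) _.
  by rewrite ler_wpM2r ?exprn_ge0 ?lw_ge0// ler_wpM2r// lerDr.
Qed.

Lemma absr_bounds (t : R) : - `|t| <= t <= `|t|.
Proof. by rewrite -ler_norml. Qed.

(** The remainder of a difference quotient is bounded by davie_stable, and the second-order error
    made in linearising the germ vanishes because |v - w| tends to 0 while the quotients stay
    bounded. *)
Lemma quotient_lim (I : Type) (G : set_system I) (v : I -> E) (c : I -> R) w N z :
  UltraFilter G -> 0 <= N ->
  (\forall i \near G, 0 <= c i /\ c i * `|v i - w| <= N) -> v @ G --> w ->
  (forall t, (fun i => c i *: (phi (v i) t - phi w t)) @ G --> z t) ->
  forall T, exists K, davie_lin al A T K (phi w) z.
Proof.
move=> GU N0 hc vw hz T; have [K [L [K0 L0 hK hL _]]] := flow_constants T (`|w| + 1).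
have [C C0 hC] := germ_bounds al3 rA T K.
exists (L * N) => s t Ts st tT.
have nv : \forall i \near G, `|v i| <= `|w| + 1.
  move/cvgrPdist_lt : vw => /(_ 1 ltr01); apply: filterS => i h.
  rewrite -(subrK w (v i)) addrC (le_trans (ler_normD _ _))// lerD2l distrC; exact: ltW.
have nw : `|w| <= `|w| + 1 by rewrite lerDl.
have sT := le_trans st tT; have Tt := le_trans Ts st.
have [_ bw] := hK w nw; have ws := bw s Ts sT.
have l0 := @lw_ge0 R al s t.
apply: (@lim_norm_le R E I G (fun i => c i *: ((phi (v i) t - phi w t) -
    (phi (v i) s - phi w s) - (A s t (phi (v i) s) - A s t (phi w s))))
  (fun=> L * N * lw s t ^+ 3)).
- rewrite (_ : (fun i => _) = (fun i => c i *: (phi (v i) t - phi w t) -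
    c i *: (phi (v i) s - phi w s) - c i *: (A s t (phi (v i) s) - A s t (phi w s)))); last first.
    by apply/funext => i; rewrite !scalerBr.
  apply: cvgB; first by apply: cvgB; exact: hz.
  apply: (@cvg_squeeze R E I G _ (fun i => C * lw s t * (L * N * L) * `|v i - w| +
     C * lw s t * `|c i *: (phi (v i) s - phi w s) - z s|)).
    rewrite -[X in _ --> X](_ : C * lw s t * (L * N * L) * 0 + C * lw s t * 0 = 0); last by ring.
    apply: cvgD; (apply: cvgM; first exact: cvg_cst); first exact: cvg_dist0.
    exact: cvg_dist0 (hz s).
  near=> i.
  have vi : `|v i| <= `|w| + 1 by near: i.
  have [ci0 ciN] : 0 <= c i /\ c i * `|v i - w| <= N by near: i.
  have [_ bv] := hK _ vi; have vs := bv s Ts sT.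
  have [_ dst _ /(_ _ vs)[_ _ _ q _]] := hC s s t Ts (lexx _) st tT _ ws.
  have [l1 _] := hL w (v i) nw vi; have {}l1 := l1 s Ts sT.
  rewrite (_ : _ - _ = c i *: (A s t (phi (v i) s) - A s t (phi w s) - DA s t (phi w s) (phi (v i) s - phi w s))
     + DA s t (phi w s) (c i *: (phi (v i) s - phi w s) - z s)); last first.
    have -> : DA s t (phi w s) (c i *: (phi (v i) s - phi w s) - z s) =
        c i *: DA s t (phi w s) (phi (v i) s - phi w s) - DA s t (phi w s) (z s).
      by rewrite linearB linearZ.
    set d1 := 'd _ _ _; set d2 := 'd _ _ _; vring.
  apply: le_trans (ler_normD _ _) _; apply: lerD; last exact: dst.
  rewrite normrZ ger0_norm//; apply: le_trans (ler_wpM2l ci0 q) _.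
  apply: (@le_trans _ _ (c i * (C * lw s t * (L * `|v i - w|) ^+ 2))).
    rewrite ler_wpM2l// ler_wpM2l ?mulr_ge0// lerXn2r// ?nnegrE ?mulr_ge0//.
  rewrite (_ : c i * _ = (C * lw s t * L * L * `|v i - w|) * (c i * `|v i - w|)); last by ring.
  rewrite (_ : C * lw s t * (L * N * L) * _ = (C * lw s t * L * L * `|v i - w|) * N); last by ring.
  by rewrite ler_wpM2l// !mulr_ge0.
- exact: cvg_cst.
- near=> i.
  have vi : `|v i| <= `|w| + 1 by near: i.
  have [ci0 ciN] : 0 <= c i /\ c i * `|v i - w| <= N by near: i.
  have [_ l2] := hL w (v i) nw vi; have {}l2 := l2 s t Ts st tT.
  rewrite normrZ ger0_norm//.
  rewrite (_ : _ - _ = (phi (v i) t - phi (v i) s - A s t (phi (v i) s)) -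
     (phi w t - phi w s - A s t (phi w s))); last by vring.
  apply: le_trans (ler_wpM2l ci0 l2) _.
  rewrite (_ : c i * _ = L * lw s t ^+ 3 * (c i * `|v i - w|)); last by ring.
  rewrite (_ : L * N * _ = L * lw s t ^+ 3 * N); last by ring.
  by rewrite ler_wpM2l// mulr_ge0// exprn_ge0.
Unshelve. all: by end_near. Qed.

Lemma quotient_cvg (I : Type) (G : set_system I) (v : I -> E) (c : I -> R) w N :
  UltraFilter G -> 0 <= N ->
  (\forall i \near G, 0 <= c i /\ c i * `|v i - w| <= N) -> v @ G --> w ->
  exists z : R -> E, (forall t, (fun i => c i *: (phi (v i) t - phi w t)) @ G --> z t) /\
    forall T, exists K, davie_lin al A T K (phi w) z.
Proof.
move=> GU N0 hc vw.
have /choice[z hz] : forall t, exists l : E, (fun i => c i *: (phi (v i) t - phi w t)) @ G --> l.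
  move=> t; have [K [L [K0 L0 hK hL _]]] := flow_constants `|t| (`|w| + 1).
  have nv : \forall i \near G, `|v i| <= `|w| + 1.
    move/cvgrPdist_lt : vw => /(_ 1 ltr01); apply: filterS => i h.
    rewrite -(subrK w (v i)) addrC (le_trans (ler_normD _ _))// lerD2l distrC; exact: ltW.
  apply: (ultra_cvg (K := L * N)); near=> i.
  have vi : `|v i| <= `|w| + 1 by near: i.
  have [ci0 ciN] : 0 <= c i /\ c i * `|v i - w| <= N by near: i.
  have nw : `|w| <= `|w| + 1 by rewrite lerDl.
  have /andP[t1 t2] := absr_bounds t.
  have [l1 _] := hL w (v i) nw vi; have {}l1 := l1 t t1 t2.
  rewrite normrZ ger0_norm//; apply: le_trans (ler_wpM2l ci0 l1) _.
  by rewrite mulrCA ler_wpM2l.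
by exists z; split=> //; exact: (quotient_lim GU N0 hc vw hz).
Unshelve. all: by end_near. Qed.

Lemma variation_unique w z z' : (forall T, exists K, davie_lin al A T K (phi w) z) ->
  (forall T, exists K, davie_lin al A T K (phi w) z') -> z 0 = z' 0 -> z = z'.
Proof.
move=> hz hz' e0; apply/funext => t.
have [K [L [K0 L0 _ _ hL]]] := flow_constants `|t| `|w|.
have [|h _] := hL w (fun t => z t - z' t) (lexx _).
  have [K1 h1] := hz `|t|; have [K2 h2] := hz' `|t|; exists (K1 + K2) => s u Ts su uT.
  have k1 := h1 s u Ts su uT; have k2 := h2 s u Ts su uT.
  have eD : DA s u (phi w s) (z s - z' s) = DA s u (phi w s) (z s) - DA s u (phi w s) (z' s).
    by rewrite linearB.
  have -> : z u - z' u - (z s - z' s) - DA s u (phi w s) (z s - z' s) =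
     (z u - z s - DA s u (phi w s) (z s)) - (z' u - z' s - DA s u (phi w s) (z' s)).
    by rewrite eD; set d1 := 'd _ _ _; set d2 := 'd _ _ _; vring.
  by apply: le_trans (ler_normB _ _) _; rewrite mulrDl lerD.
have /andP[t1 t2] := absr_bounds t.
have := h t t1 t2; rewrite e0 subrr normr0 mulr0 normr_le0 subr_eq0.
by move/eqP.
Qed.

(** A limit point of the difference quotients of phi along w + xi / n. *)
Lemma variation_exists w xi : exists z, z 0 = xi /\ forall T, exists K, davie_lin al A T K (phi w) z.
Proof.
have [G [GU sG]] := ultraFilterLemma (@eventually_filter).
pose c (n : nat) : R := n.+1%:R.
have c0 n : 0 < c n by [].
have cw : (fun n => w + (c n)^-1 *: xi) @ G --> w.
  have h : (fun n => w + (c n)^-1 *: xi) @ \oo --> w + 0 *: xi.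
    apply: cvgD; first exact: cvg_cst.
    by apply: cvgZ; [exact: cvg_harmonic|exact: cvg_cst].
  by rewrite scale0r addr0 in h => U /h /sG.
have [|z [hz dz]] := @quotient_cvg nat G (fun n => w + (c n)^-1 *: xi) c w `|xi| GU (normr_ge0 _) _ cw.
  apply: nearW => n; split; first exact: ltW.
  by rewrite addrAC subrr add0r normrZ gtr0_norm ?invr_gt0// mulrA mulfV ?mul1r// gt_eqF.
exists z; split=> //.
have h0 := hz 0.
have h1 : (fun n => c n *: (phi (w + (c n)^-1 *: xi) 0 - phi w 0)) @ G --> xi.
  rewrite (_ : (fun n => _) = (fun=> xi)); first exact: cvg_cst.
  apply/funext => n; rewrite !(flow0 gphi) addrAC subrr add0r scalerA mulfV ?scale1r//.
  by rewrite gt_eqF.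
exact: (cvg_unique _ h0 h1).
Qed.

Definition Dphi w xi : R -> E := sval (cid (variation_exists w xi)).

Lemma Dphi0 w xi : Dphi w xi 0 = xi.
Proof. by rewrite /Dphi; case: cid => z []. Qed.

Lemma DphiP w xi T : exists K, davie_lin al A T K (phi w) (Dphi w xi).
Proof. by rewrite /Dphi; case: cid => z []. Qed.

Lemma Dphi_linear w t : linear (fun xi => Dphi w xi t).
Proof.
move=> a x y; suff -> : Dphi w (a *: x + y) = (fun t => a *: Dphi w x t + Dphi w y t) by [].
apply: (@variation_unique w); first exact: DphiP.
  move=> T; have [K1 h1] := DphiP w x T; have [K2 h2] := DphiP w y T.
  exists (`|a| * K1 + K2) => s u Ts su uT.
  have k1 := h1 s u Ts su uT; have k2 := h2 s u Ts su uT.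
  pose zx := Dphi w x; pose zy := Dphi w y; rewrite -/zx -/zy in k1 k2 *.
  have eD : DA s u (phi w s) (a *: zx s + zy s) =
      a *: DA s u (phi w s) (zx s) + DA s u (phi w s) (zy s).
    by rewrite linearD linearZ.
  have -> : a *: zx u + zy u - (a *: zx s + zy s) - DA s u (phi w s) (a *: zx s + zy s) =
     a *: (zx u - zx s - DA s u (phi w s) (zx s)) + (zy u - zy s - DA s u (phi w s) (zy s)).
    by rewrite eD; set d1 := 'd _ _ _; set d2 := 'd _ _ _; vring.
  apply: le_trans (ler_normD _ _) _; rewrite mulrDl lerD//.
  by rewrite normrZ -mulrA ler_wpM2l.
by rewrite !Dphi0.
Qed.

(** Along an ultrafilter converging to w, the normalised directions (v - w) / |v - w| converge to
    some e and the quotients of phi to a variation issued from e, hence to Dphi w e. Thus the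
    normalised error of linearisation tends to 0 along every ultrafilter. *)
Lemma flow_isd w t : is_diff w (fun v => phi v t) (fun xi => Dphi w xi t).
Proof.
apply: is_diff_intro; first exact: Dphi_linear.
pose c v := `|v - w|^-1.
have c1 v : c v * `|v - w| <= 1.
  rewrite /c; have [->|h] := eqVneq `|v - w| 0; first by rewrite mulr0.
  by rewrite mulVf.
have c0 v : 0 <= c v by rewrite /c invr_ge0.
pose q v := c v *: (phi v t - phi w t - Dphi w (v - w) t).
have q0 : q @ nbhs w --> (0 : E).
  apply: cvg_of_ultra => G GU sG.
  have idw : (id : E -> E) @ G --> w by exact: sG.
  have [|z [hz dz]] := @quotient_cvg E G id c w 1 GU ler01 _ idw.
    by apply: nearW => v; split.
  have [|e he] := @ultra_cvg R E E G (fun v => c v *: (v - w)) 1 GU.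
    by apply: nearW => v; rewrite normrZ ger0_norm.
  have z0 : z 0 = e.
    have h0 := hz 0.
    have h1 : (fun v => c v *: (phi v 0 - phi w 0)) @ G --> e.
      rewrite (_ : (fun v => _) = (fun v => c v *: (v - w)))//.
      by apply/funext => v; rewrite !(flow0 gphi).
    exact: (cvg_unique _ h0 h1).
  have zD : z = Dphi w e.
    by apply: (@variation_unique w) => //; [exact: DphiP|rewrite Dphi0].
  have hD : (fun v => c v *: Dphi w (v - w) t) @ G --> Dphi w e t.
    rewrite (_ : (fun v => _) = (fun v => Dphi w (c v *: (v - w)) t)); last first.
      by apply/funext => v; rewrite (linZ _ _ (Dphi_linear w t)).
    apply: (cvg_comp (fun v => c v *: (v - w)) (fun x => Dphi w x t) he).
    exact: is_diff_continuous (isd_lin e (Dphi_linear w t)).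
  rewrite -[X in _ --> X](subrr (Dphi w e t)) (_ : q = fun v =>
     c v *: (phi v t - phi w t) - c v *: Dphi w (v - w) t); last first.
    by apply/funext => v; rewrite /q scalerBr.
  by apply: cvgB => //; rewrite -zD; exact: hz.
move=> e e0; move/cvgrPdist_le : q0 => /(_ e e0); apply: filterS => v.
rewrite sub0r normrN /q normrZ ger0_norm//.
have [vw|vw] := eqVneq v w.
  by rewrite vw !subrr (lin0 (Dphi_linear w t)) subrr !normr0 !mulr0.
by rewrite /c mulrC ler_pdivrMr// normr_gt0 subr_eq0.
Qed.

(** Uniqueness holds component by component: first for the path, then, along that path, for the
    variation. *)
Lemma tangent_flow : davie_flow al (tangent A) (fun p t => (phi p.1 t, Dphi p.1 p.2 t)).
Proof.
split.
- by move=> [w xi]; rewrite /= Dphi0 (flow0 gphi).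
- move=> T B; have [K [L [K0 L0 hK hL hl]]] := flow_constants T B.
  exists (K + L * `|B|); first by rewrite addr_ge0// mulr_ge0.
  move=> [w xi]; rewrite prod_normE/= ge_max => /andP[wB xB].
  have [dw bw] := hK w wB; have [bl dl] := hl w _ wB (DphiP w xi T).
  rewrite Dphi0 in bl dl.
  have xL : L * `|xi| <= K + L * `|B|.
    apply: (@le_trans _ _ (L * `|B|)); last by rewrite lerDr.
    by rewrite ler_wpM2l// (le_trans xB)// ler_norm.
  have KL : K <= K + L * `|B| by rewrite lerDl mulr_ge0.
  split=> [s t Ts st tT|t Tt tT].
    rewrite prod_normE/= ge_max; apply/andP; split.
      by apply: le_trans (dw s t Ts st tT) _; rewrite ler_wpM2r// exprn_ge0// lw_ge0.
    by apply: le_trans (dl s t Ts st tT) _; rewrite ler_wpM2r// exprn_ge0// lw_ge0.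
  rewrite prod_normE/= ge_max; apply/andP; split.
    exact: le_trans (bw t Tt tT) _.
  exact: le_trans (bl t Tt tT) _.
- move=> Y hY.
  have d1 T : exists K, davie al A T K (fun t => (Y t).1).
    have [K hK] := hY T; exists K => s t Ts st tT; apply: le_trans (hK s t Ts st tT).
    by rewrite [leRHS]prod_normE/= le_max lexx.
  have e1 := flow_unique gphi d1.
  have d2 T : exists K, davie_lin al A T K (phi (Y 0).1) (fun t => (Y t).2).
    have [K hK] := hY T; exists K => s t Ts st tT; apply: le_trans (hK s t Ts st tT).
    by rewrite -e1 [leRHS]prod_normE/= le_max lexx orbT.
  have e2 := variation_unique d2 (DphiP (Y 0).1 (Y 0).2) (esym (Dphi0 _ _)).
  apply/funext => t; rewrite [LHS]surjective_pairing; congr pair.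
    by have := congr1 (fun f => f t) e1.
  by have := congr1 (fun f => f t) e2.
Qed.

End Variation.

(** * Higher derivatives of the flow *)

Section Smoothness.
Variables (R : realType) (al : R).
Hypotheses (al3 : 3^-1 < al).

Lemma cball_pair (E G : normedVectType R) M : @cball R (E * G)%type M `<=` cball M `*` cball M.
Proof. by move=> [x y]; rewrite /cball/= prod_normE/= ge_max => /andP[]. Qed.

(** The derivative of the coboundary of A is the second component of the coboundary of the tangent
    germ, so that the bounds on one derivative less are those of the definition of cbd. *)
Lemma regular_tangent m (E : normedVectType R) (A : R -> R -> E -> E) :
  regular_germ al m.+1 A -> regular_germ al m (tangent A).
Proof.
move=> rA T M; have [c1 c2] := rA T M.
have rA1 : regular_germ al 1 A by exact: regular_germ_le rA.
have [_ [g1 dg1 cg1]] := cbd_inv c1; have [_ [g2 dg2 cg2]] := cbd_inv c2.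
split; apply: (cbd_sub (@cball_pair E E M)).
  rewrite (_ : (fun i => _) = (fun i p => (A (tri_s i) (tri_t i) p.1, g1 i p))); last first.
    apply/funext => i; apply/funext => -[x h]; rewrite /tangent/=; congr pair.
    have st := le_trans (tri2 i) (tri3 i).
    by have := isd_unique (diff_germ rA1 x st) (dg1 i x) => /(congr1 (fun f => f h)).
  by apply: cbd_pair => //; exact: (@cbd_fst R _ _ m.+1 E E E (cball M) (cball M) (fun i => A (tri_s i) (tri_t i)) (cbdS c1)).
rewrite (_ : (fun i => _) = (fun i p => (coboundary A (tri_s i) (tri_u i) (tri_t i) p.1, g2 i p))); last first.
  apply/funext => i; apply/funext => -[x h]; rewrite /coboundary/tangent/=.
  have := isd_unique (diff_coboundary rA1 x (tri2 i) (tri3 i)) (dg2 i x) => /(congr1 (fun f => f h)) /= <-.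
  by [].
by apply: cbd_pair => //; exact: (@cbd_fst R _ _ m E E E (cball M) (cball M) (fun i => coboundary A (tri_s i) (tri_u i) (tri_t i)) (cbdS c2)).
Qed.

(** Induction on k: the derivative of phi is the second component of the flow of the tangent germ. *)
Theorem flow_smooth k (E : normedVectType R) (A : R -> R -> E -> E) phi :
  davie_flow al A phi -> regular_germ al k A ->
  forall t M, cbd (fun _ : unit => 1) k (cball M) (fun _ w => phi w t).
Proof.
elim: k E A phi => [|k IH] E A phi gA rA t M.
  split.
    have [K K0 hK] := flow_bound gA `|t| M; exists K => // _ w wM; rewrite mulr1.
    by have [_ h] := hK w wM; have /andP[t1 t2] := absr_bounds t; exact: h.
  move=> _; apply: (flow_continuous _ gA) => s u su.
  have [T [i [<- _ <-]]] := time_triple_exists su; have [c _] := rA T 0.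
  exact: (cbd_cont c).
have rA1 : regular_germ al 1 A by exact: regular_germ_le rA.
split.
  have [K K0 hK] := flow_bound gA `|t| M; exists K => // _ w wM; rewrite mulr1.
  by have [_ h] := hK w wM; have /andP[t1 t2] := absr_bounds t; exact: h.
exists (fun _ p => Dphi al3 rA1 gA p.1 p.2 t).
  by move=> _ w; exact: flow_isd.
move=> M'; have rT := regular_tangent rA; have gT := tangent_flow al3 rA1 gA.
have := IH _ _ _ gT rT t (Num.max M M').
move=> /(cbd_lin (@linear_snd R E E)); apply: cbd_sub.
move=> [x y] [/= xM yM']; rewrite /cball/= prod_normE/= ge_max !le_max.
by apply/andP; split; apply/orP; [left|right].
Qed.

End Smoothness.

(** * Existence of the flow *)

Section FlowExistence.
Variables (R : realType) (al : R).
Hypotheses (al3 : 3^-1 < al) (al2 : al <= 2^-1).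
Local Notation lw := (lw al).
Variables (E : normedVectType R) (A : R -> R -> E -> E).
Hypotheses (rA : regular_germ al 1 A) (gA : forall T, exists2 C, 0 <= C & glob_germ al A T C).

Lemma davie_sub T T' K Y : T' <= T -> davie al A T K Y -> davie al A T' K Y.
Proof.
move=> TT dY s t Ts st tT; apply: dY => //; last exact: le_trans TT.
by apply: le_trans Ts; rewrite lerN2.
Qed.

(** The a priori bound comes from the global bounds on the germ; the local bounds of a regular germ
    would not exclude explosion. *)
Lemma davie_bounded T K Y : 0 <= T -> davie al A T K Y ->
  exists2 K', 0 <= K' & davie al A T K' Y /\ forall t, - T <= t -> t <= T -> `|Y t| <= K'.
Proof.
move=> T0 dY; have [C C0 hC] := gA T; pose W := (2 * T) `^ al.
have W0 : 0 <= W by exact: powR_ge0.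
have lW s t : - T <= s -> s <= t -> t <= T -> lw s t <= W.
  by move=> Ts st tT; rewrite lw_bound//; lra.
have W3 : 0 <= `|K| * W ^+ 3 by rewrite mulr_ge0// exprn_ge0.
have CW : 0 <= C * W by rewrite mulr_ge0.
have step s t : - T <= s -> s <= t -> t <= T -> `|Y t - Y s| <= C * W + `|K| * W ^+ 3.
  move=> Ts st tT; rewrite -(subrK (A s t (Y s)) (Y t - Y s)) addrC.
  have [b1 _ _] := hC s s t Ts (lexx _) st tT; have l0 := @lw_ge0 R al s t.
  apply: le_trans (ler_normD _ _) _; apply: lerD.
    by apply: le_trans (b1 _) _; rewrite ler_wpM2l// lW.
  apply: le_trans (dY s t Ts st tT) _; apply: (@le_trans _ _ (`|K| * lw s t ^+ 3)).
    by rewrite ler_wpM2r ?exprn_ge0// ler_norm.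
  by rewrite ler_wpM2l// lerXn2r ?nnegrE// lW.
have nT : - T <= 0 by rewrite oppr_le0.
exists (`|K| + `|Y 0| + (C * W + `|K| * W ^+ 3)); first by rewrite !addr_ge0.
split=> [s t Ts st tT|t Tt tT].
  apply: le_trans (dY s t Ts st tT) _; rewrite ler_wpM2r ?exprn_ge0 ?lw_ge0//.
  by apply: le_trans (ler_norm K) _; rewrite -addrA lerDl !addr_ge0.
apply: (@le_trans _ _ (`|Y 0| + (C * W + `|K| * W ^+ 3))).
  rewrite -(subrK (Y 0) (Y t)) addrC; apply: le_trans (ler_normD _ _) _.
  rewrite lerD2l; have [t0|/ltW t0] := leP 0 t; first exact: step.
  by rewrite distrC; exact: step.
by rewrite lerD2r lerDr.
Qed.

Lemma davie_unique T K K' Y Y' : 0 <= T -> davie al A T K Y -> davie al A T K' Y' ->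
  Y 0 = Y' 0 -> forall t, - T <= t -> t <= T -> Y t = Y' t.
Proof.
move=> T0 dY dY' e0 t Tt tT.
have [K1 K10 [d1 b1]] := davie_bounded T0 dY; have [K2 K20 [d2 b2]] := davie_bounded T0 dY'.
pose M := K1 + K2; have M0 : 0 <= M by exact: addr_ge0.
have [L L0 hL] := davie_stable al3 rA T0 M0.
have le1 : K1 <= M by rewrite lerDl.
have le2 : K2 <= M by rewrite lerDr.
have [| | | |h _] := hL Y Y'.
- move=> s u Ts su uT; apply: le_trans (d1 s u Ts su uT) _.
  by rewrite ler_wpM2r ?exprn_ge0 ?lw_ge0.
- by move=> u Tu uT; apply: le_trans (b1 u Tu uT) _.
- move=> s u Ts su uT; apply: le_trans (d2 s u Ts su uT) _.
  by rewrite ler_wpM2r ?exprn_ge0 ?lw_ge0.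
- by move=> u Tu uT; apply: le_trans (b2 u Tu uT) _.
have := h t Tt tT; rewrite e0 subrr normr0 mulr0 normr_le0 subr_eq0.
by move/eqP.
Qed.

(** The solutions on the intervals [-n, n] agree by uniqueness, and are glued. *)
Theorem flow_exists : exists phi, davie_flow al A phi.
Proof.
have /choice[K hK] : forall n : nat, exists K, 0 <= K /\ forall w, exists Y : R -> E,
    [/\ Y 0 = w, davie al A n.+1%:R K Y &
      forall t, - n.+1%:R <= t -> t <= n.+1%:R -> `|Y t - w| <= K].
  move=> n; have [C C0 hC] := gA n.+1%:R.
  have [K K0 h] := @davie_exists R al al3 al2 E n.+1%:R C (ltr0Sn _ n) C0.
  by exists K; split=> // w; exact: (h A hC w).
have /choice[Y hY] : forall p : nat * E, exists Y : R -> E,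
    [/\ Y 0 = p.2, davie al A p.1.+1%:R (K p.1) Y &
      forall t, - p.1.+1%:R <= t -> t <= p.1.+1%:R -> `|Y t - p.2| <= K p.1].
  by move=> [n w]; have [_ h] := hK n; exact: h.
pose N (t : R) := Num.trunc `|t|.
pose phi w t := Y (N t, w) t.
have Nt t : `|t| <= (N t).+1%:R by exact/ltW/truncnS_gt.
have agree n w t : - n.+1%:R <= t -> t <= n.+1%:R -> phi w t = Y (n, w) t.
  move=> h1 h2; rewrite /phi; pose m := minn (N t) n.
  have [e1 d1 _] := hY (N t, w); have [e2 d2 _] := hY (n, w).
  rewrite /= in e1 d1 e2 d2.
  have m1 : m.+1%:R <= (N t).+1%:R :> R by rewrite ler_nat ltnS geq_minl.
  have m2 : m.+1%:R <= n.+1%:R :> R by rewrite ler_nat ltnS geq_minr.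
  have tm : `|t| <= m.+1%:R.
    rewrite /m; have [_|_] := leqP (N t) n; first exact: Nt.
    by rewrite ler_norml h1.
  rewrite ler_norml in tm; have /andP[t1 t2] := tm.
  exact: (davie_unique (ler0n _ _) (davie_sub m1 d1) (davie_sub m2 d2) (etrans e1 (esym e2)) t1 t2).
have inT T t : - T <= t -> t <= T -> - (N T).+1%:R <= t /\ t <= (N T).+1%:R.
  move=> h1 h2; have h3 := le_trans (ler_norm T) (Nt T); split.
    by apply: le_trans h1; rewrite lerN2.
  exact: le_trans h3.
have dphi T w : davie al A T (K (N T)) (phi w).
  move=> s t Ts st tT; have sT := le_trans st tT; have Tt := le_trans Ts st.
  have [s1 s2] := inT T s Ts sT; have [t1 t2] := inT T t Tt tT.
  rewrite !(agree (N T))//; have [_ d _] := hY (N T, w); exact: d.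
exists phi; split.
- by move=> w; have [e _ _] := hY (N 0, w); exact: e.
- move=> T M; exists (K (N T) + `|M|); first by rewrite addr_ge0//; case: (hK (N T)).
  move=> w wM; split.
    move=> s t Ts st tT; apply: le_trans (dphi T w s t Ts st tT) _.
    by rewrite ler_wpM2r ?exprn_ge0 ?lw_ge0// lerDl.
  move=> t Tt tT; have [t1 t2] := inT T t Tt tT; rewrite (agree (N T))//.
  have [_ _ b] := hY (N T, w); have := b t t1 t2 => /= h.
  rewrite -(subrK w (Y _ t)); apply: le_trans (ler_normD _ _) _; apply: lerD => //.
  exact: le_trans wM (ler_norm _).
- move=> y dy; apply/funext => t; have [K1 d1] := dy `|t|.
  have d2 := dphi `|t| (y 0).
  have e : y 0 = phi (y 0) 0 by have [e _ _] := hY (N 0, y 0); rewrite /phi e.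
  have /andP[t1 t2] := absr_bounds t.
  exact: (davie_unique (normr_ge0 t) d1 d2 e t1 t2).
Qed.

End FlowExistence.

(** * Two-parameter functions of a given order *)

Section Orders.
Variables (R : realType) (al : R).
Hypotheses (al3 : 3^-1 < al) (al2 : al <= 2^-1).
Local Notation lw := (lw al).
Implicit Types E G H : normedVectType R.

(** Big-O of the n-th power of the unit lw, on compact intervals. Only s <= t is considered, the
    range of the times in Chen's relation. *)
Definition of_order (n : nat) G (A : R -> R -> G) := forall T, exists2 C, 0 <= C &
  forall s t, - T <= s -> s <= t -> t <= T -> `|A s t| <= C * lw s t ^+ n.

Lemma ord_ext n G (A B : R -> R -> G) : (forall s t, s <= t -> A s t = B s t) -> of_order n A -> of_order n B.
Proof.
move=> e hA T; have [C C0 hC] := hA T; exists C => // s t Ts st tT.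
by rewrite -e// hC.
Qed.

Lemma ordD n G (A B : R -> R -> G) : of_order n A -> of_order n B -> of_order n (fun s t => A s t + B s t).
Proof.
move=> hA hB T; have [C C0 hC] := hA T; have [D D0 hD] := hB T.
exists (C + D); first exact: addr_ge0.
move=> s t Ts st tT; apply: le_trans (ler_normD _ _) _.
by rewrite mulrDl lerD ?hC ?hD.
Qed.

Lemma ordN n G (A : R -> R -> G) : of_order n A -> of_order n (fun s t => - A s t).
Proof.
move=> hA T; have [C C0 hC] := hA T; exists C => // s t Ts st tT.
by rewrite normrN hC.
Qed.

Lemma ordB n G (A B : R -> R -> G) : of_order n A -> of_order n B -> of_order n (fun s t => A s t - B s t).
Proof. by move=> hA hB; apply: ordD => //; exact: ordN. Qed.

Lemma lw_bounded T : exists2 K, 0 <= K & forall s t, - T <= s -> s <= t -> t <= T -> lw s t <= K.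
Proof.
exists ((2 * T) `^ al); first exact: powR_ge0.
by move=> s t Ts st tT; rewrite lw_bound//; lra.
Qed.

Lemma ord_le m n G (A : R -> R -> G) : (m <= n)%N -> of_order n A -> of_order m A.
Proof.
move=> mn hA T; have [C C0 hC] := hA T; have [K K0 hK] := lw_bounded T.
exists (C * K ^+ (n - m)); first by rewrite mulr_ge0// exprn_ge0.
move=> s t Ts st tT; apply: le_trans (hC s t Ts st tT) _.
have -> : lw s t ^+ n = lw s t ^+ (n - m) * lw s t ^+ m by rewrite -exprD subnK.
rewrite -mulrA ler_wpM2l// ler_wpM2r ?exprn_ge0 ?lw_ge0//.
by rewrite lerXn2r ?nnegrE ?lw_ge0// hK.
Qed.

Lemma ord_app n m E G (f : R -> R -> 'Hom(E, G)) (x : R -> R -> E) : of_order n f -> of_order m x ->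
  of_order (n + m) (fun s t => f s t (x s t)).
Proof.
move=> hA hB T; have [C C0 hC] := hA T; have [D D0 hD] := hB T.
exists (C * D); first exact: mulr_ge0.
move=> s t Ts st tT; apply: le_trans (lfun_norm_le _ _) _.
rewrite exprD (_ : C * D * _ = (C * lw s t ^+ n) * (D * lw s t ^+ m)); last by ring.
by apply: ler_pM => //; [exact: hC|exact: hD].
Qed.

Lemma norm_comp_lfun E G H (f : 'Hom(G, H)) (g : 'Hom(E, G)) : `|(f \o g)%VF| <= `|f| * `|g|.
Proof.
apply: norm_lfun_le; first exact: mulr_ge0.
move=> x; rewrite comp_lfunE; apply: le_trans (lfun_norm_le _ _) _.
by rewrite -mulrA ler_wpM2l// lfun_norm_le.
Qed.

Lemma ord_comp n m E G H (f : R -> R -> 'Hom(G, H)) (g : R -> R -> 'Hom(E, G)) :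
  of_order n f -> of_order m g -> of_order (n + m) (fun s t => (f s t \o g s t)%VF).
Proof.
move=> hA hB T; have [C C0 hC] := hA T; have [D D0 hD] := hB T.
exists (C * D); first exact: mulr_ge0.
move=> s t Ts st tT; apply: le_trans (norm_comp_lfun _ _) _.
rewrite exprD (_ : C * D * _ = (C * lw s t ^+ n) * (D * lw s t ^+ m)); last by ring.
by apply: ler_pM => //; [exact: hC|exact: hD].
Qed.

Lemma ord_time n G (x : R -> R -> G) : of_order n x -> of_order n.+2 (fun s t => (t - s) *: x s t).
Proof.
move=> hA T; have [C C0 hC] := hA T.
have [T0|T0] := leP 0 T; last first.
  by exists 0 => // s t Ts st tT; exfalso; lra.
have T20 : 0 <= 2 * T by lra.
have [D D0 hD] := time_le_lw al2 T20.
exists (D * C); first exact: mulr_ge0.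
move=> s t Ts st tT; rewrite normrZ ger0_norm ?subr_ge0//.
rewrite (_ : D * C * _ = (D * lw s t ^+ 2) * (C * lw s t ^+ n)); last by rewrite -[n.+2]addn2 exprD; ring.
apply: ler_pM => //; [by rewrite subr_ge0| |exact: hC].
by apply: hD => //; lra.
Qed.

Lemma ord_path0 G (P : R -> G) : of_order 1 (incr P) -> of_order 0 (fun s t => P s) /\ of_order 0 (fun s t => P t).
Proof.
move=> hP; have bd T : exists2 C, 0 <= C & forall t, - T <= t -> t <= T -> `|P t| <= C.
  have [C C0 hC] := hP T; have [K K0 hK] := lw_bounded T.
  exists (`|P (- T)| + C * K); first by rewrite addr_ge0// mulr_ge0.
  move=> t Tt tT; rewrite -(subrK (P (- T)) (P t)) addrC.
  apply: le_trans (ler_normD _ _) _; rewrite lerD2l.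
  apply: le_trans (hC (- T) t (lexx _) Tt tT) _; rewrite expr1 ler_wpM2l//.
  exact: hK.
split=> T; have [C C0 hC] := bd T; exists C => // s t Ts st tT; rewrite mulr1.
  by apply: hC => //; exact: le_trans tT.
by apply: hC => //; exact: le_trans st.
Qed.

(** On the diagonal, where the quotient in holder2 gives no information, A vanishes. *)
Lemma holder_ord n p G (A : R -> R -> G) : (0 < n)%N -> (forall x, 0 <= x -> x `^ p = (x `^ al) ^+ n) ->
  (forall s, A s s = 0) -> holder2 p A -> of_order n A.
Proof.
move=> n0 pE A0 hA T; have [C hC] := hA (- T) T; exists `|C| => // s t Ts st tT.
have [est|nst] := eqVneq s t.
  by rewrite -est A0 normr0 mulr_ge0// exprn_ge0// lw_ge0.
have st' : s < t by rewrite lt_neqAle nst.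
have h0 : 0 < (t - s) `^ p by rewrite powR_gt0// subr_gt0.
have := hC s t Ts st' tT; rewrite ler_pdivrMr// /lw -pE ?subr_ge0// => h.
by apply: le_trans h _; rewrite ler_wpM2r ?powR_ge0// ler_norm.
Qed.

Lemma ord_holder n p G (A : R -> R -> G) : (forall x, 0 <= x -> x `^ p = (x `^ al) ^+ n) ->
  of_order n A -> holder2 p A.
Proof.
move=> pE hA a b; have [C C0 hC] := hA (`|a| + `|b|); exists C => s t as_ st tb.
have h0 : 0 < (t - s) `^ p by rewrite powR_gt0// subr_gt0.
rewrite ler_pdivrMr// pE ?subr_ge0 ?(ltW st)//; apply: hC; last 2 first.
- exact: ltW.
- by apply: (le_trans tb); apply: le_trans (ler_norm b) _; rewrite lerDr.
apply: le_trans as_; rewrite lerNl; apply: le_trans (ler_norm (- a)) _.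
by rewrite normrN lerDl.
Qed.

Lemma pow_al1 x : 0 <= x -> x `^ al = (x `^ al) ^+ 1. Proof. by rewrite expr1. Qed.

Lemma pow_al2 x : 0 <= x -> x `^ (2 * al) = (x `^ al) ^+ 2.
Proof. by move=> x0; rewrite -powR_mulrn ?powR_ge0// -powRrM mulrC. Qed.

End Orders.

Section TensorBounds.
Variables (R : realType).
Implicit Types V E : normedVectType R.

Lemma tens_extD_r V E (B : V -> V -> E) (S T : tensor V) : (forall x, linear (B x)) ->
  tens_ext B (S + T) = tens_ext B S + tens_ext B T.
Proof.
move=> l2; rewrite /tens_ext -big_split; apply: eq_bigr => i _.
by rewrite add_lfunE (linD _ _ (l2 _)).
Qed.

Lemma tens_extB_l V E (B C : V -> V -> E) (T : tensor V) :
  tens_ext B T - tens_ext C T = tens_ext (fun x y => B x y - C x y) T.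
Proof. by rewrite /tens_ext -sumrB. Qed.

Lemma tens_ext_bilin V E (B : V -> V -> E) x y : (forall y, linear (B ^~ y)) ->
  (forall x, linear (B x)) -> tens_ext B (tens x y) = B x y.
Proof.
move=> l1 l2; have lB : linear (fun x => linfun (B x)).
  move=> a u v; apply/lfunP => z; rewrite add_lfunE scale_lfunE.
  by rewrite !(linfun_lin z (l2 _)) (l1 z a u v).
have e u v : linfun (fun x => linfun (B x)) u v = B u v.
  by rewrite (linfun_lin u lB) (linfun_lin v (l2 u)).
rewrite -e -tens_ext_tens; apply: eq_bigr => i _; by rewrite e.
Qed.

Lemma tens_ext_bound V : exists2 k, 0 <= k & forall E (B : V -> V -> E) (b : R) (T : tensor V),
  0 <= b -> (forall x y, `|B x y| <= b * `|x| * `|y|) -> `|tens_ext B T| <= k * b * `|T|.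
Proof.
pose e i := (vbasis {:V})`_i; pose c i : 'Hom(V, R^o) := linfun (coord (vbasis {:V}) i : V -> R^o).
exists (\sum_(i < \dim {:V}) `|e i| * `|c i|).
  by apply: sumr_ge0 => i _; exact: mulr_ge0.
move=> E B b T b0 hB; rewrite /tens_ext (le_trans (ler_norm_sum _ _ _))//.
rewrite -mulrA mulr_suml; apply: ler_sum => i _; apply: le_trans (hB _ _) _.
rewrite (_ : `|e i| * `|c i| * (b * `|T|) = b * `|e i| * (`|T| * `|c i|)); last by ring.
by rewrite ler_wpM2l ?mulr_ge0// lfun_norm_le.
Qed.

End TensorBounds.

(** * The second level of the controlled driver *)

Section Driver.
Variables (R : realType) (al : R).
Hypotheses (al3 : 3^-1 < al) (al2 : al <= 2^-1).
Local Notation lw := (lw al).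
Variables (U V : normedVectType R).
Variables (X : R -> V) (XX : R -> R -> tensor V) (Z : R -> U) (Z' : R -> 'Hom(V, U)).
Hypotheses (hX : is_rough_path al X XX) (hZ : is_controlled al X Z Z').

Lemma incr_refl (E : normedVectType R) (P : R -> E) s : incr P s s = 0.
Proof. by rewrite /incr subrr. Qed.

Lemma tens0l (y : V) : tens 0 y = 0.
Proof.
apply/lfunP => l; rewrite /tens linfun_lin.
  by rewrite linear0 scale0r lfunE.
by move=> a l1 l2; rewrite add_lfunE scale_lfunE scalerDl scalerA.
Qed.

Lemma XX_refl s : XX s s = 0.
Proof.
have [_ _ chen] := hX; have := chen s s s (lexx _) (lexx _).
rewrite incr_refl tens0l addr0 => /eqP; rewrite -subr_eq0 opprD addrA subrr sub0r oppr_eq0.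
by move/eqP.
Qed.

Lemma ord_X : of_order al 1 (incr X).
Proof.
have [h _ _] := hX; apply: (holder_ord (p := al)) h => //; exact: incr_refl.
Qed.

Lemma ord_XX : of_order al 2 XX.
Proof.
have [_ h _] := hX; apply: (holder_ord (p := 2 * al)) h => //; last exact: XX_refl.
exact: pow_al2.
Qed.

Lemma ord_Z' : of_order al 1 (incr Z').
Proof.
have [h _] := hZ; apply: (holder_ord (p := al)) h => //; exact: incr_refl.
Qed.

Lemma ord_RZ : of_order al 2 (fun s t => incr Z s t - Z' s (incr X s t)).
Proof.
have [_ h] := hZ; apply: (holder_ord (p := 2 * al)) h => //; first exact: pow_al2.
by move=> s; rewrite !incr_refl linear0 subrr.
Qed.

Lemma ord_Z'0 : of_order al 0 (fun s t => Z' s).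
Proof. exact: (ord_path0 al3 ord_Z').1. Qed.

Lemma ord_Z : of_order al 1 (incr Z).
Proof.
apply: (@ord_ext _ _ _ _ (fun s t => (incr Z s t - Z' s (incr X s t)) + Z' s (incr X s t))).
  by move=> s t _; rewrite subrK.
apply: ordD; first exact: (ord_le al3 _ ord_RZ).
exact: (ord_app ord_Z'0 ord_X).
Qed.

Lemma lfunBE (E G : normedVectType R) (f g : 'Hom(E, G)) x : (f - g) x = f x - g x.
Proof. by rewrite add_lfunE opp_lfunE. Qed.

Lemma bilBl (E G H : normedVectType R) (q : 'Hom(E, 'Hom(G, H))) x y z :
  q (x - y) z = q x z - q y z.
Proof. by rewrite linearB lfunBE. Qed.

Lemma bilBr (E G H : normedVectType R) (q : 'Hom(E, 'Hom(G, H))) x y z :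
  q x (y - z) = q x y - q x z.
Proof. by rewrite linearB. Qed.

Lemma bilDr (E G H : normedVectType R) (q : 'Hom(E, 'Hom(G, H))) x y z :
  q x (y + z) = q x y + q x z.
Proof. by rewrite linearD. Qed.

Section Target.
Variable W : normedVectType R.
Local Notation HQ := 'Hom(U, 'Hom(U, W)).

(** The second level of Z, contracted with a bilinear coefficient: XX transported by Z' at the left
    end point. Being linear in the coefficient, it commutes with the derivatives of Q(y) in y. *)
Definition area s t : 'Hom(HQ, W) :=
  linfun (fun q : HQ => tens_ext (fun x y => q (Z' s x) (Z' s y)) (XX s t)).

Lemma areaE s t (q : HQ) : area s t q = tens_ext (fun x y => q (Z' s x) (Z' s y)) (XX s t).
Proof.
rewrite /area linfun_lin// => a f g; rewrite /tens_ext scaler_sumr -big_split.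
by apply: eq_bigr => i _; rewrite add_lfunE scale_lfunE add_lfunE scale_lfunE.
Qed.

Lemma ord_area : of_order al 2 area.
Proof.
have [k k0 hk] := tens_ext_bound V.
move=> T; have [C C0 hC] := ord_XX T; have [N N0 hN] := ord_Z'0 T.
exists (k * N ^+ 2 * C); first by rewrite !mulr_ge0// exprn_ge0.
move=> s t Ts st tT; have l0 := @lw_ge0 R al s t.
have Ns := hN s t Ts st tT; rewrite expr0 mulr1 in Ns.
have XXs := hC s t Ts st tT.
apply: norm_lfun_le; first by rewrite !mulr_ge0 ?exprn_ge0.
move=> q; rewrite areaE.
apply: (@le_trans _ _ (k * (`|q| * N ^+ 2) * `|XX s t|)).
  apply: hk; first by rewrite mulr_ge0// exprn_ge0.
  move=> x y; apply: le_trans (lfun_norm_le _ _) _.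
  apply: (@le_trans _ _ (`|q| * (N * `|x|) * (N * `|y|))).
    apply: ler_pM => //.
      apply: le_trans (lfun_norm_le _ _) _; rewrite ler_wpM2l//.
      by apply: le_trans (lfun_norm_le _ _) _; rewrite ler_wpM2r.
    by apply: le_trans (lfun_norm_le _ _) _; rewrite ler_wpM2r.
  by apply: le_of_eq; ring.
apply: (@le_trans _ _ (k * (`|q| * N ^+ 2) * (C * lw s t ^+ 2))).
  by rewrite ler_wpM2l// !mulr_ge0// exprn_ge0.
by apply: le_of_eq; ring.
Qed.

Definition quad (a b : U) : 'Hom(HQ, W) := linfun (fun q : HQ => q a b).

Lemma quadE a b (q : HQ) : quad a b q = q a b.
Proof.
by rewrite /quad linfun_lin// => c f g; rewrite add_lfunE scale_lfunE add_lfunE scale_lfunE.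
Qed.

Definition area_defect s u t := area s t - area s u - area u t - quad (incr Z s u) (incr Z u t).

(** Chen's relation for the transported second level. It fails by three terms: Z' is frozen at
    s instead of u over [u, t], and the two increments of Z differ from those of Z' X by the
    remainders of the controlled path Z. *)
Lemma area_defectE s u t (q : HQ) : s <= u -> u <= t ->
  area_defect s u t q =
  tens_ext (fun x y => q ((Z' s - Z' u) x) (Z' s y) + q (Z' u x) ((Z' s - Z' u) y)) (XX u t)
  - q (incr Z s u - Z' s (incr X s u)) (Z' s (incr X u t))
  - q (incr Z s u) ((incr Z u t - Z' u (incr X u t)) + (Z' u - Z' s) (incr X u t)).
Proof.
move=> su ut; have [_ _ chen] := hX.
have lB v w : forall x, linear (fun y => q (Z' v x) (Z' w y)).
  by move=> x a y z; rewrite !linearP.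
have lB' v w : forall y, linear (fun x => q (Z' v x) (Z' w y)).
  by move=> y a x z; rewrite !linearP add_lfunE scale_lfunE.
have -> : area_defect s u t q =
    area s t q - area s u q - area u t q - quad (incr Z s u) (incr Z u t) q.
  by rewrite /area_defect !lfunBE.
rewrite quadE !areaE (chen s u t su ut).
rewrite !(tens_extD_r _ _ (lB s s)) (tens_ext_bilin _ _ (lB' s s) (lB s s)).
move: (incr X s u) (incr X u t) (incr Z s u) (incr Z u t) => xu xt zu zt.
have -> : tens_ext (fun x y => q ((Z' s - Z' u) x) (Z' s y) + q (Z' u x) ((Z' s - Z' u) y)) (XX u t)
  = tens_ext (fun x y => q (Z' s x) (Z' s y)) (XX u t) -
    tens_ext (fun x y => q (Z' u x) (Z' u y)) (XX u t).
  rewrite tens_extB_l; congr tens_ext; apply/funext => x; apply/funext => y.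
  by rewrite !lfunBE bilBl bilBr addrA subrK.
rewrite (lfunBE (Z' u)) bilDr 2!bilBr bilBl; vring.
Qed.

(** Each term of area_defectE has at least one factor over [s, u] and one over [u, t]. *)
Lemma area_defect_bound T : exists2 C, 0 <= C & forall s u t,
  - T <= s -> s <= u -> u <= t -> t <= T ->
  `|area_defect s u t| <= C * (lw s u * lw u t * lw s t).
Proof.
have [k k0 hk] := tens_ext_bound V.
have [N N0 hN] := ord_Z'0 T; have [C1 C10 h1] := ord_X T; have [C2 C20 h2] := ord_XX T.
have [C3 C30 h3] := ord_Z' T; have [C4 C40 h4] := ord_RZ T; have [C5 C50 h5] := ord_Z T.
pose C := k * (2 * N * C3) * C2 + C4 * (N * C1) + C5 * (C4 + C3 * C1).
have NC : 0 <= N * C1 by rewrite mulr_ge0.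
have C0 : 0 <= C.
  by rewrite /C; apply: addr_ge0; [apply: addr_ge0|]; rewrite ?mulr_ge0// addr_ge0// mulr_ge0.
exists C => // s u t Ts su ut tT.
have uT := le_trans ut tT; have Tu := le_trans Ts su; have st := le_trans su ut.
have l1 := @lw_ge0 R al s u; have l2 := @lw_ge0 R al u t; have l := @lw_ge0 R al s t.
have l1l : lw s u <= lw s t by exact: lw_le.
have l2l : lw u t <= lw s t by exact: lw_le.
set a := lw s u in l1 l1l *; set b := lw u t in l2 l2l *; set c := lw s t in l l1l l2l *.
have abc0 : 0 <= a * b * c by rewrite !mulr_ge0.
apply: norm_lfun_le; first by rewrite mulr_ge0.
move=> q; rewrite area_defectE//.
have Ns := hN s t Ts st tT; rewrite expr0 mulr1 in Ns.
have Nu := hN u t Tu ut tT; rewrite expr0 mulr1 in Nu.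
have Xt := h1 u t Tu ut tT; rewrite expr1 -/b in Xt.
have XXt := h2 u t Tu ut tT; rewrite -/b in XXt.
have Zsu := h3 s u Ts su uT; rewrite expr1 -/a /incr in Zsu.
have Rsu := h4 s u Ts su uT; rewrite -/a in Rsu.
have Rut := h4 u t Tu ut tT; rewrite -/b in Rut.
have zsu := h5 s u Ts su uT; rewrite expr1 -/a in zsu.
have Zsu' : `|Z' s - Z' u| <= C3 * a by rewrite distrC.
have app (f : 'Hom(V, U)) (K : R) x : `|f| <= K -> `|f x| <= K * `|x|.
  by move=> h; apply: le_trans (lfun_norm_le _ _) _; rewrite ler_wpM2r.
have qapp x y K L : `|x| <= K -> `|y| <= L -> `|q x y| <= `|q| * K * L.
  move=> hx hy; apply: le_trans (lfun_norm_le _ _) _; apply: ler_pM => //.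
  by apply: le_trans (lfun_norm_le _ _) _; rewrite ler_wpM2l.
have aab : a * a * b <= a * b * c.
  rewrite (_ : a * a * b = a * b * a); last by ring.
  by rewrite ler_wpM2l ?mulr_ge0.
have abb : a * b * b <= a * b * c by rewrite ler_wpM2l ?mulr_ge0.
have n1 : `|tens_ext (fun x y => q ((Z' s - Z' u) x) (Z' s y) + q (Z' u x) ((Z' s - Z' u) y)) (XX u t)|
    <= k * (2 * N * C3) * C2 * (a * b * c) * `|q|.
  apply: (@le_trans _ _ (k * (`|q| * (2 * N * C3 * a)) * `|XX u t|)).
    apply: hk; first by rewrite !mulr_ge0.
    move=> x y; apply: le_trans (ler_normD _ _) _.
    apply: le_trans (lerD (qapp _ _ _ _ (app _ _ x Zsu') (app _ _ y Ns))
       (qapp _ _ _ _ (app _ _ x Nu) (app _ _ y Zsu'))) _.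
    by apply: le_of_eq; ring.
  apply: (@le_trans _ _ (k * (`|q| * (2 * N * C3 * a)) * (C2 * b ^+ 2))).
    by rewrite ler_wpM2l// !mulr_ge0.
  rewrite [leLHS](_ : _ = k * (2 * N * C3) * C2 * `|q| * (a * b * b)); last by ring.
  rewrite [leRHS](_ : _ = k * (2 * N * C3) * C2 * `|q| * (a * b * c)); last by ring.
  by rewrite ler_wpM2l// !mulr_ge0.
have n2 : `|q (incr Z s u - Z' s (incr X s u)) (Z' s (incr X u t))| <=
    C4 * (N * C1) * (a * b * c) * `|q|.
  apply: le_trans (qapp _ _ _ _ Rsu (le_trans (app _ _ _ Ns) (ler_wpM2l N0 Xt))) _.
  rewrite [leLHS](_ : _ = C4 * (N * C1) * `|q| * (a * a * b)); last by ring.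
  rewrite [leRHS](_ : _ = C4 * (N * C1) * `|q| * (a * b * c)); last by ring.
  by rewrite ler_wpM2l// !mulr_ge0.
have n3 : `|q (incr Z s u) ((incr Z u t - Z' u (incr X u t)) + (Z' u - Z' s) (incr X u t))| <=
    C5 * (C4 + C3 * C1) * (a * b * c) * `|q|.
  have h : `|(incr Z u t - Z' u (incr X u t)) + (Z' u - Z' s) (incr X u t)| <= (C4 + C3 * C1) * (b * c).
    apply: le_trans (ler_normD _ _) _; rewrite mulrDl; apply: lerD.
      apply: (le_trans Rut); rewrite ler_wpM2l// expr2 ler_wpM2l//.
    apply: le_trans (app _ _ _ Zsu) _; apply: (@le_trans _ _ (C3 * a * (C1 * b))).
      by rewrite ler_wpM2l// mulr_ge0.
    rewrite [leLHS](_ : _ = C3 * C1 * (b * a)); last by ring.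
    by rewrite ler_wpM2l ?mulr_ge0// ler_wpM2l.
  apply: le_trans (qapp _ _ _ _ zsu h) _.
  by apply: le_of_eq; ring.
apply: le_trans (ler_normB _ _) _; apply: le_trans (lerD (le_trans (ler_normB _ _) (lerD n1 n2)) n3) _.
by rewrite /C; apply: le_of_eq; ring.
Qed.

End Target.
End Driver.

(** * The germ of the rough equation *)

Section Germ.
Variables (R : realType) (al : R).
Hypotheses (al3 : 3^-1 < al) (al2 : al <= 2^-1).
Local Notation lw := (lw al).
Variables (U V W : normedVectType R).
Variables (X : R -> V) (XX : R -> R -> tensor V) (Z : R -> U) (Z' : R -> 'Hom(V, U)).
Hypotheses (hX : is_rough_path al X XX) (hZ : is_controlled al X Z Z').
Variables (k : nat) (F : W -> 'Hom(U, W)) (F0 : W -> W).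
Hypotheses (hF : Cbk (k + 3) F) (hF0 : Cbk (k + 1) F0).
Local Notation area := (area XX Z' W).

(** The derivative of F along the vector fields F themselves. *)
Definition second_field (y : W) : 'Hom(U, 'Hom(U, W)) := (frechet F y \o F y)%VF.

Definition germ s t (y : W) : W :=
  F y (incr Z s t) + area s t (second_field y) + (t - s) *: F0 y.

Lemma comp_linear1 (E G H : normedVectType R) (g : 'Hom(E, G)) :
  linear (fun f : 'Hom(G, H) => (f \o g)%VF).
Proof. by move=> a f f'; rewrite comp_lfunDl comp_lfunZl. Qed.

Lemma comp_linear2 (E G H : normedVectType R) (f : 'Hom(G, H)) :
  linear (fun g : 'Hom(E, G) => (f \o g)%VF).
Proof. by move=> a g g'; rewrite comp_lfunDr comp_lfunZr. Qed.

Lemma cbd_F I : cbd (fun _ : I => 1) k.+3 [set: W] (fun=> F).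
Proof. by rewrite -addn3; exact: Cbk_cbd. Qed.

Lemma cbd_DF I : cbd (fun _ : I => 1) k.+2 [set: W] (fun=> frechet F).
Proof. by apply: Cbk_cbd; have := hF; rewrite addn3 => -[_ []]. Qed.

Lemma cbd_F0 I : cbd (fun _ : I => 1) k.+1 [set: W] (fun=> F0).
Proof. by rewrite -addn1; exact: Cbk_cbd. Qed.

Lemma cbd_Q I : cbd (fun _ : I => 1) k.+2 [set: W] (fun=> second_field).
Proof.
have := cbd_bilin (@comp_linear1 U W 'Hom(U, W)) (@comp_linear2 U W 'Hom(U, W)) (@cbd_DF I) (cbdS (@cbd_F I)).
by apply: (cbd_weight (c := 1)) => // i; rewrite !mulr1.
Qed.

Lemma diff_F y : is_diff y F (fun h => frechet F y h).
Proof. by apply: isd_frechet; have := hF; rewrite addn3 => -[_ []]. Qed.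

Implicit Types E G H : normedVectType R.

Section Indexed.
Variables (T : R) (J : Type) (s t : J -> R).
Hypothesis hst : forall i, [/\ - T <= s i, s i <= t i & t i <= T].

Lemma cbd_ord n m E G (B : set E) (x : R -> R -> G) : of_order al n x ->
  cbd (fun i => lw (s i) (t i) ^+ n) m B (fun i (_ : E) => x (s i) (t i)).
Proof.
move=> /(_ T)[C C0 hC]; apply: (@cbd_cst R J _ m E G B (fun i => x (s i) (t i)) C) => // i.
by have [h1 h2 h3] := hst i; exact: hC.
Qed.

Lemma cbd_apply n m E G H v (B : set E) (x : R -> R -> 'Hom(G, H)) (f : J -> E -> G) :
  of_order al n x -> cbd v m B f ->
  cbd (fun i => lw (s i) (t i) ^+ n * v i) m B (fun i y => x (s i) (t i) (f i y)).
Proof.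
move=> ox cf; have := cbd_ord m B ox.
move=> /(cbd_bilin (@eval_linear1 R G H) (@eval_linear2 R G H)); exact.
Qed.

Lemma cbd_eval n m E G H v (B : set E) (x : R -> R -> G) (f : J -> E -> 'Hom(G, H)) :
  of_order al n x -> cbd v m B f ->
  cbd (fun i => v i * lw (s i) (t i) ^+ n) m B (fun i y => f i y (x (s i) (t i))).
Proof.
move=> ox cf; have := cbd_ord m B ox.
by move: cf; exact: (cbd_bilin (@eval_linear1 R G H) (@eval_linear2 R G H)).
Qed.

Lemma cbd_time m E G v (B : set E) (f : J -> E -> G) : cbd v m B f ->
  cbd (fun i => lw (s i) (t i) ^+ 2 * v i) m B (fun i y => (t i - s i) *: f i y).
Proof.
have ot : of_order al 2 (fun s t => (t - s) *: (1 : R^o)).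
  apply: ord_time => // T'; exists 1 => // s' t' _ _ _.
  by rewrite normr1 mulr1.
move=> cf; have := cbd_ord m B ot.
have l1 (y : G) : linear (fun c : R^o => (c : R) *: y).
  by move=> a u v'; rewrite scalerDl scalerA.
have l2 (c : R^o) : linear (fun y : G => (c : R) *: y).
  by move=> a u v'; rewrite scalerDr !scalerA mulrC.
move=> /(cbd_bilin l1 l2 (B := B))/(_ cf).
have e i : ((t i - s i) *: (1 : R^o) : R) = t i - s i by exact: mulr1.
have -> : (fun i y => (t i - s i) *: f i y) =
    (fun i y => ((t i - s i) *: (1 : R^o) : R) *: f i y).
  by apply/funext => i; apply/funext => y; rewrite e.
exact.
Qed.

Lemma lw_bd : exists2 K, 0 <= K & forall i, 0 <= lw (s i) (t i) <= K.
Proof.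
have [K K0 hK] := @lw_bounded R al al3 T; exists K => // i.
by have [h1 h2 h3] := hst i; rewrite lw_ge0 hK.
Qed.

(** Here alpha <= 1/2 enters: the time step is of second order. *)
Lemma germ2_cbd : cbd (fun i => lw (s i) (t i) ^+ 2) k.+1 [set: W]
  (fun i y => area (s i) (t i) (second_field y) + (t i - s i) *: F0 y).
Proof.
apply: cbdD.
  have := cbd_apply (ord_area al3 hX hZ W) (cbdS (@cbd_Q J)).
  by apply: (cbd_weight (c := 1)) => // i; rewrite !mulr1 mul1r.
have := cbd_time (@cbd_F0 J).
by apply: (cbd_weight (c := 1)) => // i; rewrite !mulr1 mul1r.
Qed.

Lemma germ_cbd : cbd (fun i => lw (s i) (t i)) k.+1 [set: W]
  (fun i => germ (s i) (t i)).
Proof.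
have [K K0 hK] := lw_bd.
have c1 := cbd_eval (ord_Z al3 hX hZ) (cbdS (cbdS (@cbd_F J))).
have := germ2_cbd; move=> /(cbd_weight (w' := fun i => lw (s i) (t i)) (c := K) K0).
have -> : (fun i => germ (s i) (t i)) = (fun i y => F y (incr Z (s i) (t i)) +
   (area (s i) (t i) (second_field y) + (t i - s i) *: F0 y)).
  by apply/funext => i; apply/funext => y; rewrite /germ addrA.
move=> c2; apply: cbdD; last first.
  apply: c2 => i; have /andP[h1 h2] := hK i.
  by rewrite expr2 ler_wpM2r.
move: c1; exact: (cbd_weight (c := 1)).
Qed.

End Indexed.

(** Each term displays its order and the derivatives that it consumes: a Taylor remainder of F, a
    product of a second-order term with an increment, first differences of Q and of F0, and the
    failure of Chen's relation. *)
Lemma germ_coboundaryE s u t y : s <= u -> u <= t ->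
  coboundary germ s u t y =
    - (F (y + germ s u y) - F y - frechet F y (germ s u y)) (incr Z u t)
    - frechet F y (area s u (second_field y) + (u - s) *: F0 y) (incr Z u t)
    - area u t (second_field (y + germ s u y) - second_field y)
    - (t - u) *: (F0 (y + germ s u y) - F0 y)
    + area_defect XX Z Z' W s u t (second_field y).
Proof.
move=> su ut; set a := germ s u y; rewrite /coboundary -/a.
have -> : area_defect XX Z Z' W s u t (second_field y) = area s t (second_field y) - area s u (second_field y)
    - area u t (second_field y) - frechet F y (F y (incr Z s u)) (incr Z u t).
  by rewrite /area_defect !lfunBE quadE comp_lfunE.
have ea : a = F y (incr Z s u) + (area s u (second_field y) + (u - s) *: F0 y).
  by rewrite /a /germ addrA.
have -> : frechet F y (area s u (second_field y) + (u - s) *: F0 y) (incr Z u t) =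
    frechet F y a (incr Z u t) - frechet F y (F y (incr Z s u)) (incr Z u t).
  by rewrite -bilBl ea addrAC subrr add0r.
have eZ : incr Z s t = incr Z s u + incr Z u t by rewrite /incr; vring.
rewrite [X in _ - X - germ _ _ _]ea; move: a {ea} => a.
have e1 : F y (incr Z s u + incr Z u t) = F y (incr Z s u) + F y (incr Z u t) by exact: linearD.
have e2 : area u t (second_field (y + a) - second_field y) = area u t (second_field (y + a)) - area u t (second_field y) by exact: linearB.
rewrite /germ eZ e1 e2 !lfunBE {e1 e2 eZ}.
move: (frechet F y a (incr Z u t)) (frechet F y (F y (incr Z s u)) (incr Z u t)) => x1 x2.
move: (F y (incr Z s u)) (F y (incr Z u t)) (F (y + a) (incr Z u t)) => x3 x4 x5.
move: (area s t (second_field y)) (area s u (second_field y)) (area u t (second_field y)) (area u t (second_field (y + a))) => x6 x7 x8 x9.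
move: (F0 y) (F0 (y + a)) => x10 x11.
by vring.
Qed.

Section Coboundary.
Variable T : R.
Local Notation suP := (fun i : time_triple T => And3 (tri1 i) (tri2 i) (le_trans (tri3 i) (tri4 i))).
Local Notation utP := (fun i : time_triple T => And3 (le_trans (tri1 i) (tri2 i)) (tri3 i) (tri4 i)).
Local Notation a := (fun i : time_triple T => germ (tri_s i) (tri_u i)).

Lemma wcob_le1 (i : time_triple T) : lw (tri_s i) (tri_u i) ^+ 2 * lw (tri_u i) (tri_t i) <= @wcob R al T i.
Proof.
have l1 := @lw_ge0 R al (tri_s i) (tri_u i); have l2 := @lw_ge0 R al (tri_u i) (tri_t i).
rewrite /wcob expr2 mulrAC ler_wpM2l ?mulr_ge0//.
by apply: lw_le => //; [exact: tri2|exact: tri3].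
Qed.

Lemma wcob_le2 (i : time_triple T) : lw (tri_u i) (tri_t i) ^+ 2 * lw (tri_s i) (tri_u i) <= @wcob R al T i.
Proof.
have l1 := @lw_ge0 R al (tri_s i) (tri_u i); have l2 := @lw_ge0 R al (tri_u i) (tri_t i).
rewrite /wcob expr2 mulrAC [lw (tri_s i) (tri_u i) * _]mulrC ler_wpM2l ?mulr_ge0//.
by apply: lw_le => //; [exact: tri2|exact: tri3].
Qed.

Lemma germ_coboundary_cbd : cbd (@wcob R al T) k [set: W] (fun i => coboundary germ (tri_s i) (tri_u i) (tri_t i)).
Proof.
have ca := germ_cbd suP; have ca0 := cbdS ca.
have oZ := ord_Z al3 hX hZ; have oA := ord_area al3 hX hZ W.
have [K K0 hK] := lw_bd suP.
have inT (i : time_triple T) (y : W) (th : R) : 0 <= th <= 1 -> [set: W] y -> [set: W] (y + th *: a i y) by [].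
have shift G (h : W -> G) : cbd (fun _ : time_triple T => 1) k.+1 [set: W] (fun=> h) ->
    cbd (fun i : time_triple T => 1 * lw (tri_s i) (tri_u i)) k [set: W] (fun i y => h (y + a i y) - h y).
  by move=> ch; exact: (cbd_shift hK inT ch ca0).
have c1 := cbd_taylor' (h' := fun _ p => frechet F p.1 p.2) hK inT (fun _ y => diff_F y)
  (cbdS (@cbd_F (time_triple T))) ca0.
have {}c1 := cbdN (cbd_eval utP oZ c1).
have c2 := cbd_bilin (@eval_linear1 R W 'Hom(U, W)) (@eval_linear2 R W 'Hom(U, W))
  (cbdS (cbdS (@cbd_DF (time_triple T)))) (cbdS (germ2_cbd suP)).
have {}c2 := cbd_eval utP oZ c2.
have c3 := cbd_apply utP oA (shift _ _ (cbdS (@cbd_Q (time_triple T)))).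
have c4 := cbd_time utP (shift _ _ (@cbd_F0 (time_triple T))).
have c5 : cbd (@wcob R al T) k [set: W] (fun i (y : W) =>
    area_defect XX Z Z' W (tri_s i) (tri_u i) (tri_t i) (second_field y)).
  have [C C0 hC] := area_defect_bound al3 hX hZ W T.
  have := @cbd_cst R (time_triple T) (@wcob R al T) k W _ [set: W]
    (fun i => area_defect XX Z Z' W (tri_s i) (tri_u i) (tri_t i)) C C0
    (fun i => hC _ _ _ (tri1 i) (tri2 i) (tri3 i) (tri4 i)).
  move=> /(cbd_bilin (@eval_linear1 R _ _) (@eval_linear2 R _ _))/(_ (cbdS (cbdS (@cbd_Q (time_triple T))))).
  by apply: (cbd_weight (c := 1)) => // i; rewrite mulr1 mul1r.
have wc v f : (forall i, v i <= @wcob R al T i) -> cbd v k [set: W] f ->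
    cbd (@wcob R al T) k [set: W] (f : time_triple T -> W -> W).
  by move=> h; apply: (cbd_weight (c := 1)) => // i; rewrite mul1r.
rewrite (_ : (fun i => _) = (fun i y =>
    - (F (y + a i y) - F y - frechet F y (a i y)) (incr Z (tri_u i) (tri_t i))
    - frechet F y (area (tri_s i) (tri_u i) (second_field y) + (tri_u i - tri_s i) *: F0 y) (incr Z (tri_u i) (tri_t i))
    - area (tri_u i) (tri_t i) (second_field (y + a i y) - second_field y)
    - (tri_t i - tri_u i) *: (F0 (y + a i y) - F0 y)
    + area_defect XX Z Z' W (tri_s i) (tri_u i) (tri_t i) (second_field y))); last first.
  by apply/funext => i; apply/funext => y; rewrite germ_coboundaryE//; [exact: tri2|exact: tri3].
apply: cbdD c5; apply: cbdB; last first.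
  by apply: wc c4 => i; rewrite mul1r; exact: wcob_le2.
apply: cbdB; last first.
  by apply: wc c3 => i; rewrite mul1r; exact: wcob_le2.
apply: cbdB.
  by apply: wc c1 => i; rewrite mul1r expr1; exact: wcob_le1.
by apply: wc c2 => i; rewrite mul1r expr1; exact: wcob_le1.
Qed.

End Coboundary.

Lemma germ_regular : regular_germ al k germ.
Proof.
move=> T M; split; last exact: cbd_sub (germ_coboundary_cbd T).
have := @germ_cbd T (time_triple T) (@tri_s R T) (@tri_t R T) (fun i => And3 (tri1 i) (le_trans (tri2 i) (tri3 i)) (tri4 i)).
exact: cbd_sub.
Qed.

Lemma germ_glob T : exists2 C, 0 <= C & glob_germ al germ T C.
Proof.
have cg := @germ_cbd T (time_triple T) (@tri_s R T) (@tri_t R T) (fun i => And3 (tri1 i) (le_trans (tri2 i) (tri3 i)) (tri4 i)).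
have [C1 C10 h1] := cbd_bound cg; have [C3 C30 h3] := cbd_bound (germ_coboundary_cbd T).
have cT : convex_set [set: W] by [].
have [_ [g dg _]] := cbd_inv cg.
have [C2 C20 h2] := cbd_lip cT (fun i => lw_ge0 al (tri_s i) (tri_t i)) dg (cbd_le (ltn0Sn k) cg).
pose C := C1 + C2 + C3.
have [c1 c2 c3] : [/\ C1 <= C, C2 <= C & C3 <= C] by rewrite /C; split; lra.
exists C; first exact: le_trans c1.
move=> s u t Ts su ut tT; pose i := TimeTriple Ts su ut tT; have l0 := @lw_ge0 R al s t.
split=> [y|y y'|y].
- by apply: le_trans (h1 i y I) _; rewrite ler_wpM2r.
- have [_ /(_ y I) h] := h2 i y' I; apply: (le_trans h).
  by rewrite ler_wpM2r// ler_wpM2r.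
- apply: le_trans (h3 i y I) _; rewrite ler_wpM2r//.
  by rewrite !mulr_ge0// lw_ge0.
Qed.

Lemma rde_flow : (0 < k)%N -> exists phi, davie_flow al germ phi.
Proof.
move=> k0; apply: (flow_exists al3 al2); last exact: germ_glob.
exact: regular_germ_le germ_regular.
Qed.

End Germ.

(** * Riemann sums and sewing *)

Section RiemannSums.
Variables (R : realType) (al : R).
Hypotheses (al3 : 3^-1 < al).
Local Notation lw := (lw al).

Lemma fine_partition_exists (a b e : R) : a <= b -> 0 < e ->
  exists p, itv_partition a b p /\
    forall i, (i < size p)%N -> nth b (a :: p) i.+1 - nth b (a :: p) i < e.
Proof.
move=> ab e0; have [<-|nab] := eqVneq a b.
  by exists [::]; split => //; split.
have ab' : a < b by rewrite lt_neqAle nab.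
(* Equal steps; the successor makes their length strictly less than e. *)
pose n := (Num.trunc ((b - a) / e)).+1.
have n0 : 0 < n%:R :> R by rewrite ltr0n.
have ne : (b - a) / n%:R < e.
  rewrite ltr_pdivrMr// mulrC -ltr_pdivrMr//; exact: truncnS_gt.
pose f (i : nat) : R := a + (b - a) * (i%:R / n%:R).
have fS i : f i.+1 - f i = (b - a) / n%:R.
  by rewrite /f -natr1; field; rewrite gt_eqF.
have f0 : f 0%N = a by rewrite /f mul0r mulr0 addr0.
have fn : f n = b by rewrite /f divff ?gt_eqF//; ring.
have np i : (i <= n)%N -> nth b (a :: [seq f i | i <- iota 1 n]) i = f i.
  move=> im; rewrite -{1}f0 -map_cons -/(iota 0 n.+1) (nth_map 0%N) ?size_iota ?ltnS//.
  by rewrite nth_iota ?ltnS.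
exists [seq f i | i <- iota 1 n]; split; last first.
  move=> i; rewrite size_map size_iota => im.
  by rewrite !np ?(ltnW im)// fS.
split.
  rewrite -f0 path_map.
  have h : path ltn 0%N (iota 1 n) by exact: (iota_ltn_sorted 0 n.+1).
  apply: (sub_path _ h) => i j /= ij.
  rewrite /f ltrD2l ltr_pM2l ?subr_gt0// ltr_pM2r ?invr_gt0// ltr_nat.
  exact: ij.
rewrite (last_nth b) size_map size_iota np//.
exact/eqP.
Qed.

Lemma fine_partitions_proper (a b : R) : a <= b -> ProperFilter (fine_partitions a b).
Proof.
move=> ab; apply: filter_from_proper; last first.
  by move=> e e0; exact: fine_partition_exists.
apply: filter_from_filter; first by exists 1; exact: ltr01.
move=> e1 e2 e10 e20; exists (Num.min e1 e2); first by rewrite /= lt_min e10.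
by move=> p [pab hp]; split; split=> // i ip; have := hp i ip; rewrite lt_min => /andP[].
Qed.

(** The terms telescope, and an interval of length x < e contributes
    x ^ (3 alpha) <= x * e ^ (3 alpha - 1). *)
Lemma riemann_sum_bound (E : normedVectType R) (I : R -> E) Xi C a b e p :
  0 <= C -> (forall s t, a <= s -> s <= t -> t <= b -> `|I t - I s - Xi s t| <= C * lw s t ^+ 3) ->
  (forall s t, s <= t -> t - s <= e -> (t - s) `^ (3 * al - 1) <= e `^ (3 * al - 1)) ->
  itv_partition a b p ->
  (forall i, (i < size p)%N -> nth b (a :: p) i.+1 - nth b (a :: p) i < e) ->
  `|I b - I a - \sum_(0 <= i < size p) Xi (nth b (a :: p) i) (nth b (a :: p) i.+1)| <=
    C * e `^ (3 * al - 1) * (b - a).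
Proof.
move=> C0 hI he pab hp; set x := fun i => nth b (a :: p) i.
have x0 : x 0%N = a by [].
have xn : x (size p) = b.
  exact: (itv_partition_nth_size b pab).
have tel (G : zmodType) (f : R -> G) : f b - f a = \sum_(0 <= i < size p) (f (x i.+1) - f (x i)).
  by rewrite (telescope_sumr (fun i => f (x i))) ?leq0n// xn x0.
rewrite (tel _ I) -sumrB (tel _ id) mulr_sumr (le_trans (ler_norm_sum _ _ _))//.
rewrite !big_nat; apply: ler_sum => i /andP[_ ip].
have hx : x i < x i.+1.
  have [pp _] := pab; have /(pathP b) h := pp; exact: h.
have ax : a <= x i by apply: (itv_partition_nth_ge _ pab); rewrite ltnS ltnW.
have xb : x i.+1 <= b by exact: (itv_partition_nth_le _ pab).
apply: le_trans (hI _ _ ax (ltW hx) xb) _.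
rewrite /lw powR_al3 ?subr_ge0 ?(ltW hx)//.
rewrite (_ : C * _ * _ = C * ((x i.+1 - x i) * e `^ (3 * al - 1))); last by ring.
rewrite ler_wpM2l// ler_wpM2l ?subr_ge0 ?(ltW hx)// he ?(ltW hx)//.
by apply: ltW; exact: hp.
Qed.

Lemma partition_lim_sewn (E : normedVectType R) (I : R -> E) Xi C a b :
  0 <= C -> a <= b ->
  (forall s t, a <= s -> s <= t -> t <= b -> `|I t - I s - Xi s t| <= C * lw s t ^+ 3) ->
  partition_lim Xi a b = I b - I a.
Proof.
move=> C0 ab hI; have pf := fine_partitions_proper ab.
have a31 := al31 al3.
apply: cvg_lim; first exact: norm_hausdorff.
apply/cvgrPdist_le => eps eps0.
pose M := C * (b - a) + 1; have M0 : 0 < M.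
  by rewrite /M ltr_pwDr// mulr_ge0// subr_ge0.
exists ((eps / M) `^ (3 * al - 1)^-1).
  by rewrite /= powR_gt0// divr_gt0.
move=> p [pab hp]; set e := _ `^ _ in hp.
have ee : e `^ (3 * al - 1) = eps / M.
  by rewrite /e -powRrM mulVf ?gt_eqF// powRr1// divr_ge0// ltW.
apply: le_trans (riemann_sum_bound C0 hI _ pab hp) _.
  move=> s t st h; apply: ge0_ler_powR => //; rewrite ?nnegrE ?subr_ge0//.
  - by rewrite -subr_ge0 ltW.
  - exact: powR_ge0.
rewrite ee mulrAC mulrA ler_pdivrMr// mulrC ler_wpM2l ?(ltW eps0)//.
by rewrite /M lerDl.
Qed.

End RiemannSums.

Section Sewing.
Variables (R : realType) (al : R).
Hypotheses (al3 : 3^-1 < al) (al2 : al <= 2^-1).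
Local Notation lw := (lw al).

(** The sewing lemma is the existence of the flow of a germ that does not depend on the state. *)
Lemma sewing (E : normedVectType R) (Xi : R -> R -> E) :
  of_order al 1 Xi ->
  (forall T, exists2 C, 0 <= C & forall s u t, - T <= s -> s <= u -> u <= t -> t <= T ->
     `|Xi s t - Xi s u - Xi u t| <= C * (lw s u * lw u t * lw s t)) ->
  exists I : R -> E, I 0 = 0 /\ of_order al 3 (fun s t => I t - I s - Xi s t).
Proof.
move=> h1 h2; pose A s t (_ : E) := Xi s t.
have rA : regular_germ al 1 A.
  move=> T M; have [C1 C10 b1] := h1 T; have [C2 C20 b2] := h2 T; split.
    apply: (@cbd_cst R _ _ _ E E _ (fun i : time_triple T => Xi (tri_s i) (tri_t i)) C1) => // i.
    have := b1 (tri_s i) (tri_t i) (tri1 i) (le_trans (tri2 i) (tri3 i)) (tri4 i).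
    by rewrite expr1.
  apply: (@cbd_cst R _ _ _ E E _ (fun i : time_triple T =>
    Xi (tri_s i) (tri_t i) - Xi (tri_s i) (tri_u i) - Xi (tri_u i) (tri_t i)) C2) => // i.
  exact: b2 (tri1 i) (tri2 i) (tri3 i) (tri4 i).
have gA T : exists2 C, 0 <= C & glob_germ al A T C.
  have [C1 C10 b1] := h1 T; have [C2 C20 b2] := h2 T.
  exists (C1 + C2); first exact: addr_ge0.
  move=> s u t Ts su ut tT; have st := le_trans su ut; split=> [y|y y'|y].
  - apply: le_trans (b1 s t Ts st tT) _; rewrite expr1 ler_wpM2r ?lw_ge0//.
    by rewrite lerDl.
  - by rewrite subrr normr0 !mulr_ge0 ?lw_ge0 ?addr_ge0.
  - apply: le_trans (b2 s u t Ts su ut tT) _; rewrite ler_wpM2r ?mulr_ge0 ?lw_ge0//.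
    by rewrite lerDr.
have [phi gphi] := flow_exists al3 al2 rA gA.
exists (phi 0); split; first by rewrite (flow0 gphi).
move=> T; have [K K0 hK] := flow_bound gphi T 0; exists K => // s t Ts st tT.
have n0 : `|0 : E| <= 0 by rewrite normr0.
by have [d _] := hK 0 n0; exact: d.
Qed.

(** Estimates over s <= t determine the oriented integral from 0 for both signs of t. *)
Lemma oriented_sewn (E : normedVectType R) (I : R -> E) Xi t :
  I 0 = 0 -> of_order al 3 (fun s t => I t - I s - Xi s t) ->
  oriented (partition_lim Xi) 0 t = I t.
Proof.
move=> I0 hI; have [C C0 hC] := hI `|t|; have /andP[t1 t2] := absr_bounds t.
rewrite /oriented; case: ifPn => [t0|/negP t0].
  rewrite (partition_lim_sewn (I := I) al3 C0 t0) ?I0 ?subr0//.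
  move=> s u s0 su ut; apply: hC => //; last exact: le_trans t2.
  by apply: le_trans s0; rewrite oppr_le0.
have {}t0 : t <= 0 by have [//|/ltW/t0] := leP t 0.
rewrite (partition_lim_sewn (I := I) al3 C0 t0) ?I0 ?sub0r ?opprK//.
move=> s u ts su u0; apply: hC => //; first exact: le_trans ts.
by apply: le_trans u0 _.
Qed.

Section ControlledIntegral.
Variables (U V W : normedVectType R).
Variables (X : R -> V) (XX : R -> R -> tensor V) (Z : R -> U) (Z' : R -> 'Hom(V, U)).
Hypotheses (hX : is_rough_path al X XX) (hZ : is_controlled al X Z Z').
Variables (G : R -> 'Hom(U, W)) (q : R -> 'Hom(U, 'Hom(U, W))) (G' : R -> 'Hom(V, 'Hom(U, W))).
Hypotheses (hG : of_order al 2 (fun s t => incr G s t - q s (incr Z s t)))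
  (hq : of_order al 1 (incr q)) (hG' : forall u x, G' u x = q u (Z' u x)).
Local Notation area := (area XX Z' W).

Definition int_germ s t := G s (incr Z s t) + area s t (q s).

Lemma int_germE : (fun u v => G u (incr Z u v) + tens_ext (fun x y => G' u x (Z' u y)) (XX u v))
  = int_germ.
Proof.
apply/funext => u; apply/funext => v; rewrite /int_germ areaE; congr (_ + _).
by congr tens_ext; apply/funext => x; apply/funext => y; rewrite hG'.
Qed.

Lemma ord_G : of_order al 1 (incr G).
Proof.
apply: (@ord_ext _ _ _ _ (fun s t => (incr G s t - q s (incr Z s t)) + q s (incr Z s t))).
  by move=> s t _; rewrite subrK.
apply: ordD; first exact: ord_le hG.
exact: ord_app (ord_path0 al3 hq).1 (ord_Z al3 hX hZ).
Qed.

Lemma int_germ_ord : of_order al 1 int_germ.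
Proof.
apply: ordD; first exact: ord_app (ord_path0 al3 ord_G).1 (ord_Z al3 hX hZ).
apply: (ord_le al3 (n := 2)) => //.
exact: ord_app (ord_area al3 hX hZ W) (ord_path0 al3 hq).1.
Qed.

(** The expansion of G along Z cancels the quadratic term that Chen's relation leaves. *)
Lemma int_germ_coboundary s u t : s <= u -> u <= t ->
  int_germ s t - int_germ s u - int_germ u t =
    area_defect XX Z Z' W s u t (q s) - area u t (incr q s u)
    - (incr G s u - q s (incr Z s u)) (incr Z u t).
Proof.
move=> su ut.
have -> : area_defect XX Z Z' W s u t (q s) = area s t (q s) - area s u (q s)
    - area u t (q s) - q s (incr Z s u) (incr Z u t).
  by rewrite /area_defect !lfunBE quadE.
have eZ : incr Z s t = incr Z s u + incr Z u t by rewrite /incr; vring.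
have e1 : G s (incr Z s u + incr Z u t) = G s (incr Z s u) + G s (incr Z u t) by exact: linearD.
have e2 : area u t (incr q s u) = area u t (q u) - area u t (q s) by exact: linearB.
rewrite /int_germ eZ e1 e2 lfunBE {3}/incr lfunBE {eZ e1 e2}.
move: (G s (incr Z s u)) (G s (incr Z u t)) (G u (incr Z u t)) (q s (incr Z s u) (incr Z u t)) => x1 x2 x3 x4.
move: (area s t (q s)) (area s u (q s)) (area u t (q s)) (area u t (q u)) => x5 x6 x7 x8.
by vring.
Qed.

Lemma int_germ_defect T : exists2 C, 0 <= C & forall s u t,
  - T <= s -> s <= u -> u <= t -> t <= T ->
  `|int_germ s t - int_germ s u - int_germ u t| <= C * (lw s u * lw u t * lw s t).
Proof.
have [C1 C10 h1] := area_defect_bound al3 hX hZ W T.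
have [C2 C20 h2] := ord_area al3 hX hZ W T; have [C3 C30 h3] := hq T.
have [C4 C40 h4] := hG T; have [C5 C50 h5] := ord_Z al3 hX hZ T.
have [C6 C60 h6] := (ord_path0 al3 hq).1 T.
exists (C1 * C6 + C2 * C3 + C4 * C5); first by rewrite !addr_ge0// mulr_ge0.
move=> s u t Ts su ut tT; rewrite int_germ_coboundary//.
have uT := le_trans ut tT; have Tu := le_trans Ts su; have st := le_trans su ut.
have a0 := @lw_ge0 R al s u; have b0 := @lw_ge0 R al u t; have c0 := @lw_ge0 R al s t.
have ac : lw s u <= lw s t by exact: lw_le.
have bc : lw u t <= lw s t by exact: lw_le.
have g1 := h1 s u t Ts su ut tT; have g2 := h2 u t Tu ut tT; have g3 := h3 s u Ts su uT.
have g4 := h4 s u Ts su uT; have g5 := h5 u t Tu ut tT; have g6 := h6 s t Ts st tT.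
rewrite expr1 in g3 g5; rewrite expr0 mulr1 in g6.
move: (lw s u) (lw u t) (lw s t) a0 b0 c0 ac bc g1 g2 g3 g4 g5 => a b c a0 b0 c0 ac bc g1 g2 g3 g4 g5.
apply: le_trans (ler_normB _ _) _; rewrite mulrDl; apply: lerD.
  apply: le_trans (ler_normB _ _) _; rewrite mulrDl; apply: lerD.
    apply: le_trans (lfun_norm_le _ _) _; rewrite mulrAC.
    by apply: ler_pM.
  apply: le_trans (lfun_norm_le _ _) _.
  apply: (@le_trans _ _ ((C2 * b ^+ 2) * (C3 * a))); first exact: ler_pM.
  rewrite (_ : _ * _ * _ = C2 * C3 * (a * b * b)); last by ring.
  by rewrite ler_wpM2l ?mulr_ge0// ler_wpM2l ?mulr_ge0.
apply: le_trans (lfun_norm_le _ _) _.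
apply: (@le_trans _ _ ((C4 * a ^+ 2) * (C5 * b))); first exact: ler_pM.
rewrite (_ : _ * _ * _ = C4 * C5 * (a * b * a)); last by ring.
by rewrite ler_wpM2l ?mulr_ge0// ler_wpM2l ?mulr_ge0.
Qed.

Local Notation J := (controlled_int XX Z Z' G G' 0).

(** This is how a Davie path is shown to satisfy an integral equation. *)
Lemma controlled_int_unique (I : R -> W) :
  I 0 = 0 -> of_order al 3 (fun s t => I t - I s - int_germ s t) -> J = I.
Proof.
by move=> I0 hI; apply/funext => t; rewrite /controlled_int int_germE; exact: oriented_sewn.
Qed.

Lemma controlled_int_sewn :
  J 0 = 0 /\ of_order al 3 (fun s t => J t - J s - int_germ s t).
Proof.
have [I [I0 hI]] := sewing int_germ_ord int_germ_defect.
by rewrite (controlled_int_unique I0 hI).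
Qed.

End ControlledIntegral.

End Sewing.

(** * The time integral *)

Section TimeIntegral.
Variables (R : realType) (al : R).
Hypotheses (al3 : 3^-1 < al) (al2 : al <= 2^-1).
Local Notation lw := (lw al).
Local Notation mu := (@lebesgue_measure R).

Lemma Rintegral_itvD (c : R -> R) a x b : continuous c -> a <= x -> x <= b ->
  \int[mu]_(r in `[a, x]) c r + \int[mu]_(r in `[x, b]) c r = \int[mu]_(r in `[a, b]) c r.
Proof.
move=> cc ax xb.
have int u v : mu.-integrable `[u, v] (EFin \o c).
  apply: continuous_compact_integrable; first exact: segment_compact.
  exact: continuous_subspaceT.
have := @Rintegral_itvB R c (BLeft a) (BRight b) x (int a b).
rewrite !bnd_simp => /(_ ax xb); rewrite Rintegral_itv_obnd_cbnd.
  by move=> <-; rewrite addrC subrK.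
apply: integrableS (int x b) => //; exact: subset_itv_oc_cc.
Qed.

Lemma Rintegral_near_cst (c : R -> R) a b D : continuous c -> a <= b ->
  (forall r, a <= r -> r <= b -> `|c r - c a| <= D) ->
  `|\int[mu]_(r in `[a, b]) c r - (b - a) * c a| <= D * (b - a).
Proof.
move=> cc ab hD.
have mi k : (\int[mu]_(r in `[a, b]) k) = k * (b - a).
  rewrite Rintegral_cst//= lebesgue_measure_itv/= lte_fin.
  have [<-|nab] := eqVneq a b; first by rewrite ltxx subrr.
  by rewrite lt_neqAle nab ab -EFinD.
have int (f : R -> R) : continuous f -> mu.-integrable `[a, b] (EFin \o f).
  move=> cf; apply: continuous_compact_integrable; first exact: segment_compact.
  exact: continuous_subspaceT.
have ck (k : R) : continuous (fun _ : R => k) by move=> r; exact: cvg_cst.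
have cB : continuous (fun r => c r - c a) by move=> r; apply: cvgB; [exact: cc|exact: cvg_cst].
rewrite [(b - a) * _]mulrC -mi -RintegralB//; [|exact: int|exact: int].
apply: le_trans (le_normr_Rintegral _ _) _ => //; first exact: int.
rewrite -mi; apply: le_Rintegral => //.
- by apply: int => r; exact: cvg_norm (cB r).
- exact: int.
by move=> r /=; rewrite in_itv/= => /andP[ar rb]; exact: hD.
Qed.

Section Vector.
Variables (W : normedVectType R) (g : R -> W).
Hypothesis hg : of_order al 1 (incr g).

Let c i r := coord (vbasis {:W}) i (g r).
Let Iv a b := \sum_(i < \dim {:W}) (\int[mu]_(r in `[a, b]) c i r) *: (vbasis {:W})`_i.

Lemma ord_continuous : continuous g.
Proof.
move=> t; have [C C0 hC] := hg (`|t| + 1).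
apply/cvgrPdist_le => e e0.
have eC : 0 < e / (C + 1) by rewrite divr_gt0// ltr_wpDl.
have [tau tau0 htau] := lw_small al3 eC.
near=> r.
have rt : `|r - t| <= Num.min 1 tau.
  rewrite distrC; near: r; apply: cvgr_dist_le => //; by rewrite lt_min ltr01.
have [r1 r2] : `|r - t| <= 1 /\ `|r - t| <= tau.
  by move: rt; rewrite le_min => /andP[].
have key s u : - (`|t| + 1) <= s -> s <= u -> u <= `|t| + 1 -> u - s <= tau -> `|g u - g s| <= e.
  move=> h1 h2 h3 h4; apply: le_trans (hC s u h1 h2 h3) _; rewrite expr1.
  apply: (@le_trans _ _ (C * (e / (C + 1)))); first by rewrite ler_wpM2l// htau.
  by rewrite mulrCA ler_piMr ?(ltW e0)// ler_pdivrMr ?mul1r ?lerDl// ltr_wpDl.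
have := absr_bounds t => /andP[t1 t2].
move: r1 r2; rewrite !ler_norml => /andP[r1 r1'] /andP[r2 r2'].
have [tr|/ltW rt'] := leP t r.
  by rewrite distrC; apply: key => //; lra.
by apply: key => //; lra.
Unshelve. all: by end_near. Qed.

Lemma coord_continuous i : continuous (c i).
Proof.
move=> t; apply: (@continuous_comp _ _ _ g (@crd R W i)); first exact: ord_continuous.
exact: crd_continuous.
Qed.

Lemma IvD a x b : a <= x -> x <= b -> Iv a x + Iv x b = Iv a b.
Proof.
move=> ax xb; rewrite /Iv -big_split; apply: eq_bigr => i _ /=.
by rewrite -scalerDl Rintegral_itvD//; exact: coord_continuous.
Qed.

Lemma Iv_sewn : of_order al 3 (fun s t => Iv s t - (t - s) *: g s).
Proof.
move=> T; have [T0|T0] := ltP T 0.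
  by exists 0 => // s t Ts st tT; exfalso; lra.
have [C C0 hC] := hg T; have T20 : 0 <= 2 * T by lra.
have [D D0 hD] := time_le_lw al2 T20.
have [K K0 hK] := crd_bounded W.
pose N := \sum_(i < \dim {:W}) `|(vbasis {:W})`_i|.
have N0 : 0 <= N by apply: sumr_ge0.
exists (K * C * D * N); first by rewrite !mulr_ge0.
move=> s t Ts st tT.
have -> : Iv s t - (t - s) *: g s = \sum_(i < \dim {:W})
    (\int[mu]_(r in `[s, t]) c i r - (t - s) * c i s) *: (vbasis {:W})`_i.
  have -> : (t - s) *: g s = \sum_(i < \dim {:W}) ((t - s) * c i s) *: (vbasis {:W})`_i.
    rewrite {1}(crdE (g s)) scaler_sumr; apply: eq_bigr => i _; exact: scalerA.
  by rewrite /Iv -sumrB; apply: eq_bigr => i _; rewrite scalerBl.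
rewrite (le_trans (ler_norm_sum _ _ _))// mulrAC [X in _ <= X]mulr_sumr.
apply: ler_sum => i _; rewrite normrZ ler_wpM2r//.
have l0 := @lw_ge0 R al s t.
apply: (@le_trans _ _ (K * (C * lw s t) * (t - s))).
  apply: Rintegral_near_cst => //; first exact: coord_continuous.
  move=> r sr rt; rewrite -[c i r - c i s](raddfB (coord (vbasis {:W}) i)).
  apply: le_trans (hK i _) _; rewrite ler_wpM2l//.
  have := hC s r Ts sr (le_trans rt tT); rewrite expr1 => h; apply: le_trans h _.
  by rewrite ler_wpM2l// lw_le.
have h : t - s <= D * lw s t ^+ 2 by apply: hD => //; lra.
apply: (@le_trans _ _ (K * (C * lw s t) * (D * lw s t ^+ 2))); first by rewrite ler_wpM2l ?mulr_ge0.
by apply: le_of_eq; ring.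
Qed.

Lemma time_int_sewn : time_int g 0 0 = 0 /\
  of_order al 3 (fun s t => time_int g 0 t - time_int g 0 s - (t - s) *: g s).
Proof.
have Iv0 : Iv 0 0 = 0.
  by apply: (addrI (Iv 0 0)); rewrite IvD// addr0.
split; first by rewrite /time_int /oriented lexx.
apply: ord_ext Iv_sewn => s t st; congr (_ - _).
rewrite /time_int /oriented -/(Iv 0 t) -/(Iv t 0) -/(Iv 0 s) -/(Iv s 0).
have [t0|t0] := leP 0 t; have [s0|s0] := leP 0 s.
- by rewrite -(IvD s0 st) addrC addKr.
- by rewrite opprK addrC IvD// ltW.
- by have := le_lt_trans (le_trans s0 st) t0; rewrite ltxx.
- by rewrite opprK -(IvD st (ltW t0)) [Iv s t + _]addrC addKr.
Qed.

End Vector.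
End TimeIntegral.

(** * Integral equations as Davie estimates *)

Section Composition.
Variables (R : realType) (al : R).
Hypotheses (al3 : 3^-1 < al).
Local Notation lw := (lw al).
Implicit Types E G : normedVectType R.

Lemma lfunBr E G (f : 'Hom(E, G)) x y : f (x - y) = f x - f y.
Proof. exact: linearB. Qed.

Lemma ord0_ball E (H : R -> E) T : of_order al 0 (fun s t => H s) ->
  exists2 M, 0 <= M & forall t, - T <= t -> t <= T -> cball M (H t).
Proof.
move=> /(_ T)[M M0 hM]; exists M => // t Tt tT.
by have := hM t t Tt (lexx _) tT; rewrite expr0 mulr1.
Qed.

Lemma ord_compose0 E G (K : E -> G) (H : R -> E) :
  (forall M, cbd (fun _ : unit => 1) 0 (cball M) (fun=> K)) ->
  of_order al 0 (fun s t => H s) -> of_order al 0 (fun s t => K (H s)).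
Proof.
move=> cK hH T; have [M M0 hM] := ord0_ball T hH; have [C C0 hC] := cbd_bound (cK M).
exists C => // s t Ts st tT; rewrite expr0.
exact: (hC tt (H s) (hM s Ts (le_trans st tT))).
Qed.

Lemma ord_compose1 E G (K : E -> G) (H : R -> E) :
  (forall M, cbd (fun _ : unit => 1) 1 (cball M) (fun=> K)) ->
  of_order al 1 (incr H) -> of_order al 1 (incr (fun r => K (H r))).
Proof.
move=> cK hH T; have [M M0 hM] := ord0_ball T (ord_path0 al3 hH).1.
have [_ [g dg _]] := cbd_inv (cK M).
have [C C0 hC] := cbd_lip (cball_convex (M := M)) (fun _ : unit => @ler01 R) dg (cK M).
have [D D0 hD] := hH T; exists (C * D); first exact: mulr_ge0.
move=> s t Ts st tT; have [_ h] := hC tt (H s) (hM s Ts (le_trans st tT)).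
apply: le_trans (h (H t) (hM t (le_trans Ts st) tT)) _.
by rewrite mulr1 -mulrA ler_wpM2l// hD.
Qed.

(** Taylor's formula: the increment of H may be replaced by r inside the linear map DK. *)
Lemma ord_compose2 E G (K : E -> G) (H : R -> E) (r : R -> R -> E) :
  (forall M, cbd (fun _ : unit => 1) 2 (cball M) (fun=> K)) ->
  of_order al 1 (incr H) -> of_order al 2 (fun s t => incr H s t - r s t) ->
  of_order al 2 (fun s t => incr (fun r => K (H r)) s t - frechet K (H s) (r s t)).
Proof.
move=> cK hH hr.
have dK x : is_diff x K (fun h => frechet K x h).
  have [_ [g dg _]] := cbd_inv (cK 0); apply: isd_frechet.
  exact: (@ex_diff _ _ _ _ _ _ _ (dg tt x)).
apply: (@ord_ext _ _ _ _ (fun s t => (K (H t) - K (H s) - frechet K (H s) (incr H s t)) +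
    frechet K (H s) (incr H s t - r s t))).
  by move=> s t _; rewrite lfunBr /incr; vring.
have ball T := ord0_ball T (ord_path0 al3 hH).1.
apply: ordD.
  move=> T; have [M M0 hM] := ball T.
  have [C C0 hC] := cbd_lip2 (cball_convex (M := M)) (fun _ : unit => @ler01 R) (fun _ => dK) (cK M).
  have [D D0 hD] := hH T; exists (C * D ^+ 2); first by rewrite mulr_ge0// exprn_ge0.
  move=> s t Ts st tT.
  have [_ h _] := hC tt (H s) (H t) (hM s Ts (le_trans st tT)) (hM t (le_trans Ts st) tT).
  apply: (le_trans h); rewrite mulr1 -mulrA ler_wpM2l// -exprMn.
  by rewrite lerXn2r ?nnegrE ?mulr_ge0 ?lw_ge0//; have := hD s t Ts st tT; rewrite expr1.
apply: (ord_app (n := 0)) hr => T; have [M M0 hM] := ball T.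
have [C C0 hC] := cbd_lip (cball_convex (M := M)) (fun _ : unit => @ler01 R) (fun _ => dK) (cbdS (cK M)).
exists C => // s t Ts st tT; rewrite expr0 mulr1; apply: norm_lfun_le => // x.
have [h _] := hC tt (H s) (hM s Ts (le_trans st tT)).
by have := h x; rewrite mulr1.
Qed.

Lemma ord_pair n E G (f : R -> R -> E) (g : R -> R -> G) :
  of_order al n f -> of_order al n g -> of_order al n (fun s t => (f s t, g s t)).
Proof.
move=> hf hg T; have [C C0 hC] := hf T; have [D D0 hD] := hg T.
exists (C + D); first exact: addr_ge0.
move=> s t Ts st tT; have l0 : 0 <= lw s t ^+ n by rewrite exprn_ge0// lw_ge0.
rewrite prod_normE/= ge_max; apply/andP; split.
  by apply: le_trans (hC s t Ts st tT) _; rewrite ler_wpM2r// lerDl.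
by apply: le_trans (hD s t Ts st tT) _; rewrite ler_wpM2r// lerDr.
Qed.

End Composition.

Section Equations.
Variables (R : realType) (al : R).
Hypotheses (al3 : 3^-1 < al) (al2 : al <= 2^-1).
Local Notation lw := (lw al).
Variables (U V W : normedVectType R).
Variables (X : R -> V) (XX : R -> R -> tensor V) (Z : R -> U) (Z' : R -> 'Hom(V, U)).
Hypotheses (hX : is_rough_path al X XX) (hZ : is_controlled al X Z Z').
Variables (y : R -> W) (y' : R -> 'Hom(V, W)) (y0 : W).
Variables (G : R -> 'Hom(U, W)) (q : R -> 'Hom(U, 'Hom(U, W)))
  (G' : R -> 'Hom(V, 'Hom(U, W))) (g : R -> W).
Local Notation area := (area XX Z' W).

(** The Gubinelli expansion in X with derivative G Z' is an expansion in Z, since Z - Z' X is of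
    second order. *)
Lemma controlled_expand : is_controlled al X y y' -> (forall t, y' t = (G t \o Z' t)%VF) ->
  of_order al 0 (fun s t => G s) -> of_order al 2 (fun s t => incr y s t - G s (incr Z s t)).
Proof.
move=> hy ey hG; apply: (@ord_ext _ _ _ _ (fun s t => (incr y s t - y' s (incr X s t)) -
    G s (incr Z s t - Z' s (incr X s t)))).
  move=> s t _; rewrite ey; move: (incr X s t) (incr Z s t) (incr y s t) => x z v.
  by rewrite lfunBr comp_lfunE; vring.
by apply: ordB; [exact: ord_RZ hy|exact: (ord_app hG (ord_RZ hZ))].
Qed.

(** The second level and the drift are of second order, so that a Davie estimate contains the
    expansion of y in Z. *)
Lemma davie_expand : of_order al 0 (fun s t => G s) -> of_order al 0 (fun s t => q s) ->
  of_order al 0 (fun s t => g s) ->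
  of_order al 3 (fun s t => incr y s t - (G s (incr Z s t) + area s t (q s) + (t - s) *: g s)) ->
  of_order al 1 (incr y) /\ of_order al 2 (fun s t => incr y s t - G s (incr Z s t)).
Proof.
move=> hG hq hg hy.
have h2 : of_order al 2 (fun s t => incr y s t - G s (incr Z s t)).
  apply: (@ord_ext _ _ _ _ (fun s t =>
    (incr y s t - (G s (incr Z s t) + area s t (q s) + (t - s) *: g s)) +
    (area s t (q s) + (t - s) *: g s))).
    by move=> s t _; move: (incr y s t) (G s (incr Z s t)) (area s t (q s)) => x1 x2 x3; vring.
  apply: ordD; first exact: ord_le hy.
  by apply: ordD; [exact: (ord_app (ord_area al3 hX hZ W) hq)|exact: ord_time].
split=> //; apply: (@ord_ext _ _ _ _ (fun s t => (incr y s t - G s (incr Z s t)) + G s (incr Z s t))).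
  by move=> s t _; rewrite subrK.
by apply: ordD; [exact: ord_le h2|exact: (ord_app hG (ord_Z al3 hX hZ))].
Qed.

Hypotheses (hG : of_order al 2 (fun s t => incr G s t - q s (incr Z s t)))
  (hq : of_order al 1 (incr q)) (hG' : forall u x, G' u x = q u (Z' u x)) (hg : of_order al 1 (incr g)).

Lemma equation_davie :
  (forall t, y t = y0 + controlled_int XX Z Z' G G' 0 t + time_int g 0 t) ->
  y 0 = y0 /\
  of_order al 3 (fun s t => incr y s t - (G s (incr Z s t) + area s t (q s) + (t - s) *: g s)).
Proof.
move=> ey; have [J0 hJ] := controlled_int_sewn al3 al2 hX hZ hG hq hG'.
have [S0 hS] := time_int_sewn al3 al2 hg.
split; first by rewrite ey J0 S0 !addr0.
apply: ord_ext (ordD hJ hS) => s t _; have -> : incr y s t = y t - y s by [].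
rewrite !ey /int_germ; move: (controlled_int _ _ _ _ _ _ s) (controlled_int _ _ _ _ _ _ t) => j1 j2.
move: (time_int g 0 s) (time_int g 0 t) (G s (incr Z s t)) (area s t (q s)) => s1 s2 x1 x2; vring.
Qed.

Lemma davie_equation : y 0 = y0 ->
  of_order al 1 (incr y) -> of_order al 2 (fun s t => incr y s t - G s (incr Z s t)) ->
  of_order al 3 (fun s t => incr y s t - (G s (incr Z s t) + area s t (q s) + (t - s) *: g s)) ->
  is_controlled al X y (fun t => (G t \o Z' t)%VF) /\
  forall t, y t = y0 + controlled_int XX Z Z' G G' 0 t + time_int g 0 t.
Proof.
move=> ey0 hy1 hy2 hy; have [S0 hS] := time_int_sewn al3 al2 hg.
have oG := ord_G al3 hX hZ hG hq; split.
  split.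
    apply: (ord_holder (@pow_al1 R al)).
    apply: (@ord_ext _ _ _ _ (fun s t => (incr G s t \o Z' t)%VF + (G s \o incr Z' s t)%VF)).
      move=> s t _; rewrite /incr; apply/lfunP => x.
      rewrite !(add_lfunE, opp_lfunE, comp_lfunE) lfunBr; vring.
    apply: ordD.
      exact: (ord_comp oG (ord_path0 al3 (ord_Z' hZ)).2).
    exact: (ord_comp (ord_path0 al3 oG).1 (ord_Z' hZ)).
  apply: (@ord_holder _ al 2 (2 * al)); first exact: pow_al2.
  apply: (@ord_ext _ _ _ _ (fun s t => (incr y s t - G s (incr Z s t)) +
      G s (incr Z s t - Z' s (incr X s t)))).
    move=> s t _; move: (incr X s t) (incr Z s t) (incr y s t) => x z v.
    by rewrite lfunBr comp_lfunE; vring.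
  by apply: ordD => //; exact: (ord_app (ord_path0 al3 oG).1 (ord_RZ hZ)).
pose I t := y t - y0 - time_int g 0 t.
have I0 : I 0 = 0 by rewrite /I ey0 S0 subrr subr0.
have -> : controlled_int XX Z Z' G G' 0 = I.
  apply: (controlled_int_unique al3 hG' I0).
  apply: ord_ext (ordB hy hS) => s t _; rewrite /I /int_germ.
  have -> : incr y s t = y t - y s by [].
  move: (time_int g 0 s) (time_int g 0 t) (G s (incr Z s t)) (area s t (q s)) => s1 s2 x1 x2; vring.
by move=> t; rewrite /I; vring.
Qed.

End Equations.

(** * The solution map and its derivative *)

Section SecondDerivative.
Variable R : realType.
Implicit Types E G : normedVectType R.

(** For one map, the derivative in the sense of cbd is the Frechet derivative evaluated at the
    direction. *)
Lemma cbd_frechet m E G (f : E -> G) : cbd (fun _ : unit => 1) m.+1 [set: E] (fun=> f) ->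
  forall M, cbd (fun _ : unit => 1) m (cball M) (fun _ (p : E * E) => frechet f p.1 p.2).
Proof.
move=> /cbd_inv[_ [g dg cg]] M.
rewrite (_ : (fun _ => _) = g).
  by apply: cbd_sub (cg M) => p /cball_pair[_ h]; split.
apply/funext => i; apply/funext => -[x h] /=; exact: (frechet_isd h (dg i x)).
Qed.

Lemma diff_frechet_eval E G (f : E -> G) p : differentiable (frechet f) p.1 ->
  is_diff p (fun p : E * E => frechet f p.1 p.2)
    (fun q => frechet f p.1 q.2 + frechet (frechet f) p.1 q.1 p.2).
Proof.
move=> df.
have h1 := isd_pair (isd_comp (isd_lin p (@linear_fst R E E)) (isd_frechet df))
  (isd_lin p (@linear_snd R E E)).
exact: (isd_comp h1 (isd_bilin (frechet f p.1, p.2) (@eval_linear1 R E G) (@eval_linear2 R E G))).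
Qed.

Lemma frechet2_sym E G (f : E -> G) x a b : (forall x, differentiable f x) ->
  (forall x, differentiable (frechet f) x) ->
  (forall M, cbd (fun _ : unit => 1) 1 (cball M) (fun _ (p : E * E) => frechet f p.1 p.2)) ->
  frechet (frechet f) x a b = frechet (frechet f) x b a.
Proof.
move=> d1 d2 c; have [_ [g dg cg]] := cbd_inv (c 0).
have e p q : g tt (p, q) = frechet f p.1 q.2 + frechet (frechet f) p.1 q.1 p.2.
  by have := isd_unique (dg tt p) (diff_frechet_eval (d2 p.1)) => /(congr1 (fun f => f q)).
have := @isd_sym R E G f (fun p => frechet f p.1 p.2) (g tt) x a b
  (fun x => isd_frechet (d1 x)) (dg tt) (cbd_cont (cg 0)).
by rewrite !e /= !linear0 !add0r => ->.
Qed.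

End SecondDerivative.

Section Solutions.
Variables (R : realType) (al : R).
Hypotheses (al3 : 3^-1 < al) (al2 : al <= 2^-1).
Local Notation lw := (lw al).
Variables (U V W : normedVectType R).
Variables (X : R -> V) (XX : R -> R -> tensor V) (Z : R -> U) (Z' : R -> 'Hom(V, U)).
Hypotheses (hX : is_rough_path al X XX) (hZ : is_controlled al X Z Z').
Variables (k : nat) (F : W -> 'Hom(U, W)) (F0 : W -> W).
Hypotheses (k0 : (0 < k)%N) (hF : Cbk (k + 3) F) (hF0 : Cbk (k + 1) F0).
Local Notation area := (area XX Z' W).
Local Notation germ := (germ XX Z Z' F F0).
Local Notation one := (fun _ : unit => 1 : R).

Lemma diff_DF y : differentiable (frechet F) y.
Proof. by have := hF; rewrite addn3 => -[_ [_ [_ [h _]]]]; exact: h. Qed.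

Lemma diffF y : differentiable F y.
Proof. by have := hF; rewrite addn3 => -[_ [h _]]; exact: h. Qed.

Lemma diffF0 y : differentiable F0 y.
Proof. by have := hF0; rewrite addn1 => -[_ [h _]]; exact: h. Qed.

Lemma cbd_ball m (G : normedVectType R) (f : W -> G) : cbd one m [set: W] (fun=> f) ->
  forall M, cbd one m (cball M) (fun=> f).
Proof. by move=> h M; apply: cbd_sub h. Qed.

Lemma cbdF M : cbd one 2 (cball M) (fun=> F).
Proof. by apply: cbd_ball; exact: (cbd_le _ (cbd_F hF unit)). Qed.

Lemma cbdQ M : cbd one 1 (cball M) (fun=> second_field F).
Proof. by apply: cbd_ball; exact: (cbd_le _ (cbd_Q hF unit)). Qed.

Lemma cbdF0 M : cbd one 1 (cball M) (fun=> F0).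
Proof. by apply: cbd_ball; exact: (cbd_le _ (cbd_F0 hF0 unit)). Qed.

Lemma cbdDF M : cbd one 2 (cball M) (fun _ (p : W * W) => frechet F p.1 p.2).
Proof. by apply: cbd_frechet; exact: (cbd_le _ (cbd_F hF unit)). Qed.

Lemma cbdDQ M : cbd one 1 (cball M) (fun _ (p : W * W) => frechet (second_field F) p.1 p.2).
Proof. by apply: cbd_frechet; exact: (cbd_le _ (cbd_Q hF unit)). Qed.

Lemma cbdDF0 M : cbd one 1 (cball M) (fun _ (p : W * W) => frechet F0 p.1 p.2).
Proof. by apply: cbd_frechet; apply: (cbd_le _ (cbd_F0 hF0 unit)). Qed.

Lemma diff_Q y : is_diff y (second_field F) (fun h => (frechet F y \o frechet F y h)%VF +
  (frechet (frechet F) y h \o F y)%VF).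
Proof.
exact: (isd_comp (isd_pair (isd_frechet (diff_DF y)) (isd_frechet (diffF y)))
  (isd_bilin (frechet F y, F y) (@comp_linear1 R U W 'Hom(U, W)) (@comp_linear2 R U W 'Hom(U, W)))).
Qed.

(** By the symmetry of the second derivative of F, the derivative of Q(y) = DF(y) o F(y) in the
    direction h is the derivative of (y, h) |-> DF(y)h along the fields (F(y), DF(y)h) that drive
    the pair (y, h). This makes the derivative of the germ the germ of the variational equation. *)
Lemma frechetQE y h u : frechet (second_field F) y h u =
  frechet (frechet F) y (F y u) h + frechet F y (frechet F y h u).
Proof.
rewrite (frechet_isd h (diff_Q y)) add_lfunE !comp_lfunE addrC; congr (_ + _).
by rewrite (frechet2_sym _ _ _ diffF diff_DF)// => M; exact: cbdS (cbdDF M).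
Qed.

Lemma germ_diff s t y h : 'd (germ s t) y h =
  frechet F y h (incr Z s t) + area s t (frechet (second_field F) y h) + (t - s) *: frechet F0 y h.
Proof.
have e1 : linear (fun f : 'Hom(U, W) => f (incr Z s t)) by exact: eval_linear1.
have e2 : linear (fun f => area s t f) by exact: eval_linear2.
have e3 : linear (fun x : W => (t - s) *: x).
  by move=> a u v; rewrite scalerDr !scalerA mulrC.
have dQ : is_diff y (second_field F) (fun h => frechet (second_field F) y h).
  by apply: isd_frechet; exact: (@ex_diff _ _ _ _ _ _ _ (diff_Q y)).
have := isd_add (isd_add (isd_comp (isd_frechet (diffF y)) (isd_lin _ e1))
  (isd_comp dQ (isd_lin _ e2))) (isd_comp (isd_frechet (diffF0 y)) (isd_lin _ e3)).
by move=> d; have := @diff_val _ _ _ _ _ _ _ d => /(congr1 (fun f => f h)).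
Qed.

Variable phi : W -> R -> W.
Hypothesis gphi : davie_flow al germ phi.
Let rA1 : regular_germ al 1 germ := regular_germ_le k0 (germ_regular al3 al2 hX hZ hF hF0).

Lemma ord_phi0 w : of_order al 0 (fun s t => phi w s).
Proof.
move=> T; have [K K0 hK] := flow_bound gphi T `|w|; exists K => // s t Ts st tT.
rewrite expr0 mulr1; have [_ h] := hK w (lexx _); apply: h => //; exact: le_trans tT.
Qed.

Lemma ord_phi3 w : of_order al 3 (fun s t => incr (phi w) s t - germ s t (phi w s)).
Proof.
move=> T; have [K K0 hK] := flow_bound gphi T `|w|; exists K => // s t Ts st tT.
by have [h _] := hK w (lexx _); exact: h.
Qed.

Lemma ord_phi w : of_order al 1 (incr (phi w)) /\
  of_order al 2 (fun s t => incr (phi w) s t - F (phi w s) (incr Z s t)).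
Proof.
have b := ord_phi0 w.
apply: (davie_expand al3 al2 hX hZ (q := fun s => second_field F (phi w s)) (g := fun s => F0 (phi w s))).
- by apply: ord_compose0 b => M; exact: cbd_le (cbdF M).
- by apply: ord_compose0 b => M; exact: cbd_le (cbdQ M).
- by apply: ord_compose0 b => M; exact: cbd_le (cbdF0 M).
exact: ord_phi3.
Qed.

Lemma ord_FQ y : of_order al 1 (incr y) -> of_order al 2 (fun s t => incr y s t - F (y s) (incr Z s t)) ->
  of_order al 2 (fun s t => incr (fun r => F (y r)) s t - second_field F (y s) (incr Z s t)).
Proof.
move=> h1 h2; apply: ord_ext (ord_compose2 al3 cbdF h1 h2) => s t _.
by rewrite comp_lfunE.
Qed.

(** A solution is a Davie path of the germ, hence the flow; conversely the flow expands along Z,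
    so that its Davie estimate is the integral equation. *)
Lemma solves_rdeP w (Y : R -> W * 'Hom(V, W)) : solves_rde al X XX Z Z' F F0 w Y <->
  Y = (fun t => (phi w t, (F (phi w t) \o Z' t)%VF)).
Proof.
split=> [[hc ey ey']|->].
  pose y t := (Y t).1.
  have oy : of_order al 1 (incr y) := ord_Z al3 hX hc.
  have o0 := (ord_path0 al3 oy).1.
  have oF : of_order al 0 (fun s t => F (y s)) by apply: ord_compose0 o0 => M; exact: cbd_le (cbdF M).
  have r2 := controlled_expand hZ hc ey' oF.
  have oQ := ord_compose1 al3 cbdQ oy; have oF0 := ord_compose1 al3 cbdF0 oy.
  have hG' u x : (frechet F (y u) \o (Y u).2)%VF x = second_field F (y u) (Z' u x).
    by rewrite !comp_lfunE ey' comp_lfunE.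
  have [y0 hy] := equation_davie al3 al2 hX hZ (ord_FQ oy r2) oQ hG' oF0 ey.
  have ephi : y = phi w.
    rewrite -y0; apply: (flow_unique gphi) => T; have [K _ hK] := hy T; exists K; exact: hK.
  apply/funext => t; rewrite [LHS]surjective_pairing ey' -/(y t).
  by have -> : y t = phi w t by rewrite ephi.
have [r1 r2] := ord_phi w.
have oQ := ord_compose1 al3 cbdQ r1; have oF0 := ord_compose1 al3 cbdF0 r1.
have hG' u x : (frechet F (phi w u) \o (F (phi w u) \o Z' u))%VF x = second_field F (phi w u) (Z' u x).
  by rewrite !comp_lfunE.
have [c1 c2] := davie_equation al3 al2 hX hZ (ord_FQ r1 r2) oQ hG' oF0 (flow0 gphi w) r1 r2 (ord_phi3 w).
by split.
Qed.

Lemma rde_solutionE w : rde_solution al X XX Z Z' F F0 w =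
  (fun t => (phi w t, (F (phi w t) \o Z' t)%VF)).
Proof.
have : unique (solves_rde al X XX Z Z' F F0 w) (rde_solution al X XX Z Z' F F0 w).
  apply: getPex; exists (fun t => (phi w t, (F (phi w t) \o Z' t)%VF)).
  by split=> [|Y /solves_rdeP ->//]; exact/solves_rdeP.
by move=> [/solves_rdeP].
Qed.

Local Notation Dphi := (Dphi al3 rA1 gphi).

Section Variation.
Variables (w : W) (eta : R -> W).
Local Notation y := (phi w).
Local Notation H := (fun r => (y r, eta r)).
Local Notation G := (fun r => frechet F (y r) (eta r)).
Local Notation q := (fun r => frechet (second_field F) (y r) (eta r)).
Local Notation g := (fun r => frechet F0 (y r) (eta r)).

Lemma ord_DF0 : of_order al 0 (fun s t => eta s) ->
  [/\ of_order al 0 (fun s t => G s), of_order al 0 (fun s t => q s) & of_order al 0 (fun s t => g s)].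
Proof.
move=> o0; have b := ord_pair (ord_phi0 w) o0; split.
- by apply: (ord_compose0 (K := fun p : W * W => frechet F p.1 p.2) _ b) => M; exact: cbd_le (cbdDF M).
- by apply: (ord_compose0 (K := fun p : W * W => frechet (second_field F) p.1 p.2) _ b) => M; exact: cbd_le (cbdDQ M).
- by apply: (ord_compose0 (K := fun p : W * W => frechet F0 p.1 p.2) _ b) => M; exact: cbd_le (cbdDF0 M).
Qed.

(** The pair of the solution and its variation is expanded along Z, and (y, h) |-> DF(y)h is
    composed with it; frechetQE identifies the result with the derivative of Q. *)
Lemma ord_DFQ : of_order al 1 (incr eta) ->
  of_order al 2 (fun s t => incr eta s t - G s (incr Z s t)) ->
  [/\ of_order al 2 (fun s t => incr G s t - q s (incr Z s t)), of_order al 1 (incr q) &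
      of_order al 1 (incr g)].
Proof.
have [p1 p2] := ord_phi w; move=> r1 r2.
have h1 : of_order al 1 (incr H) := ord_pair p1 r1.
have h2 : of_order al 2 (fun s t => incr H s t - (F (y s) (incr Z s t), G s (incr Z s t))) :=
  ord_pair p2 r2.
split; last 2 first.
- exact: (ord_compose1 al3 cbdDQ h1).
- exact: (ord_compose1 al3 cbdDF0 h1).
apply: ord_ext (ord_compose2 al3 cbdDF h1 h2) => s t _; congr (_ - _).
have d := @diff_frechet_eval R W 'Hom(U, W) F (y s, eta s) (diff_DF (y s)).
by rewrite (frechet_isd _ d)/= frechetQE addrC.
Qed.

Lemma variation_ord : (forall T, exists K, davie_lin al germ T K y eta) <->
  of_order al 3 (fun s t => incr eta s t -
    (G s (incr Z s t) + area s t (q s) + (t - s) *: g s)).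
Proof.
split=> h T.
  have [K hK] := h T; exists `|K| => // s t Ts st tT.
  rewrite -germ_diff; apply: le_trans (hK s t Ts st tT) _.
  by rewrite ler_wpM2r ?exprn_ge0 ?lw_ge0// ler_norm.
have [K _ hK] := h T; exists K => s t Ts st tT; rewrite germ_diff; exact: hK.
Qed.

End Variation.

Lemma variational_deriv y eta (y' eta' : R -> 'Hom(V, W)) :
  (forall t, y' t = (F (y t) \o Z' t)%VF) ->
  (forall t, eta' t = (frechet F (y t) (eta t) \o Z' t)%VF) ->
  forall u x, linfun (fun v : V => frechet (frechet F) (y u) (y' u v) (eta u)
               + frechet F (y u) (eta' u v)) x = frechet (second_field F) (y u) (eta u) (Z' u x).
Proof.
move=> ey' ee' u x; rewrite linfun_lin.
  by rewrite ey' ee' !comp_lfunE frechetQE.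
move=> a v1 v2; rewrite !linearP add_lfunE scale_lfunE; vring.
Qed.

(** As for solves_rdeP, with the tangent germ: a solution is a variation along the flow, and variations
    with a given initial value are unique. *)
Lemma solves_variationalP w (y' : R -> 'Hom(V, W)) xi (x : R -> W * 'Hom(V, W)) :
  (forall t, y' t = (F (phi w t) \o Z' t)%VF) ->
  solves_variational al X XX Z Z' F F0 (phi w) y' xi x <->
  x = (fun t => (Dphi w xi t, (frechet F (phi w t) (Dphi w xi t) \o Z' t)%VF)).
Proof.
move=> ey'; split=> [[hc ex ex']|->].
  pose eta t := (x t).1.
  have oe : of_order al 1 (incr eta) := ord_Z al3 hX hc.
  have [b1 b2 b3] := ord_DF0 w (ord_path0 al3 oe).1.
  have r2 := controlled_expand hZ hc ex' b1.
  have [h1 h2 h3] := ord_DFQ oe r2.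
  have [e0 he] := equation_davie al3 al2 hX hZ h1 h2 (variational_deriv ey' ex') h3 ex.
  have eD : eta = Dphi w xi.
    apply: (variation_unique al3 rA1 gphi (w := w)); last by rewrite Dphi0.
      exact/variation_ord.
    exact: DphiP.
  apply/funext => t; rewrite [LHS]surjective_pairing ex' -/(eta t).
  by have -> : eta t = Dphi w xi t by rewrite eD.
pose eta := Dphi w xi.
have he := (variation_ord w eta).1 (DphiP al3 rA1 gphi w xi).
have oe0 : of_order al 0 (fun s t => eta s).
  move=> T; have [K K0 hK] := flow_bound (tangent_flow al3 rA1 gphi) T `|(w, xi)|.
  exists K => // s t Ts st tT; rewrite expr0 mulr1.
  have [_ /(_ s Ts (le_trans st tT))] := hK (w, xi) (lexx _).
  by rewrite prod_normE/= ge_max => /andP[].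
have [b1 b2 b3] := ord_DF0 w oe0.
have [r1 r2] := davie_expand al3 al2 hX hZ b1 b2 b3 he.
have [h1 h2 h3] := ord_DFQ r1 r2.
have [c1 c2] := davie_equation al3 al2 hX hZ h1 h2
  (variational_deriv (eta := eta) ey' (fun t => erefl)) h3 (Dphi0 al3 rA1 gphi w xi) r1 r2 he.
by split.
Qed.

Lemma phi_cbd t M : cbd one k (cball M) (fun _ w => phi w t).
Proof. exact: (flow_smooth al3 gphi (germ_regular al3 al2 hX hZ hF hF0)). Qed.

Lemma state_cbd t M : cbd one k (cball M)
  (fun _ (p : W * 'Hom(V, W)) => (phi p.1 t, (F (phi p.1 t) \o Z' t)%VF)).
Proof.
have c1 : cbd one k (cball M) (fun _ (p : W * 'Hom(V, W)) => phi p.1 t).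
  apply: (cbd_precomp (B := cball M) (f := fun _ w => phi w t) (@linear_fst R W 'Hom(V, W))).
    by move=> p /cball_pair[].
  exact: phi_cbd.
apply: cbd_pair => //; apply: (cbd_lin (@comp_linear1 R V U W (Z' t))).
apply: (cbd_comp (B' := [set: W]) (f := fun=> F)) c1 => //.
by apply: (cbd_le _ (cbd_F hF unit)); rewrite -addn3 leq_addr.
Qed.

Lemma state_diff t (p : W * 'Hom(V, W)) :
  is_diff p (fun p => (phi p.1 t, (F (phi p.1 t) \o Z' t)%VF))
    (fun xi => (Dphi p.1 xi.1 t, (frechet F (phi p.1 t) (Dphi p.1 xi.1 t) \o Z' t)%VF)).
Proof.
have h1 := isd_comp (isd_lin p (@linear_fst R W 'Hom(V, W))) (flow_isd al3 rA1 gphi p.1 t).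
apply: (isd_pair h1); have h2 := isd_comp h1 (isd_frechet (diffF (phi p.1 t))).
exact: (isd_comp h2 (isd_lin _ (@comp_linear1 R V U W (Z' t)))).
Qed.

End Solutions.

Theorem proposition3p13 (R : realType) (d : measure_display)
    (Omega : measurableType d) (P : probability Omega R)
    (theta : R -> Omega -> Omega) (U V W : normedVectType R) (alpha : R)
    (X : Omega -> R -> V) (XX : Omega -> R -> R -> tensor V)
    (Z : Omega -> R -> U) (Z' : Omega -> R -> 'Hom(V, U))
    (k : nat) (F : W -> 'Hom(U, W)) (F0 : W -> W) :
  3^-1 < alpha -> alpha <= 2^-1 ->
  invertible_mpds P theta ->
  rough_path_cocycle theta alpha X XX ->
  controlled_cocycle theta alpha X Z Z' ->
  (1 <= k)%N -> Cbk (k + 3) F -> Cbk (k + 1) F0 ->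
  let phi := solution_map alpha X XX Z Z' F F0 in
  (forall (t : R) (omega : Omega), Ck k (phi t omega)) /\
  (forall (omega : Omega) (y xi : W * 'Hom(V, W)),
     unique
       (solves_variational alpha (X omega) (XX omega) (Z omega) (Z' omega) F F0
          (fun t => (phi t omega y).1) (fun t => (phi t omega y).2) xi.1)
       (fun t => 'd (phi t omega) y xi)).
Proof.
move=> al3 al2 _ cX cZ k0 hF hF0 Phi.
have hX omega := rpc_rough_path cX omega; have hZ omega := cc_controlled cZ omega.
have flow omega := rde_flow al3 al2 (hX omega) (hZ omega) hF hF0 k0.
have PhiE omega phi t : davie_flow alpha (germ (XX omega) (Z omega) (Z' omega) F F0) phi ->
    Phi t omega = (fun p => (phi p.1 t, (F (phi p.1 t) \o Z' omega t)%VF)).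
  move=> gphi; apply/funext => p; rewrite /Phi /solution_map.
  by rewrite (rde_solutionE al3 al2 (hX omega) (hZ omega) hF hF0 gphi).
split=> [t omega|omega y xi]; have [phi gphi] := flow omega.
  rewrite (PhiE _ _ _ gphi); apply: cbd_Ck => M.
  exact: (state_cbd al3 al2 (hX omega) (hZ omega) hF hF0 gphi).
pose rA := regular_germ_le k0 (germ_regular al3 al2 (hX omega) (hZ omega) hF hF0).
pose eta := Dphi al3 rA gphi y.1 xi.1.
have -> : (fun t => 'd (Phi t omega) y xi) =
    (fun t => (eta t, (frechet F (phi y.1 t) (eta t) \o Z' omega t)%VF)).
  apply/funext => t; rewrite (PhiE _ _ _ gphi).
  have h := state_diff al3 al2 (hX omega) (hZ omega) k0 hF hF0 gphi t y.
  exact: (congr1 (fun f => f xi) (@diff_val _ _ _ _ _ _ _ h)).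
have -> : (fun t => (Phi t omega y).1) = phi y.1.
  by apply/funext => t; rewrite (PhiE _ _ _ gphi).
have ey' t : (Phi t omega y).2 = (F (phi y.1 t) \o Z' omega t)%VF.
  by rewrite (PhiE _ _ _ gphi).
have iff x := solves_variationalP al3 al2 (hX omega) (hZ omega) k0 hF hF0 gphi xi.1 x ey'.
by split=> [|x /iff ->//]; exact/iff.
Qed.
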